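(* Let $\varphi_S(z):=1+\sin z$ for $z\in\mathbb{D}$, let $\varphi_{Ne}(z):=1+z-z^3/3$, let $p\in\mathcal{H}$ satisfy $p(0)=1$, and let $\beta\in\mathbb{R}$. Each of the following subordinations implies $p\prec\varphi_{Ne}$: (a) $1+\beta zp'(z)\prec\varphi_S(z)$, for $\beta\geq\dfrac32\displaystyle\sum_{n=0}^{\infty}\frac{(-1)^n}{(2n+1)!\,(2n+1)}\approx1.41912$; (b) $1+\beta\,\dfrac{zp'(z)}{p(z)}\prec\varphi_S(z)$, for $\beta\geq\dfrac{1}{\log(5/3)}\displaystyle\sum_{n=0}^{\infty}\frac{(-1)^n}{(2n+1)!\,(2n+1)}\approx1.85207$; (c) $1+\beta\,\dfrac{zp'(z)}{p^2(z)}\prec\varphi_S(z)$, for $\beta\geq\dfrac52\displaystyle\sum_{n=0}^{\infty}\frac{(-1)^n}{(2n+1)!\,(2n+1)}\approx2.36521$. The estimates on $\beta$ cannot be improved.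
   Context: $\mathbb{D}=\{z\in\mathbb{C}:|z|<1\}$ and $\mathcal{H}$ is the set of all analytic functions on $\mathbb{D}$. For $f,g\in\mathcal{H}$, $f\prec g$ ($f$ is subordinate to $g$) means that there is $w\in\mathcal{H}$ with $w(0)=0$ and $|w(z)|<1$ for $z\in\mathbb{D}$ such that $f(z)=g(w(z))$ on $\mathbb{D}$; in particular, writing a subordination presupposes that both sides are analytic in $\mathbb{D}$. $\log$ of a positive number is the natural logarithm. That an estimate $\beta\ge\beta_0$ cannot be improved means that $\beta_0$ cannot be replaced by any smaller real number so that the implication remains valid for all such $p$ and all $\beta$ at least that number. *)

(* Defs.v *)
From Stdlib Require Import Reals Factorial.
From Coquelicot Require Import Coquelicot.
Open Scope R_scope.

Definition in_disk (z : C) : Prop := Cmod z < 1.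

(* Functions on the disk are represented by total functions [C -> C], whose
   values outside the disk are irrelevant.  Analytic means complex
   differentiable at every point of the disk; [C_derive p z] is then the
   complex derivative of [p] at [z]. *)
Definition analytic_on_disk (f : C -> C) : Prop :=
  forall z : C, in_disk z -> ex_derive (K := C_AbsRing) (V := C_NormedModule) f z.

Definition subordinate (f g : C -> C) : Prop :=
  analytic_on_disk f /\ analytic_on_disk g /\
  exists w : C -> C,
    analytic_on_disk w /\ w (RtoC 0) = RtoC 0 /\
    (forall z : C, in_disk z -> Cmod (w z) < 1) /\
    (forall z : C, in_disk z -> f z = g (w z)).

Definition Cexp (z : C) : C := (exp (Re z) * cos (Im z), exp (Re z) * sin (Im z)).

Definition Csin (z : C) : C := ((Cexp (Ci * z) - Cexp (- (Ci * z))) / (2 * Ci))%C.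

Definition phi_S (z : C) : C := (1 + Csin z)%C.

Definition phi_Ne (z : C) : C := (1 + z - z ^ 3 / 3)%C.

Definition subord_a (beta : R) (p : C -> C) : Prop :=
  subordinate (fun z => (1 + beta * (z * C_derive p z))%C) phi_S.

(* Below, the left-hand side with [p] in a denominator has to be a function on the whole disk, so
   [p] has no zero there.  This is stated because division in [C] is total;
   for [beta <> 0] it already follows from analyticity, the quotient being
   unbounded near a zero of [p]. *)
Definition subord_b (beta : R) (p : C -> C) : Prop :=
  (forall z : C, in_disk z -> p z <> RtoC 0) /\
  subordinate (fun z => (1 + beta * (z * C_derive p z / p z))%C) phi_S.

Definition subord_c (beta : R) (p : C -> C) : Prop :=
  (forall z : C, in_disk z -> p z <> RtoC 0) /\
  subordinate (fun z => (1 + beta * (z * C_derive p z / (p z) ^ 2))%C) phi_S.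

Definition implication_from (hyp : R -> (C -> C) -> Prop) (b : R) : Prop :=
  forall (p : C -> C) (beta : R),
    analytic_on_disk p -> p (RtoC 0) = RtoC 1 -> b <= beta ->
    hyp beta p -> subordinate p phi_Ne.

Definition sine_sum : R :=
  Series (fun n : nat => (-1) ^ n / (INR (fact (2 * n + 1)) * INR (2 * n + 1))).

Definition beta_a : R := 3 / 2 * sine_sum.
Definition beta_b : R := 1 / ln (5 / 3) * sine_sum.
Definition beta_c : R := 5 / 2 * sine_sum.

(* Main.v *)
(* Let nu(x) be 1, 1/x or 1/x^2.  The hypothesis reads beta z p'(z) nu(p(z)) = sin w(z), where
   |w(z)| <= |z| by Schwarz's lemma.  Let V be beta times Re(p - 1), ln |p| or Re(1 - 1/p), so that
   sin w(z) has real part r dV/dr and imaginary part minus the angular derivative of V.  Where V is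
   maximal on a circle |z| = r, sin w is therefore real, hence at most sin r, so V grows at most like
   Si(r), the integral of sin t / t up to r; the same holds for -V.
   With the bound |Im sin w| <= sinh 1 |w| along rays, this confines p to the rectangle
   |Re p - 1| < 2/3, |Im p| < 1.065, which lies inside the nephroid domain, where phi_Ne has a
   differentiable inverse.

   Functions in the hypotheses are only assumed complex differentiable once.  Schwarz's lemma is
   nevertheless obtained from the second derivative test, because the equation above makes p twice
   differentiable off 0 and w a local uniform limit of twice differentiable functions, namely
   arcsines of expressions in difference quotients of p.

   For sharpness take w(z) = z, that is p = 1 + Si/beta, exp(Si/beta) or 1/(1 - Si/beta) with the
   complex sine integral Si: below the critical beta, p takes a real value beyond the cusp 5/3. *)
Require Import Defs.
From Stdlib Require Import Reals.
From Coquelicot Require Import Coquelicot.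
From Stdlib Require Import Lra Lia Psatz ClassicalEpsilon List Factorial.
Open Scope R_scope.

(** * Complex derivatives *)

(** The three critical values share one origin. Since [|V|] stays below [Si(1) = sine_sum], dividing
    by beta leaves half-lengths 2/3, ln (5/3) and 2/5 for Re (p - 1), ln |p| and Re (1 - 1/p), and 1
    + 2/3 = exp (ln (5/3)) = 1 / (1 - 2/5) = 5/3 is the right cusp of the nephroid. The opposite end
    is tight only in case (a), where 1/3 is the left cusp. The estimate of V must be exact, because
    the extremal functions approach [sine_sum]. Integrating a pointwise bound of Re sin w along a
    ray would not give it: Re sin (x + i y) = sin x cosh y, and once r tan r > 1, which happens
    before r = 1, its maximum on |w| = r exceeds sin r and lies off the real axis. Comparing with
    the whole circle forces sin w to be real at the decisive point and removes this excess. The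
    imaginary direction has enough slack for a ray estimate. All bounds on Re p are strict since |z|
    < 1; this keeps the values of p away from the cusps, where the derivative 1 - w^2 of [phi_Ne]
    vanishes and no differentiable inverse exists. *)

Notation Cder := (is_derive (K := C_AbsRing) (V := C_NormedModule)).

Lemma Cder_eps (f : C -> C) (z l : C) :
  Cder f z l <->
  (forall eps, 0 < eps -> exists d, 0 < d /\ forall y, Cmod (y - z) < d ->
     Cmod (f y - f z - (y - z) * l) <= eps * Cmod (y - z)).
Proof.
split.
- intros [_ H] eps He.
  destruct (H z (fun P HP => HP) (mkposreal eps He)) as [d Hd].
  exists d; split; [apply cond_pos|]. intros y Hy. exact (Hd y Hy).
- intros H; split.
  + apply is_linear_scal_l.
  + intros x Hx eps.
    assert (Hxz : z = x) by (apply (is_filter_lim_locally_unique (K:=C_AbsRing) (V:=AbsRing_NormedModule C_AbsRing)); exact Hx).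
    subst x.
    destruct (H eps (cond_pos eps)) as [d [Hd0 Hd]].
    exists (mkposreal d Hd0). intros y Hy. exact (Hd y Hy).
Qed.

(** [C] carries two normed-module structures over itself, and the product and chain rules involve
    the one induced by the ring. Linearity is that of scalar multiplication in both, and the
    remainder estimates are convertible. *)
Lemma Cder_AbsRing (f : C -> C) (z l : C) :
  Cder f z l <-> is_derive (K := C_AbsRing) (V := AbsRing_NormedModule C_AbsRing) f z l.
Proof.
split; intros [H1 H2]; (split; [apply is_linear_scal_l|exact H2]).
Qed.

Lemma Cder_mult (f g : C -> C) (z a b : C) :
  Cder f z a -> Cder g z b -> Cder (fun x => f x * g x)%C z (a * g z + f z * b)%C.
Proof.
intros Hf Hg.
apply Cder_AbsRing.
exact (is_derive_mult (K := C_AbsRing) f g z a b (proj1 (Cder_AbsRing _ _ _) Hf) (proj1 (Cder_AbsRing _ _ _) Hg) Cmult_comm).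
Qed.

Lemma Cder_comp (f g : C -> C) (z a b : C) :
  Cder f (g z) a -> Cder g z b -> Cder (fun x => f (g x)) z (b * a)%C.
Proof.
intros Hf Hg.
exact (is_derive_comp (K := C_AbsRing) (V := C_NormedModule) f g z a b Hf (proj1 (Cder_AbsRing _ _ _) Hg)).
Qed.

Lemma Cder_plus (f g : C -> C) (z a b : C) :
  Cder f z a -> Cder g z b -> Cder (fun x => f x + g x)%C z (a + b)%C.
Proof. exact (is_derive_plus (K := C_AbsRing) (V := C_NormedModule) f g z a b). Qed.

Lemma Cder_opp (f : C -> C) (z a : C) : Cder f z a -> Cder (fun x => - f x)%C z (- a)%C.
Proof. exact (is_derive_opp (K := C_AbsRing) (V := C_NormedModule) f z a). Qed.

Lemma Cder_minus (f g : C -> C) (z a b : C) :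
  Cder f z a -> Cder g z b -> Cder (fun x => f x - g x)%C z (a - b)%C.
Proof. exact (is_derive_minus (K := C_AbsRing) (V := C_NormedModule) f g z a b). Qed.

Lemma Cder_const (c z : C) : Cder (fun _ => c) z (RtoC 0).
Proof. exact (is_derive_const (K := C_AbsRing) (V := C_NormedModule) c z). Qed.

Lemma Cder_id (z : C) : Cder (fun x => x) z (RtoC 1).
Proof. apply Cder_AbsRing. exact (is_derive_id (K := C_AbsRing) z). Qed.

Lemma Cder_eq (f : C -> C) (z l l' : C) : l = l' -> Cder f z l -> Cder f z l'.
Proof. now intros ->. Qed.

Lemma Cder_ext_near (f g : C -> C) (z l : C) (d : R) : 0 < d ->
  (forall y, Cmod (y - z) < d -> f y = g y) -> Cder f z l -> Cder g z l.
Proof.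
intros Hd Heq. apply (is_derive_ext_loc (K := C_AbsRing) (V := C_NormedModule) f g z l).
exists (mkposreal d Hd). intros y Hy. exact (Heq y Hy).
Qed.

Lemma Cder_cont (f : C -> C) (z l : C) : Cder f z l ->
  forall eps, 0 < eps -> exists d, 0 < d /\ forall y, Cmod (y - z) < d -> Cmod (f y - f z) < eps.
Proof.
intros H eps He. rewrite Cder_eps in H.
destruct (H 1 Rlt_0_1) as [d [Hd0 Hd]].
pose proof (Cmod_ge_0 l) as Hl.
exists (Rmin d (eps / (2 + Cmod l))). split.
- apply Rmin_glb_lt; [easy|]. apply Rdiv_lt_0_compat; lra.
- intros y Hy.
  assert (H1 := Rlt_le_trans _ _ _ Hy (Rmin_l _ _)).
  assert (H2 := Rlt_le_trans _ _ _ Hy (Rmin_r _ _)).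
  specialize (Hd y H1).
  replace (f y - f z)%C with ((f y - f z - (y - z) * l) + (y - z) * l)%C by ring.
  eapply Rle_lt_trans; [apply Cmod_triangle|]. rewrite Cmod_mult.
  apply (Rmult_lt_compat_r (2 + Cmod l)) in H2; [|lra].
  unfold Rdiv in H2. rewrite Rmult_assoc, Rinv_l, Rmult_1_r in H2 by lra.
  pose proof (Cmod_ge_0 (y - z)). nra.
Qed.

Lemma Cmod_tri_inv (x y : C) : Cmod x - Cmod y <= Cmod (x - y).
Proof.
assert (H := Cmod_triangle (x - y) y). replace (x - y + y)%C with x in H by ring. lra.
Qed.

Lemma Cmod_minus_sym (x y : C) : Cmod (x - y) = Cmod (y - x).
Proof. rewrite <- Cmod_opp. f_equal. ring. Qed.

(* The last hypothesis, that [f] expands distances from [W z], stands in for the continuity of the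
   branch [W] of the inverse of [f]. *)
Lemma Cder_lift (f F W : C -> C) (z m l : C) (c d : R) :
  0 < c -> 0 < d ->
  Cder f (W z) m -> m <> 0 -> Cder F z l ->
  (forall y, Cmod (y - z) < d -> f (W y) = F y) ->
  (forall y, Cmod (y - z) < d -> c * Cmod (W y - W z) <= Cmod (f (W y) - f (W z))) ->
  Cder W z (l / m)%C.
Proof.
intros Hc Hd Hf Hm HF Heq Hexp.
assert (Hm0 : 0 < Cmod m) by now apply Cmod_gt_0.
assert (Hzz : Cmod (z - z) < d) by (replace (z - z)%C with (RtoC 0) by ring; rewrite Cmod_0; easy).
pose proof (Cmod_ge_0 l) as Hl0.
assert (HFz := Heq z Hzz).
set (L := (1 + Cmod l) / c).
assert (HL0 : 0 < L) by (apply Rdiv_lt_0_compat; lra).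
assert (HL : exists d1, 0 < d1 <= d /\ forall y, Cmod (y - z) < d1 -> Cmod (W y - W z) <= L * Cmod (y - z)).
{ destruct (proj1 (Cder_eps F z l) HF 1 Rlt_0_1) as [d1 [Hd1 H1]].
  exists (Rmin d d1). split; [split; [now apply Rmin_glb_lt|apply Rmin_l]|].
  intros y Hy.
  assert (Hya := Rlt_le_trans _ _ _ Hy (Rmin_l _ _)).
  assert (Hyb := Rlt_le_trans _ _ _ Hy (Rmin_r _ _)).
  specialize (Hexp y Hya). rewrite (Heq y Hya), HFz in Hexp.
  specialize (H1 y Hyb).
  assert (Hb : Cmod (F y - F z) <= (1 + Cmod l) * Cmod (y - z)).
  { replace (F y - F z)%C with ((F y - F z - (y - z) * l) + (y - z) * l)%C by ring.
    eapply Rle_trans; [apply Cmod_triangle|]. rewrite Cmod_mult. lra. }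
  unfold L. apply (Rmult_le_reg_l c); [easy|].
  replace (c * ((1 + Cmod l) / c * Cmod (y - z))) with ((1 + Cmod l) * Cmod (y - z)) by (field; lra).
  lra. }
destruct HL as [d1 [[Hd1 Hd1d] HL]].
apply Cder_eps. intros eps He.
assert (He1 : 0 < eps * Cmod m / (2 * L)) by (apply Rdiv_lt_0_compat; nra).
assert (He2 : 0 < eps * Cmod m / 2) by nra.
destruct (proj1 (Cder_eps f (W z) m) Hf _ He1) as [d2 [Hd2 H2]].
destruct (proj1 (Cder_eps F z l) HF _ He2) as [d3 [Hd3 H3]].
exists (Rmin d1 (Rmin (d2 / L) d3)).
split; [repeat apply Rmin_glb_lt; try easy; now apply Rdiv_lt_0_compat|].
intros y Hy.
assert (Hy1 := Rlt_le_trans _ _ _ Hy (Rmin_l _ _)).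
assert (Hy23 := Rlt_le_trans _ _ _ Hy (Rmin_r _ _)).
assert (Hy2 := Rlt_le_trans _ _ _ Hy23 (Rmin_l _ _)).
assert (Hy3 := Rlt_le_trans _ _ _ Hy23 (Rmin_r _ _)).
specialize (HL y Hy1). specialize (H3 y Hy3).
assert (HW : Cmod (W y - W z) < d2).
{ apply Rle_lt_trans with (1 := HL). apply (Rmult_lt_compat_l L) in Hy2; [|easy].
  replace (L * (d2 / L)) with d2 in Hy2 by (field; lra). easy. }
specialize (H2 _ HW). rewrite (Heq y), HFz in H2 by lra.
assert (E : (W y - W z - (y - z) * (l / m) =
  ((F y - F z - (y - z) * l) - (F y - F z - (W y - W z) * m)) / m)%C) by (field; easy).
rewrite E, Cmod_div by easy.
apply (Rmult_le_reg_r (Cmod m)); [easy|].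
unfold Rdiv. rewrite Rmult_assoc, Rinv_l, Rmult_1_r by lra.
assert (Htri := Cmod_triangle (F y - F z - (y - z) * l) (- (F y - F z - (W y - W z) * m))).
rewrite Cmod_opp in Htri. unfold Cminus at 1.
eapply Rle_trans; [exact Htri|].
assert (H4 : eps * Cmod m / (2 * L) * Cmod (W y - W z) <= eps * Cmod m / 2 * Cmod (y - z)).
{ apply (Rmult_le_compat_l (eps * Cmod m / (2 * L))) in HL; [|lra].
  replace (eps * Cmod m / (2 * L) * (L * Cmod (y - z))) with (eps * Cmod m / 2 * Cmod (y - z)) in HL
    by (field; lra). easy. }
lra.
Qed.

Lemma Cder_inv (g : C -> C) (z b : C) :
  Cder g z b -> g z <> 0 -> Cder (fun x => / g x)%C z (- b / (g z * g z))%C.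
Proof.
intros Hg Hz.
assert (Hi : Cder (fun x => / x)%C (g z) (- (1) / (g z * g z))%C).
{ apply Cder_eps. intros eps He.
  set (a := g z) in *. assert (Ha : 0 < Cmod a) by now apply Cmod_gt_0.
  (* The remainder is [(y - a)^2 / (y * a^2)]. The first radius keeps [|y|] above [|a| / 2]; the
     second then makes the remainder at most [eps * |y - a|]. *)
  exists (Rmin (Cmod a / 2) (eps * (Cmod a * Cmod a * Cmod a) / 2)).
  split; [apply Rmin_glb_lt; [lra|]; assert (0 < Cmod a * Cmod a * Cmod a) by (repeat apply Rmult_lt_0_compat; easy); nra|].
  intros y Hy.
  assert (Hy1 := Rlt_le_trans _ _ _ Hy (Rmin_l _ _)).
  assert (Hy2 := Rlt_le_trans _ _ _ Hy (Rmin_r _ _)).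
  assert (Hyn : Cmod a / 2 < Cmod y).
  { assert (H := Cmod_tri_inv a y). rewrite Cmod_minus_sym in H. lra. }
  assert (Hy0 : y <> 0) by (apply Cmod_gt_0; lra).
  replace (/ y - / a - (y - a) * (- (1) / (a * a)))%C with ((y - a) * (y - a) / (y * (a * a)))%C
    by (field; split; easy).
  rewrite Cmod_div by (repeat apply Cmult_neq_0; easy).
  rewrite !Cmod_mult.
  pose proof (Cmod_ge_0 (y - a)).
  assert (Hp : 0 < Cmod y * (Cmod a * Cmod a)) by (repeat apply Rmult_lt_0_compat; lra).
  apply (Rmult_le_reg_r (Cmod y * (Cmod a * Cmod a))); [easy|].
  unfold Rdiv. rewrite Rmult_assoc, Rinv_l, Rmult_1_r by lra.
  assert (Hq : Cmod (y - a) <= eps * (Cmod y * (Cmod a * Cmod a))).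
  { assert (0 < Cmod a * Cmod a) by nra.
    assert (eps * (Cmod a / 2 * (Cmod a * Cmod a)) <= eps * (Cmod y * (Cmod a * Cmod a))).
    { apply Rmult_le_compat_l; [lra|]. apply Rmult_le_compat_r; lra. }
    lra. }
  nra. }
assert (H := Cder_comp _ g z _ b Hi Hg).
refine (Cder_eq _ _ _ _ _ H). field. easy.
Qed.

Lemma Cder_div (f g : C -> C) (z a b : C) :
  Cder f z a -> Cder g z b -> g z <> 0 ->
  Cder (fun x => f x / g x)%C z ((a * g z - f z * b) / (g z * g z))%C.
Proof.
intros Hf Hg Hz.
refine (Cder_eq _ _ _ _ _ (Cder_mult _ _ _ _ _ Hf (Cder_inv _ _ _ Hg Hz))).
field; easy.
Qed.

Lemma is_derive_eps (g : R -> R) (t m : R) :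
  is_derive g t m <->
  (forall eps, 0 < eps -> exists d, 0 < d /\ forall y, Rabs (y - t) < d ->
     Rabs (g y - g t - (y - t) * m) <= eps * Rabs (y - t)).
Proof.
split.
- intros [_ H] eps He. destruct (H t (fun P HP => HP) (mkposreal eps He)) as [d Hd].
  exists d; split; [apply cond_pos|]. intros y Hy. exact (Hd y Hy).
- intros H; split; [apply is_linear_scal_l|].
  intros t' Ht eps.
  assert (E : t = t') by (apply (is_filter_lim_locally_unique (K:=R_AbsRing) (V:=R_NormedModule)); exact Ht).
  subst t'. destruct (H eps (cond_pos eps)) as [d [Hd0 Hd]].
  exists (mkposreal d Hd0). intros y Hy. exact (Hd y Hy).
Qed.

(** Mean value and extremum arguments concern real functions of a real variable, so both components
    are differentiated along a curve given by its coordinates. The remainder is first estimated in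
    [C] and then projected. *)
Lemma Cder_path (f : C -> C) (z l : C) (g1 g2 : R -> R) (t a b : R) :
  Cder f z l -> is_derive g1 t a -> is_derive g2 t b -> (g1 t, g2 t) = z ->
  is_derive (fun s => Re (f (g1 s, g2 s))) t (Re (l * (a, b))) /\
  is_derive (fun s => Im (f (g1 s, g2 s))) t (Im (l * (a, b))).
Proof.
intros Hf H1 H2 Hz.
assert (Hg : forall eps, 0 < eps -> exists d, 0 < d /\ forall y, Rabs (y - t) < d ->
   Cmod ((g1 y, g2 y) - z - RtoC (y - t) * (a, b)) <= eps * Rabs (y - t)).
{ intros eps He. assert (He2 : 0 < eps / 2) by lra.
  destruct (proj1 (is_derive_eps _ _ _) H1 _ He2) as [d1 [Hd1 K1]].
  destruct (proj1 (is_derive_eps _ _ _) H2 _ He2) as [d2 [Hd2 K2]].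
  exists (Rmin d1 d2). split; [now apply Rmin_glb_lt|]. intros y Hy.
  specialize (K1 y (Rlt_le_trans _ _ _ Hy (Rmin_l _ _))).
  specialize (K2 y (Rlt_le_trans _ _ _ Hy (Rmin_r _ _))).
  subst z.
  replace ((g1 y, g2 y) - (g1 t, g2 t) - RtoC (y - t) * (a, b))%C with
    (RtoC (g1 y - g1 t - (y - t) * a) + Ci * RtoC (g2 y - g2 t - (y - t) * b))%C
    by (apply injective_projections; simpl; ring).
  eapply Rle_trans; [apply Cmod_triangle|]. rewrite Cmod_mult, Cmod_Ci, !Cmod_R. lra. }
assert (Hc : forall eps, 0 < eps -> exists d, 0 < d /\ forall y, Rabs (y - t) < d ->
   Cmod (f (g1 y, g2 y) - f (g1 t, g2 t) - RtoC (y - t) * (l * (a, b))) <= eps * Rabs (y - t)).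
{ intros eps He.
  set (A := Cmod (a, b)). pose proof (Cmod_ge_0 (a, b)) as HA; fold A in HA.
  pose proof (Cmod_ge_0 l) as Hl.
  assert (Hf' := proj1 (Cder_eps _ _ _) Hf).
  destruct (Hf' (eps / (2 * (1 + A)))) as [d1 [Hd1 K1]]; [apply Rdiv_lt_0_compat; lra|].
  (* The bound 1 makes the curve Lipschitz at [t] with constant [1 + A]; the other bound absorbs the
     factor [|l|]. *)
  destruct (Hg (Rmin 1 (eps / (2 * (1 + Cmod l))))) as [d2 [Hd2 K2]].
  { apply Rmin_glb_lt; [lra|]. apply Rdiv_lt_0_compat; lra. }
  exists (Rmin d2 (d1 / (1 + A))). split; [apply Rmin_glb_lt; [easy|apply Rdiv_lt_0_compat; lra]|].
  intros y Hy.
  specialize (K2 y (Rlt_le_trans _ _ _ Hy (Rmin_l _ _))).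
  assert (Hy1 := Rlt_le_trans _ _ _ Hy (Rmin_r _ _)).
  assert (Hm1 := Rmin_l 1 (eps / (2 * (1 + Cmod l)))).
  assert (Hm2 := Rmin_r 1 (eps / (2 * (1 + Cmod l)))).
  pose proof (Rabs_pos (y - t)) as Hp.
  assert (HG : Cmod ((g1 y, g2 y) - z) <= (1 + A) * Rabs (y - t)).
  { replace ((g1 y, g2 y) - z)%C with (((g1 y, g2 y) - z - RtoC (y - t) * (a, b)) + RtoC (y - t) * (a, b))%C by ring.
    eapply Rle_trans; [apply Cmod_triangle|]. rewrite Cmod_mult, Cmod_R. fold A. nra. }
  assert (HG' : Cmod ((g1 y, g2 y) - z) < d1).
  { apply Rle_lt_trans with (1 := HG). apply (Rmult_lt_compat_l (1 + A)) in Hy1; [|lra].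
    replace ((1 + A) * (d1 / (1 + A))) with d1 in Hy1 by (field; lra). easy. }
  specialize (K1 _ HG'). rewrite Hz.
  replace (f (g1 y, g2 y) - f z - RtoC (y - t) * (l * (a, b)))%C with
    ((f (g1 y, g2 y) - f z - ((g1 y, g2 y) - z) * l) + ((g1 y, g2 y) - z - RtoC (y - t) * (a, b)) * l)%C by ring.
  eapply Rle_trans; [apply Cmod_triangle|]. rewrite Cmod_mult.
  assert (T1 : eps / (2 * (1 + A)) * Cmod ((g1 y, g2 y) - z) <= eps / 2 * Rabs (y - t)).
  { apply (Rmult_le_compat_l (eps / (2 * (1 + A)))) in HG; [|apply Rlt_le, Rdiv_lt_0_compat; lra].
    replace (eps / (2 * (1 + A)) * ((1 + A) * Rabs (y - t))) with (eps / 2 * Rabs (y - t)) in HG by (field; lra). easy. }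
  assert (T2 : Cmod ((g1 y, g2 y) - z - RtoC (y - t) * (a, b)) * Cmod l <= eps / 2 * Rabs (y - t)).
  { assert (U : Cmod ((g1 y, g2 y) - z - RtoC (y - t) * (a, b)) <= eps / (2 * (1 + Cmod l)) * Rabs (y - t)) by nra.
    apply (Rmult_le_compat_r (1 + Cmod l)) in U; [|lra].
    replace (eps / (2 * (1 + Cmod l)) * Rabs (y - t) * (1 + Cmod l)) with (eps / 2 * Rabs (y - t)) in U by (field; lra).
    pose proof (Cmod_ge_0 ((g1 y, g2 y) - z - RtoC (y - t) * (a, b))). nra. }
  lra. }
split; apply is_derive_eps; intros eps He; destruct (Hc eps He) as [d [Hd K]]; exists d; (split; [easy|]);
  intros y Hy; specialize (K y Hy).
- eapply Rle_trans; [|exact K].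
  eapply Rle_trans; [|apply re_le_Cmod].
  apply Req_le. f_equal. unfold Re, Im. simpl. unfold Re, Im. ring.
- eapply Rle_trans; [|exact K].
  match goal with |- _ <= Cmod ?c => eapply Rle_trans; [|apply (Rle_trans _ _ _ (Rmax_r _ _) (Rmax_Cmod c))] end.
  apply Req_le. f_equal. unfold Re, Im. simpl. unfold Re, Im. ring.
Qed.

(** * Maxima on closed disks *)

Lemma Cmod_le_sum (z : C) : Cmod z <= Rabs (fst z) + Rabs (snd z).
Proof.
replace z with (RtoC (fst z) + Ci * RtoC (snd z))%C at 1
  by (apply injective_projections; simpl; ring).
eapply Rle_trans; [apply Cmod_triangle|]. rewrite Cmod_mult, Cmod_Ci, !Cmod_R. lra.
Qed.

Lemma Im_le_Cmod (z : C) : Rabs (Im z) <= Cmod z.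
Proof. exact (Rle_trans _ _ _ (Rmax_r _ _) (Rmax_Cmod z)). Qed.

Lemma continuous_eps (f : C -> R) (z : C) :
  (forall eps, 0 < eps -> exists d, 0 < d /\ forall y, Cmod (y - z) < d -> Rabs (f y - f z) < eps) ->
  continuous f z.
Proof.
intros H P [eps HP]. destruct (H eps (cond_pos eps)) as [d [Hd K]].
exists (mkposreal (d / 2) ltac:(lra)). intros y [Hy1 Hy2]. apply HP. apply (K y).
eapply Rle_lt_trans; [apply Cmod_le_sum|].
unfold ball in Hy1, Hy2; simpl in Hy1, Hy2; unfold AbsRing_ball, abs, minus, plus, opp in Hy1, Hy2; simpl in Hy1, Hy2.
unfold Rminus in *. simpl. lra.
Qed.

(** Without a maximum, every point of the disk has a neighbourhood on which [f] stays below its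
    value at some other point of the disk. Finitely many neighbourhoods cover the disk, and the
    largest of the finitely many values would lie below itself. *)
Lemma disk_max (f : C -> R) (a : C) (r : R) : 0 <= r ->
  (forall z, Cmod (z - a) <= r -> continuous f z) ->
  exists z0, Cmod (z0 - a) <= r /\ forall z, Cmod (z - a) <= r -> f z <= f z0.
Proof.
intros Hr Hc.
destruct (classic (exists z0, Cmod (z0 - a) <= r /\ forall z, Cmod (z - a) <= r -> f z <= f z0)) as [|Hn]; [easy|].
exfalso.
assert (Hlt : forall z, Cmod (z - a) <= r -> exists y, Cmod (y - a) <= r /\ f z < f y).
{ intros z Hz. destruct (classic (exists y, Cmod (y - a) <= r /\ f z < f y)) as [|H]; [easy|].
  exfalso. apply Hn. exists z. split; [easy|]. intros y Hy.
  destruct (Rle_lt_dec (f y) (f z)); [easy|]. exfalso. apply H. now exists y. }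
assert (Hd : forall z : C, exists dy : posreal * C, Cmod (snd dy - a) <= r /\
   forall x, Rabs (fst x - fst z) < fst dy -> Rabs (snd x - snd z) < fst dy ->
   Cmod (x - a) <= r -> f x < f (snd dy)).
{ intros z. destruct (Rle_lt_dec (Cmod (z - a)) r) as [Hz|Hz].
  - destruct (Hlt z Hz) as [y [Hy Hfy]].
    assert (He : 0 < f y - f z) by lra.
    destruct (Hc z Hz (fun v => v < f y)) as [d Hdd].
    { exists (mkposreal _ He). intros v Hv. 
      unfold ball in Hv; simpl in Hv; unfold AbsRing_ball, abs, minus, plus, opp in Hv; simpl in Hv.
      apply Rabs_def2 in Hv. lra. }
    exists (d, y). split; [easy|]. intros x H1 H2 _. apply Hdd. split; [exact H1|exact H2].
  (* Compactness is applied to a square, so points outside the disk need a gauge too. With half the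
     distance to the disk, their coordinate boxes miss the disk altogether. *)
  - assert (He : 0 < (Cmod (z - a) - r) / 2) by lra.
    exists (mkposreal _ He, a). simpl. split.
    { replace (a - a)%C with (RtoC 0) by ring. rewrite Cmod_0. easy. }
    intros x H1 H2 Hx. exfalso.
    assert (H := Cmod_tri_inv (z - a) (x - a)).
    replace (z - a - (x - a))%C with (-(x - z))%C in H by ring. rewrite Cmod_opp in H.
    assert (H' := Cmod_le_sum (x - z)). simpl in H'.
    unfold Rminus in *. lra. }
pose (sel := fun z => proj1_sig (constructive_indefinite_description _ (Hd z))).
assert (Hsel : forall z : C, Cmod (snd (sel z) - a) <= r /\
   forall x, Rabs (fst x - fst z) < fst (sel z) -> Rabs (snd x - snd z) < fst (sel z) ->
   Cmod (x - a) <= r -> f x < f (snd (sel z)))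
  by (intros z; exact (proj2_sig (constructive_indefinite_description _ (Hd z)))).
pose (toC := fun t : Compactness.Tn 2 R => (fst t, fst (snd t)) : C).
(* The finite cover is given only under a double negation, which is enough for the goal [False]. *)
apply (compactness_list 2 (fst a - r, (snd a - r, tt)) (fst a + r, (snd a + r, tt))
   (fun t => fst (sel (toC t)))).
intros [l Hl].
assert (Hfin : forall l : list (Compactness.Tn 2 R), exists y, Cmod (y - a) <= r /\
   forall t, In t l -> f (snd (sel (toC t))) <= f y).
{ clear l Hl. intros l; induction l as [|t l [y [Hy IH]]].
  - exists a. split; [|intros t []]. replace (a - a)%C with (RtoC 0) by ring. now rewrite Cmod_0.
  - destruct (Rle_lt_dec (f (snd (sel (toC t)))) (f y)).
    + exists y. split; [easy|]. intros t' [<-|Ht']; [easy|now apply IH].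
    + exists (snd (sel (toC t))). split; [apply Hsel|]. intros t' [<-|Ht']; [lra|].
      specialize (IH t' Ht'). lra. }
destruct (Hfin l) as [y [Hy Hmax]].
destruct (Hl (fst y, (snd y, tt))) as [t [Ht [_ Hcl]]].
{ assert (H1 := Rle_trans _ _ _ (re_le_Cmod (y - a)) Hy).
  assert (H2 := Rle_trans _ _ _ (Im_le_Cmod (y - a)) Hy).
  unfold Re, Im in H1, H2. simpl in H1, H2. apply Rabs_le_between in H1. apply Rabs_le_between in H2.
  simpl. lra. }
specialize (Hmax t Ht).
destruct (Hsel (toC t)) as [_ H].
destruct t as [t1 [t2 []]]. simpl in Hcl. destruct Hcl as [C1 [C2 _]].
specialize (H y C1 C2 Hy). lra.
Qed.

Lemma continuous_Cmod_Cder (f : C -> C) (z l : C) : Cder f z l -> continuous (fun x => Cmod (f x)) z.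
Proof.
intros H. apply continuous_eps. intros eps He.
destruct (Cder_cont f z l H eps He) as [d [Hd K]]. exists d. split; [easy|].
intros y Hy. specialize (K y Hy).
apply Rle_lt_trans with (2 := K). apply Rabs_le.
assert (H1 := Cmod_tri_inv (f y) (f z)). assert (H2 := Cmod_tri_inv (f z) (f y)).
rewrite Cmod_minus_sym in H2. lra.
Qed.

(* Otherwise moving from [z0] in the direction [- F z0 / l] would decrease [|F|]. *)
Lemma min_Cmod_zero (F : C -> C) (z0 l : C) (d : R) : 0 < d -> Cder F z0 l -> l <> 0 ->
  (forall y, Cmod (y - z0) < d -> Cmod (F z0) <= Cmod (F y)) -> F z0 = 0.
Proof.
intros Hd HF Hl Hmin. apply Cmod_eq_0.
destruct (Rle_lt_or_eq_dec 0 (Cmod (F z0)) (Cmod_ge_0 _)) as [Hp|<-]; [|easy]. exfalso.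
assert (Hl0 : 0 < Cmod l) by now apply Cmod_gt_0.
destruct (proj1 (Cder_eps _ _ _) HF (Cmod l / 2)) as [d1 [Hd1 K]]; [lra|].
set (q := Cmod (F z0) / Cmod l). assert (Hq : 0 < q) by now apply Rdiv_lt_0_compat.
set (t := Rmin 1 (Rmin d d1 / (2 * q))).
assert (Hmd : 0 < Rmin d d1) by now apply Rmin_glb_lt.
assert (Ht0 : 0 < t) by (apply Rmin_glb_lt; [lra|apply Rdiv_lt_0_compat; lra]).
assert (Ht1 : t <= 1) by apply Rmin_l.
assert (Htq : t * q < Rmin d d1).
{ assert (H : t <= Rmin d d1 / (2 * q)) by apply Rmin_r.
  apply (Rmult_le_compat_r q) in H; [|lra].
  replace (Rmin d d1 / (2 * q) * q) with (Rmin d d1 / 2) in H by (field; lra). lra. }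
set (y := (z0 - RtoC t * (F z0 / l))%C).
assert (Ey : (y - z0 = - (RtoC t * (F z0 / l)))%C) by (unfold y; ring).
assert (Hy : Cmod (y - z0) = t * q).
{ rewrite Ey, Cmod_opp, Cmod_mult, Cmod_R, Cmod_div by easy. rewrite Rabs_pos_eq by lra. easy. }
assert (Hy1 : Cmod (y - z0) < d) by (rewrite Hy; apply Rlt_le_trans with (1 := Htq), Rmin_l).
assert (Hy2 : Cmod (y - z0) < d1) by (rewrite Hy; apply Rlt_le_trans with (1 := Htq), Rmin_r).
specialize (Hmin y Hy1). specialize (K y Hy2).
replace (F y) with ((F y - F z0 - (y - z0) * l) + RtoC (1 - t) * F z0)%C in Hmin.
2:{ rewrite Ey, RtoC_minus. field. easy. }
assert (Htri := Cmod_triangle (F y - F z0 - (y - z0) * l) (RtoC (1 - t) * F z0)).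
rewrite Cmod_mult, Cmod_R, Rabs_pos_eq in Htri by lra.
rewrite Hy in K.
replace (Cmod l / 2 * (t * q)) with (t * Cmod (F z0) / 2) in K by (unfold q; field; lra).
nra.
Qed.

(** Minimize [|f - u|] on the closed disk. On the rim it is at least [c * s - c * s / 2], more than
    at the centre, so the minimum is interior, and there [min_Cmod_zero] forces the value 0. *)
Lemma disk_preimage (f f' : C -> C) (a u : C) (s c : R) : 0 < s -> 0 < c ->
  (forall z, Cmod (z - a) <= s -> Cder f z (f' z) /\ f' z <> 0) ->
  (forall z, Cmod (z - a) <= s -> c * Cmod (z - a) <= Cmod (f z - f a)) ->
  Cmod (u - f a) < c * s / 2 ->
  exists z, Cmod (z - a) < s /\ f z = u.
Proof.
intros Hs Hc Hf Hexp Hu.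
assert (HF : forall z, Cmod (z - a) <= s -> Cder (fun x => f x - u)%C z (f' z)).
{ intros z Hz. refine (Cder_eq _ _ _ _ _ (Cder_minus _ _ _ _ _ (proj1 (Hf z Hz)) (Cder_const u z))). ring. }
destruct (disk_max (fun z => - Cmod (f z - u)) a s) as [z0 [Hz0 Hmax]]; [lra| |].
{ intros z Hz. apply (continuous_opp (fun z => Cmod (f z - u))).
  exact (continuous_Cmod_Cder _ _ _ (HF z Hz)). }
assert (Haa : Cmod (a - a) <= s) by (replace (a - a)%C with (RtoC 0) by ring; rewrite Cmod_0; lra).
assert (Hint : Cmod (z0 - a) < s).
{ destruct (Rle_lt_or_eq_dec _ _ Hz0) as [|E]; [easy|exfalso].
  specialize (Hmax a Haa). specialize (Hexp z0 Hz0). rewrite E in Hexp.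
  rewrite Cmod_minus_sym in Hu.
  assert (H := Cmod_triangle (f z0 - u) (-(f a - u))). rewrite Cmod_opp in H.
  replace (f z0 - u + - (f a - u))%C with (f z0 - f a)%C in H by ring. lra. }
exists z0. split; [easy|].
assert (E : (f z0 - u)%C = 0).
{ apply (min_Cmod_zero (fun z => f z - u)%C z0 (f' z0) (s - Cmod (z0 - a))); [lra|now apply HF|now apply Hf|].
  intros y Hy.
  assert (Hya : Cmod (y - a) <= s).
  { replace (y - a)%C with ((y - z0) + (z0 - a))%C by ring.
    eapply Rle_trans; [apply Cmod_triangle|]. lra. }
  specialize (Hmax y Hya). lra. }
replace (f z0) with ((f z0 - u) + u)%C by ring. rewrite E. ring.
Qed.

(** * The complex sine *)

(** From [cos x = 1 - 2 sin^2 (x / 2)] and [|sin t| <= |t|]. *)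
Lemma cos_ge_quadratic (x : R) : 1 - x ^ 2 / 2 <= cos x.
Proof.
replace x with (2 * (x / 2)) at 2 by field. rewrite cos_2a_sin.
assert (H : sin (x / 2) * sin (x / 2) <= (x / 2) * (x / 2)).
{ apply Rsqr_le_abs_1. 
  destruct (Rle_lt_dec 0 (x / 2)).
  - rewrite (Rabs_pos_eq (x / 2)) by easy.
    apply Rabs_le. split.
    + destruct (Rle_lt_dec (x / 2) 1).
      * assert (0 <= sin (x / 2)) by (apply sin_ge_0; [easy|pose proof PI2_1; lra]). lra.
      * pose proof (SIN_bound (x / 2)); lra.
    + destruct (Rle_lt_or_eq_dec _ _ r) as [Hp|<-]; [apply Rlt_le, sin_lt_x; easy|rewrite sin_0; lra].
  - rewrite <- Rabs_Ropp, <- sin_neg, <- (Rabs_Ropp (x / 2)).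
    rewrite (Rabs_pos_eq (- (x / 2))) by lra.
    set (y := - (x / 2)). assert (Hy : 0 < y) by (unfold y; lra).
    apply Rabs_le. split; [|now apply Rlt_le, sin_lt_x].
    destruct (Rle_lt_dec y 1).
    + assert (0 <= sin y) by (apply sin_ge_0; [lra|pose proof PI2_1; lra]). lra.
    + pose proof (SIN_bound y); lra. }
nra.
Qed.

Lemma sin_minus_id_le (y : R) : Rabs (sin y - y) <= Rabs y * (y ^ 2 / 2).
Proof.
destruct (MVT_gen (fun t => sin t - t) 0 y (fun t => cos t - 1)) as [c [Hc Hm]].
- intros t _. auto_derive; [easy|ring].
- intros t _. apply derivable_continuous_pt. apply derivable_pt_minus; [apply derivable_pt_sin|apply derivable_pt_id].
- rewrite sin_0 in Hm. replace (sin y - y) with ((cos c - 1) * (y - 0)) by lra.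
  rewrite Rabs_mult, Rminus_0_r, Rmult_comm. apply Rmult_le_compat_l; [apply Rabs_pos|].
  assert (c ^ 2 <= y ^ 2).
  { destruct (Rle_lt_dec 0 y).
    - rewrite Rmin_left, Rmax_right in Hc by lra. nra.
    - rewrite Rmin_right, Rmax_left in Hc by lra. nra. }
  pose proof (cos_ge_quadratic c). pose proof (COS_bound c). apply Rabs_le. lra.
Qed.

(** The upper bound rests on [exp x * (1 - x) <= 1] and on [(1 + x + 2 x^2) (1 - x) = 1 + x^2 (1 - 2
    x)], which is at least 1 for [x <= 1/2]. *)
Lemma exp_second_order (x : R) : Rabs x <= / 2 -> Rabs (exp x - 1 - x) <= 2 * x ^ 2.
Proof.
intros Hx. apply Rabs_le_between in Hx.
pose proof (exp_ineq1_le x). pose proof (exp_ineq1_le (- x)).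
rewrite exp_Ropp in H0. pose proof (exp_pos x).
assert (exp x * (1 - x) <= 1).
{ apply (Rmult_le_compat_l (exp x)) in H0; [|lra]. rewrite Rinv_r in H0 by lra. lra. }
apply Rabs_le. split; [nra|].
assert ((1 + x + 2 * x ^ 2) * (1 - x) >= 1) by nra.
nra.
Qed.

(** A remainder estimate at 0 suffices, since [Cexp_plus] carries it to every other point. The
    constant 4 adds up generous bounds for the two components. *)
Lemma Cexp_second_order (b : C) : Cmod b <= / 2 ->
  Cmod (Cexp b - 1 - b) <= 4 * Cmod b ^ 2.
Proof.
destruct b as [x y]. intros Hb.
assert (Hx := Rle_trans _ _ _ (re_le_Cmod (x, y)) Hb).
assert (Hy := Rle_trans _ _ _ (Im_le_Cmod (x, y)) Hb).
rewrite Cmod2_alt. unfold Cexp, Re, Im in *. simpl fst in *. simpl snd in *.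
eapply Rle_trans; [apply Cmod_le_sum|]. simpl fst; simpl snd.
assert (E := exp_second_order x Hx).
assert (S := sin_minus_id_le y).
assert (Cc : Rabs (cos y - 1) <= y ^ 2 / 2).
{ apply Rabs_le. pose proof (cos_ge_quadratic y). pose proof (COS_bound y). nra. }
assert (H1 : Rabs (cos y) <= 1) by (apply Rabs_le; pose proof (COS_bound y); lra).
assert (Hex : Rabs (exp x) <= 2).
{ apply Rabs_le_between in E. apply Rabs_le_between in Hx. apply Rabs_le. nra. }
assert (Hex1 : Rabs (exp x - 1) <= 2 * Rabs x).
{ replace (exp x - 1) with ((exp x - 1 - x) + x) by ring.
  eapply Rle_trans; [apply Rabs_triang|]. rewrite <- (pow2_abs x) in E. pose proof (Rabs_pos x). nra. }
assert (Hx1 : Rabs (1 + x) <= 3 / 2) by (apply Rabs_le; apply Rabs_le_between in Hx; lra).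
replace (exp x * cos y + - (1) + - x) with ((exp x - 1 - x) * cos y + (1 + x) * (cos y - 1)) by ring.
replace (exp x * sin y + - 0 + - y) with (exp x * (sin y - y) + (exp x - 1) * y) by ring.
assert (T1 := Rabs_triang ((exp x - 1 - x) * cos y) ((1 + x) * (cos y - 1))).
assert (T2 := Rabs_triang (exp x * (sin y - y)) ((exp x - 1) * y)).
rewrite !Rabs_mult in T1, T2.
pose proof (Rabs_pos (exp x - 1 - x)). pose proof (Rabs_pos (cos y)).
pose proof (Rabs_pos (1 + x)). pose proof (Rabs_pos (cos y - 1)).
pose proof (Rabs_pos (exp x)). pose proof (Rabs_pos (sin y - y)).
pose proof (Rabs_pos (exp x - 1)). pose proof (Rabs_pos y). pose proof (Rabs_pos x).
assert (U1 : Rabs (exp x - 1 - x) * Rabs (cos y) <= 2 * x ^ 2) by nra.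
assert (U2 : Rabs (1 + x) * Rabs (cos y - 1) <= 3 / 4 * y ^ 2).
{ replace (3 / 4 * y ^ 2) with (3 / 2 * (y ^ 2 / 2)) by field. apply Rmult_le_compat; lra. }
assert (U3 : Rabs (exp x) * Rabs (sin y - y) <= y ^ 2 / 2).
{ apply Rle_trans with (2 * (Rabs y * (y ^ 2 / 2))); [apply Rmult_le_compat; lra|].
  pose proof (pow2_ge_0 y). nra. }
assert (U4 : Rabs (exp x - 1) * Rabs y <= x ^ 2 + y ^ 2).
{ apply Rle_trans with (2 * Rabs x * Rabs y); [apply Rmult_le_compat_r; lra|].
  rewrite <- (pow2_abs x), <- (pow2_abs y). pose proof (pow2_ge_0 (Rabs x - Rabs y)). lra. }
pose proof (pow2_ge_0 x). pose proof (pow2_ge_0 y). lra.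
Qed.

Lemma Cexp_plus (a b : C) : Cexp (a + b) = (Cexp a * Cexp b)%C.
Proof.
destruct a as [a1 a2], b as [b1 b2]. unfold Cexp, Re, Im; simpl.
rewrite exp_plus, cos_plus, sin_plus. apply injective_projections; simpl; ring.
Qed.

Lemma Cexp_neq_0 (a : C) : Cexp a <> 0.
Proof.
intros E.
assert (H : (Cexp a * Cexp (- a))%C = 1).
{ rewrite <- Cexp_plus. replace (a + - a)%C with (RtoC 0) by ring.
  unfold Cexp; simpl. rewrite exp_0, cos_0, sin_0. apply injective_projections; simpl; ring. }
rewrite E, Cmult_0_l in H. injection H; lra.
Qed.

Lemma Cder_Cexp (z : C) : Cder Cexp z (Cexp z).
Proof.
apply Cder_eps. intros eps He.
assert (H0 : 0 < Cmod (Cexp z)) by (apply Cmod_gt_0, Cexp_neq_0).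
exists (Rmin (/ 2) (eps / (4 * Cmod (Cexp z)))). split.
{ apply Rmin_glb_lt; [lra|]. apply Rdiv_lt_0_compat; lra. }
intros y Hy.
assert (H1 := Rlt_le_trans _ _ _ Hy (Rmin_l _ _)).
assert (H2 := Rlt_le_trans _ _ _ Hy (Rmin_r _ _)).
assert (K := Cexp_second_order (y - z) (Rlt_le _ _ H1)).
replace (Cexp y - Cexp z - (y - z) * Cexp z)%C with (Cexp z * (Cexp (y - z) - 1 - (y - z)))%C.
2:{ replace (Cexp y) with (Cexp z * Cexp (y - z))%C by (rewrite <- Cexp_plus; f_equal; ring). ring. }
rewrite Cmod_mult. pose proof (Cmod_ge_0 (y - z)).
apply (Rmult_lt_compat_r (4 * Cmod (Cexp z))) in H2; [|lra].
unfold Rdiv in H2. rewrite Rmult_assoc, Rinv_l, Rmult_1_r in H2 by lra.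
apply Rle_trans with (Cmod (Cexp z) * (4 * Cmod (y - z) ^ 2)); [apply Rmult_le_compat_l; lra|].
nra.
Qed.

Definition Ccos (z : C) : C := ((Cexp (Ci * z) + Cexp (- (Ci * z))) / 2)%C.

Lemma C2_neq_0 : RtoC 2 <> 0.
Proof. intros H; injection H; lra. Qed.

Lemma Ci_neq_0 : Ci <> 0.
Proof. intros H; injection H; lra. Qed.

Lemma Ci_sqr : (Ci * Ci = - (1))%C.
Proof. apply injective_projections; simpl; ring. Qed.

Lemma Cder_Cexp_Ci (z : C) :
  Cder (fun x => Cexp (Ci * x)%C) z (Ci * Cexp (Ci * z))%C /\
  Cder (fun x => Cexp (- (Ci * x))%C) z (- Ci * Cexp (- (Ci * z)))%C.
Proof.
assert (H : Cder (fun x => (Ci * x)%C) z Ci).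
{ refine (Cder_eq _ _ _ _ _ (Cder_mult _ _ _ _ _ (Cder_const Ci z) (Cder_id z))). ring. }
split; apply Cder_comp; try apply Cder_Cexp; [easy|now apply Cder_opp].
Qed.

Lemma Cder_Csin (z : C) : Cder Csin z (Ccos z).
Proof.
destruct (Cder_Cexp_Ci z) as [H1 H2].
refine (Cder_eq _ _ _ _ _ (Cder_div _ _ _ _ _ (Cder_minus _ _ _ _ _ H1 H2) (Cder_const (2 * Ci)%C z) _)).
- unfold Ccos. field. repeat split; (apply Ci_neq_0 || apply C2_neq_0).
- apply Cmult_neq_0; [apply C2_neq_0|apply Ci_neq_0].
Qed.

Lemma Cder_Ccos (z : C) : Cder Ccos z (- Csin z)%C.
Proof.
destruct (Cder_Cexp_Ci z) as [H1 H2].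
refine (Cder_eq _ _ _ _ _ (Cder_div _ _ _ _ _ (Cder_plus _ _ _ _ _ H1 H2) (Cder_const 2 z) C2_neq_0)).
unfold Csin. pose proof Ci_sqr as E.
replace (- ((Cexp (Ci * z) - Cexp (- (Ci * z))) / (2 * Ci)))%C with
   ((Ci * Ci) * ((Cexp (Ci * z) - Cexp (- (Ci * z))) / (2 * Ci)))%C by (rewrite E; ring).
field. repeat split; (apply Ci_neq_0 || apply C2_neq_0).
Qed.

Lemma Csin_pair (x y : R) : Csin (x, y) = (sin x * cosh y, cos x * sinh y).
Proof.
unfold Csin, Cexp, cosh, sinh, Re, Im. simpl.
replace (0 * x - 1 * y) with (- y) by ring. replace (0 * y + 1 * x) with x by ring.
rewrite Ropp_involutive, cos_neg, sin_neg.
apply injective_projections; simpl; field.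
Qed.

Lemma Ccos_pair (x y : R) : Ccos (x, y) = (cos x * cosh y, - (sin x * sinh y)).
Proof.
unfold Ccos, Cexp, cosh, sinh, Re, Im. simpl.
replace (0 * x - 1 * y) with (- y) by ring. replace (0 * y + 1 * x) with x by ring.
rewrite Ropp_involutive, cos_neg, sin_neg.
apply injective_projections; simpl; field.
Qed.

Lemma cosh_ge_1 (y : R) : 1 <= cosh y.
Proof.
unfold cosh. rewrite exp_Ropp. pose proof (exp_pos y).
assert (0 <= (exp y - 1) ^ 2) by apply pow2_ge_0.
assert (2 <= exp y + / exp y); [|lra].
apply (Rmult_le_reg_l (exp y)); [easy|]. rewrite Rmult_plus_distr_l, Rinv_r by lra. nra.
Qed.

(** The real part is [cos x * cosh y] with [cos x >= 1 - x^2 / 2 >= 1/2]. A derivative with real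
    part bounded below on a convex set is what makes the sine expand distances there. *)
Lemma Re_Ccos_disk (z : C) : Cmod z <= 1 -> / 2 <= Re (Ccos z).
Proof.
destruct z as [x y]. intros Hz. rewrite Ccos_pair. simpl.
assert (Hx := Rle_trans _ _ _ (re_le_Cmod (x, y)) Hz). simpl in Hx.
apply Rabs_le_between in Hx.
pose proof (cos_ge_quadratic x). pose proof (cosh_ge_1 y).
assert (/ 2 <= cos x) by nra. nra.
Qed.

Lemma is_derive_affine (a b t : R) : is_derive (fun s => a + s * b) t b.
Proof. auto_derive; trivial; ring. Qed.

(** The Noshiro-Warschawski argument: along the segment from [b] to [a], the real part of [Csin]
    times the conjugate of [e = a - b] has derivative [Re (Ccos m) * |e|^2 >= |e|^2 / 2]. *)
Lemma Csin_expand (a b : C) : Cmod a <= 1 -> Cmod b <= 1 ->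
  / 2 * Cmod (a - b) <= Cmod (Csin a - Csin b).
Proof.
intros Ha Hb.
set (e := (a - b)%C).
set (g := fun z => (Csin z * Cconj e)%C).
assert (Hg : forall z, Cder g z (Ccos z * Cconj e)%C).
{ intros z. refine (Cder_eq _ _ _ _ _ (Cder_mult _ _ _ _ _ (Cder_Csin z) (Cder_const (Cconj e) z))). ring. }
assert (Hd : forall t, is_derive (fun s => Re (g (fst b + s * fst e, snd b + s * snd e))) t
   (Re (Ccos (fst b + t * fst e, snd b + t * snd e) * Cconj e * (fst e, snd e)))).
{ intros t. refine (proj1 (Cder_path g _ _ (fun s => fst b + s * fst e) (fun s => snd b + s * snd e) t _ _ (Hg _) _ _ eq_refl)); apply is_derive_affine. }
destruct (MVT_gen (fun s => Re (g (fst b + s * fst e, snd b + s * snd e))) 0 1 _ (fun t _ => Hd t)) as [t [Ht Hm]].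
{ intros t _. apply continuity_pt_filterlim. apply (ex_derive_continuous (K := R_AbsRing) (V := R_NormedModule)). eexists. apply Hd. }
rewrite Rmin_left, Rmax_right in Ht by lra.
cbv beta in Hm.
replace (fst b + 1 * fst e, snd b + 1 * snd e) with a in Hm
  by (unfold e; apply injective_projections; simpl; ring).
replace (fst b + 0 * fst e, snd b + 0 * snd e) with b in Hm
  by (apply injective_projections; simpl; ring).
set (m := (fst b + t * fst e, snd b + t * snd e) : C) in *.
assert (Hmm : Cmod m <= 1).
{ replace m with (RtoC t * a + RtoC (1 - t) * b)%C
    by (unfold m, e; apply injective_projections; simpl; ring).
  eapply Rle_trans; [apply Cmod_triangle|]. rewrite !Cmod_mult, !Cmod_R, !Rabs_pos_eq by lra.
  pose proof (Cmod_ge_0 a). pose proof (Cmod_ge_0 b). nra. }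
assert (Hc := Re_Ccos_disk m Hmm).
replace (Re (Ccos m * Cconj e * (fst e, snd e))) with (Re (Ccos m) * Cmod e ^ 2) in Hm
  by (rewrite Cmod2_alt; unfold Re, Im; simpl; ring).
assert (Hr : Re (g a) - Re (g b) <= Cmod (Csin a - Csin b) * Cmod e).
{ rewrite <- (Cmod_conj e), <- Cmod_mult.
  eapply Rle_trans; [|eapply Rle_trans; [apply Rle_abs|apply re_le_Cmod]].
  apply Req_le. unfold g, Re. simpl. ring. }
destruct (Rle_lt_or_eq_dec 0 (Cmod e) (Cmod_ge_0 _)) as [Hp|<-].
- apply (Rmult_le_reg_r (Cmod e)); [easy|]. pose proof (pow2_ge_0 (Cmod e)). nra.
- rewrite Rmult_0_r. apply Cmod_ge_0.
Qed.

Lemma Ccos_neq_0 (z : C) : Cmod z <= 1 -> Ccos z <> 0.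
Proof. intros Hz E. pose proof (Re_Ccos_disk z Hz) as H. rewrite E in H. simpl in H. lra. Qed.

Lemma sin_increasing_unit (x y : R) : -1 <= x -> x <= y -> y <= 1 -> sin x <= sin y.
Proof. intros. pose proof PI2_1. apply sin_incr_1; lra. Qed.

(** The imaginary part is [cos x * sinh y] and [cos x] is positive for [|x| <= 1], so [w] itself is
    real. *)
Lemma Csin_real (w : C) (r : R) : Cmod w <= r -> r <= 1 -> Im (Csin w) = 0 -> Re (Csin w) <= sin r.
Proof.
destruct w as [x y]. intros Hw Hr. rewrite Csin_pair. simpl. intros H.
assert (Hx := Rle_trans _ _ _ (re_le_Cmod (x, y)) Hw). simpl in Hx. apply Rabs_le_between in Hx.
assert (Hc : 0 < cos x) by (pose proof (cos_ge_quadratic x); nra).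
assert (Hs : sinh y = 0) by (apply Rmult_integral in H; lra).
assert (y = 0).
{ destruct (Rtotal_order y 0) as [Hy|[Hy|Hy]]; [|easy|].
  - apply sinh_lt in Hy. rewrite sinh_0 in Hy. lra.
  - apply sinh_lt in Hy. rewrite sinh_0 in Hy. lra. }
subst y. rewrite cosh_0, Rmult_1_r. apply sin_increasing_unit; lra.
Qed.

(* [sinh] is convex and [sinh 1 = 1.1752...]. *)
Lemma sinh_le_linear (y : R) : 0 <= y <= 1 -> sinh y <= 1.182 * y.
Proof.
intros Hy.
(* A crude bound from [1 <= exp t <= 3]. Integrated five times it only enters the last Taylor term,
   and [1 + 1/6 + 1.75/120 = 1.18125]. *)
assert (Hcosh : forall t, 0 <= t <= 1 -> cosh t <= 1.75).
{ intros t Ht. unfold cosh. rewrite exp_Ropp.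
  pose proof exp_le_3. assert (He : exp t <= exp 1) by (destruct (Rle_lt_or_eq_dec _ _ (proj2 Ht)) as [Hl| ->]; [now apply Rlt_le, exp_increasing|lra]).
  pose proof (exp_ineq1_le t). pose proof (exp_pos t).
  assert (exp t + / exp t <= 3.5); [|lra].
  apply (Rmult_le_reg_l (exp t)); [easy|]. rewrite Rmult_plus_distr_l, Rinv_r by lra. nra. }
assert (Hinc : forall f f' : R -> R, (forall t, is_derive f t (f' t)) -> f 0 <= 0 ->
   (forall t, 0 <= t <= 1 -> f' t <= 0) -> forall t, 0 <= t <= 1 -> f t <= 0).
{ intros f f' Hd H0 Hf' t Ht.
  destruct (MVT_gen f 0 t f' (fun x _ => Hd x)) as [c [Hc Hm]].
  { intros x _. apply continuity_pt_filterlim. apply (ex_derive_continuous (K := R_AbsRing) (V := R_NormedModule)). eexists. apply Hd. }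
  rewrite Rmin_left, Rmax_right in Hc by lra.
  specialize (Hf' c). nra. }
assert (Dsh : forall t, is_derive sinh t (cosh t)) by (intros; apply is_derive_Reals, derivable_pt_lim_sinh).
assert (Dch : forall t, is_derive cosh t (sinh t)) by (intros; apply is_derive_Reals, derivable_pt_lim_cosh).
assert (E4 : forall t, 0 <= t <= 1 -> sinh t - 1.75 * t <= 0).
{ apply (Hinc _ (fun t => cosh t - 1.75)).
  - intros t. apply (is_derive_minus sinh (fun t => 1.75 * t)); [apply Dsh|auto_derive; trivial; ring].
  - rewrite sinh_0; lra.
  - intros t Ht. specialize (Hcosh t Ht). lra. }
assert (E3 : forall t, 0 <= t <= 1 -> cosh t - (1 + 1.75 / 2 * t ^ 2) <= 0).
{ apply (Hinc _ (fun t => sinh t - 1.75 * t)); [|rewrite cosh_0; lra|easy].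
  intros t. apply (is_derive_minus cosh (fun t => 1 + 1.75 / 2 * t ^ 2)); [apply Dch|auto_derive; trivial; field]. }
assert (E2 : forall t, 0 <= t <= 1 -> sinh t - (t + 1.75 / 6 * t ^ 3) <= 0).
{ apply (Hinc _ (fun t => cosh t - (1 + 1.75 / 2 * t ^ 2))); [|rewrite sinh_0; lra|easy].
  intros t. apply (is_derive_minus sinh (fun t => t + 1.75 / 6 * t ^ 3)); [apply Dsh|auto_derive; trivial; field]. }
assert (E1 : forall t, 0 <= t <= 1 -> cosh t - (1 + t ^ 2 / 2 + 1.75 / 24 * t ^ 4) <= 0).
{ apply (Hinc _ (fun t => sinh t - (t + 1.75 / 6 * t ^ 3))); [|rewrite cosh_0; lra|easy].
  intros t. apply (is_derive_minus cosh (fun t => 1 + t ^ 2 / 2 + 1.75 / 24 * t ^ 4)); [apply Dch|auto_derive; trivial; field]. }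
assert (E0 : forall t, 0 <= t <= 1 -> sinh t - (t + t ^ 3 / 6 + 1.75 / 120 * t ^ 5) <= 0).
{ apply (Hinc _ (fun t => cosh t - (1 + t ^ 2 / 2 + 1.75 / 24 * t ^ 4))); [|rewrite sinh_0; lra|easy].
  intros t. apply (is_derive_minus sinh (fun t => t + t ^ 3 / 6 + 1.75 / 120 * t ^ 5)); [apply Dsh|auto_derive; trivial; field]. }
specialize (E0 y Hy).
assert (y ^ 3 <= y) by nra. assert (y ^ 5 <= y) by (replace (y ^ 5) with (y ^ 3 * y ^ 2) by ring; nra).
lra.
Qed.

Lemma Im_Csin_le (w : C) : Cmod w <= 1 -> Rabs (Im (Csin w)) <= 1.182 * Cmod w.
Proof.
destruct w as [x y]. intros Hw. rewrite Csin_pair. simpl Im.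
assert (Hy := Im_le_Cmod (x, y)). simpl in Hy.
rewrite Rabs_mult.
assert (Hc : Rabs (cos x) <= 1) by (apply Rabs_le; pose proof (COS_bound x); lra).
assert (Hs : Rabs (sinh y) <= 1.182 * Rabs y).
{ assert (Hpos : forall t, 0 <= t <= 1 -> Rabs (sinh t) <= 1.182 * t).
  { intros t Ht. rewrite Rabs_pos_eq; [now apply sinh_le_linear|].
    destruct (Rle_lt_or_eq_dec _ _ (proj1 Ht)) as [Hl|<-].
    - apply sinh_lt in Hl. rewrite sinh_0 in Hl. lra.
    - rewrite sinh_0. lra. }
  destruct (Rle_lt_dec 0 y) as [H|H].
  - rewrite (Rabs_pos_eq y) in * by easy. apply Hpos. lra.
  - rewrite (Rabs_left y) in * by easy. rewrite <- Rabs_Ropp.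
    replace (- sinh y) with (sinh (- y)) by (unfold sinh; rewrite Ropp_involutive; field).
    apply Hpos. lra. }
pose proof (Rabs_pos (cos x)). pose proof (Rabs_pos (sinh y)). pose proof (Rabs_pos y). nra.
Qed.

(** * The nephroid domain *)

Lemma derive_left_max (g : R -> R) (t m d : R) : is_derive g t m -> 0 < d ->
  (forall s, t - d < s < t -> g s <= g t) -> 0 <= m.
Proof.
intros Hg Hd Hmax. destruct (Rle_lt_dec 0 m) as [|Hm]; [easy|exfalso].
destruct (proj1 (is_derive_eps _ _ _) Hg (- m / 2)) as [d1 [Hd1 K]]; [lra|].
set (s := Rmin d d1 / 2). assert (0 < Rmin d d1) by now apply Rmin_glb_lt.
assert (Hs : 0 < s < d /\ s < d1).
{ pose proof (Rmin_l d d1). pose proof (Rmin_r d d1). unfold s. lra. }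
specialize (Hmax (t - s)). specialize (K (t - s)).
replace (t - s - t) with (- s) in K by ring. rewrite Rabs_Ropp, Rabs_pos_eq in K by lra.
assert (g (t - s) <= g t) by (apply Hmax; lra).
assert (K' := K (proj2 Hs)). apply Rabs_le_between in K'. nra.
Qed.

Lemma derive_right_max (g : R -> R) (t m d : R) : is_derive g t m -> 0 < d ->
  (forall s, t < s < t + d -> g s <= g t) -> m <= 0.
Proof.
intros Hg Hd Hmax.
assert (H : 0 <= -1 * m); [|lra].
apply (derive_left_max (fun s => g (- s)) (- t) (-1 * m) d); [|easy|].
- apply (is_derive_comp (K := R_AbsRing) (V := R_NormedModule) g Ropp (- t) m (-1)).
  + now rewrite Ropp_involutive.
  + auto_derive; trivial; ring.
- intros s Hs. rewrite Ropp_involutive. apply Hmax. lra.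
Qed.

Lemma derive_max_zero (g : R -> R) (t m d : R) : is_derive g t m -> 0 < d ->
  (forall s, Rabs (s - t) < d -> g s <= g t) -> m = 0.
Proof.
intros Hg Hd H.
apply Rle_antisym; [apply (derive_right_max g t m d)|apply (derive_left_max g t m d)]; try easy;
  intros s Hs; apply H; apply Rabs_def1; lra.
Qed.

Lemma C3_neq_0 : RtoC 3 <> 0.
Proof. intros H; injection H; lra. Qed.

Lemma Cder_phi_Ne (w : C) : Cder phi_Ne w (1 - w * w)%C.
Proof.
pose proof C3_neq_0 as H3.
apply (is_derive_ext (K := C_AbsRing) (V := C_NormedModule) (fun z => 1 + z - z * (z * z) / 3)%C).
{ intros t. unfold phi_Ne. replace (t ^ 3)%C with (t * (t * t))%C by (simpl; ring). reflexivity. }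
pose proof (Cder_id w) as I.
refine (Cder_eq _ _ _ _ _ (Cder_minus _ _ _ _ _ (Cder_plus _ _ _ _ _ (Cder_const 1 w) I)
  (Cder_div _ _ _ _ _ (Cder_mult _ _ _ _ _ I (Cder_mult _ _ _ _ _ I I)) (Cder_const 3 w) H3))).
field.
Qed.

Lemma phi_Ne_pair (c s : R) :
  phi_Ne (c, s) = (1 + c - (c ^ 3 - 3 * c * s ^ 2) / 3, s - (3 * c ^ 2 * s - s ^ 3) / 3).
Proof. unfold phi_Ne. apply injective_projections; simpl; field. Qed.

Lemma is_derive_sqr_sum (f g : R -> R) (t a b : R) : is_derive f t a -> is_derive g t b ->
  is_derive (fun s => - (f s ^ 2 + g s ^ 2)) t (-2 * (f t * a + g t * b)).
Proof.
intros Hf Hg. auto_derive; [split; [|split; trivial]; eexists; eassumption|].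
replace (Derive (fun x => f x) t) with a by (symmetry; apply is_derive_unique, Hf).
replace (Derive (fun x => g x) t) with b by (symmetry; apply is_derive_unique, Hg). ring.
Qed.

(* Minimize [|phi_Ne - u|] on the closed unit disk.  At a boundary minimum [w0], the point
   [u - phi_Ne w0] is a nonnegative multiple of the outward normal [w0 - w0^3], which puts [u]
   outside the rectangle; at the cusps [w0 = 1] and [w0 = -1], where the normal vanishes, moving
   inwards decreases the distance.  The nephroid meets the line [Re u = 5 / 3] at height
   [1.0746...], so [1.065] is close to optimal; the estimates of case (b) give [1.0637]. *)
Lemma nephroid_rectangle (x y : R) : Rabs x < 2 / 3 -> Rabs y < 1.065 ->
  exists w, Cmod w < 1 /\ phi_Ne w = (1 + x, y).
Proof.
intros Hx Hy. apply Rabs_def2 in Hx. apply Rabs_def2 in Hy.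
set (u := (1 + x, y) : C).
set (F := fun w => (phi_Ne w - u)%C).
assert (HF : forall w, Cder F w (1 - w * w)%C).
{ intros w. refine (Cder_eq _ _ _ _ _ (Cder_minus _ _ _ _ _ (Cder_phi_Ne w) (Cder_const u w))). ring. }
destruct (disk_max (fun w => - Cmod (F w)) 0 1) as [w0 [Hw0 Hmax]]; [lra| |].
{ intros w _. apply (continuous_opp (fun w => Cmod (F w))). exact (continuous_Cmod_Cder _ _ _ (HF w)). }
replace (w0 - 0)%C with w0 in Hw0 by ring.
assert (Hmin : forall w, Cmod w <= 1 -> Cmod (F w0) <= Cmod (F w)).
{ intros w Hw. specialize (Hmax w). replace (w - 0)%C with w in Hmax by ring. specialize (Hmax Hw). lra. }
clear Hmax.
assert (Hz : F w0 = 0 -> phi_Ne w0 = (1 + x, y)).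
{ intros E. replace (phi_Ne w0) with (F w0 + u)%C by (unfold F; ring). rewrite E. unfold u. ring. }
destruct (Rle_lt_or_eq_dec _ _ Hw0) as [Hlt|Heq].
- exists w0. split; [easy|]. apply Hz.
  apply (min_Cmod_zero F w0 (1 - w0 * w0)%C (1 - Cmod w0)); [lra|apply HF| |].
  + intros E. assert (Cmod (w0 * w0) = 1).
    { replace (w0 * w0)%C with (1 - (1 - w0 * w0))%C by ring. rewrite E.
      replace (1 - 0)%C with (RtoC 1) by ring. apply Cmod_1. }
    rewrite Cmod_mult in H. pose proof (Cmod_ge_0 w0). nra.
  + intros w Hw. apply Hmin. replace w with (w0 + (w - w0))%C by ring.
    eapply Rle_trans; [apply Cmod_triangle|]. lra.
- exfalso.
  destruct w0 as [c s].
  assert (Hcs : c ^ 2 + s ^ 2 = 1).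
  { assert (H := Cmod2_alt (c, s)). rewrite Heq in H. simpl Re in H; simpl Im in H. lra. }
  assert (Hsq : forall w, Cmod w <= 1 -> Re (F (c, s)) ^ 2 + Im (F (c, s)) ^ 2 <= Re (F w) ^ 2 + Im (F w) ^ 2).
  { intros w Hw. rewrite <- !Cmod2_alt. specialize (Hmin w Hw). pose proof (Cmod_ge_0 (F (c, s))). nra. }
  assert (HFp : forall a b, F (a, b) = (a - (a ^ 3 - 3 * a * b ^ 2) / 3 - x, b - (3 * a ^ 2 * b - b ^ 3) / 3 - y)).
  { intros a b. unfold F, u. rewrite phi_Ne_pair. apply injective_projections; simpl; ring. }
  destruct (Req_dec s 0) as [Hs|Hs].
  + subst s.
    assert (Hc : c = 1 \/ c = -1).
    { assert (Hp : (c - 1) * (c + 1) = 0) by (replace ((c - 1) * (c + 1)) with (c ^ 2 + 0 ^ 2 - 1) by ring; lra).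
      apply Rmult_integral in Hp. lra. }
    assert (Hk : forall k, 0 <= k <= 1 -> Cmod (c * k, 0) <= 1).
    { intros k Hk. eapply Rle_trans; [apply Cmod_le_sum|]. simpl. rewrite Rabs_R0, Rplus_0_r.
      apply Rabs_le. destruct Hc as [-> | ->]; lra. }
    (* At a cusp [c], equal to 1 or -1, the competitor is [c * (1 - e)]. Its image is [1 + c * h]
       with [c * x < h < 2/3], hence strictly between the abscissa of [u] and the cusp, so the
       distance to [u] decreases. *)
    set (e := (2 / 3 - c * x) / 2).
    assert (He : 0 < e < 1) by (unfold e; destruct Hc as [-> | ->]; lra).
    specialize (Hsq (c * (1 - e), 0) (Hk (1 - e) ltac:(lra))). rewrite !HFp in Hsq. simpl Re in Hsq; simpl Im in Hsq.
    assert (He3 : 0 < e ^ 2 < e) by nra.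
    assert (He4 : 0 < e ^ 3 < e ^ 2) by (split; [apply pow_lt; lra|nra]).
    assert (E1 : (1 - e) - (1 - e) ^ 3 / 3 = 2 / 3 - e ^ 2 + e ^ 3 / 3) by field.
    set (h := 2 / 3 - e ^ 2 + e ^ 3 / 3) in *.
    assert (Hh : h < 2 / 3) by (unfold h; lra).
    assert (Hh2 : c * x < h) by (unfold h, e in *; lra).
    destruct Hc as [-> | ->].
    * replace (1 * (1 - e) - ((1 * (1 - e)) ^ 3 - 3 * (1 * (1 - e)) * 0 ^ 2) / 3 - x) with (h - x) in Hsq
        by (rewrite <- E1; field).
      ring_simplify in Hsq. nra.
    * replace (-1 * (1 - e) - ((-1 * (1 - e)) ^ 3 - 3 * (-1 * (1 - e)) * 0 ^ 2) / 3 - x) with (- h - x) in Hsq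
        by (rewrite <- E1; field).
      ring_simplify in Hsq. nra.
  (* [(F1, F2)] is [phi_Ne w0 - u], and [(g1, g2)] is [w0 - w0^3], the radial derivative of [phi_Ne]
     at [w0]. [Htan] is stationarity of the distance under rotation of [w0]; [Hrad] comes from
     moving [w0] inwards. *)
  + set (F1 := c - (c ^ 3 - 3 * c * s ^ 2) / 3 - x). set (F2 := s - (3 * c ^ 2 * s - s ^ 3) / 3 - y).
    set (g1 := 4 * c * s ^ 2). set (g2 := 2 * s * (s ^ 2 - c ^ 2)).
    assert (El : (1 - (c, s) * (c, s))%C = (2 * s ^ 2, - 2 * c * s)).
    { apply injective_projections; simpl; nra. }
    assert (Htan : - F1 * g2 + F2 * g1 = 0).
    { destruct (Cder_path F (c, s) _ (fun t => c * cos t - s * sin t) (fun t => c * sin t + s * cos t)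
        0 (- s) c (HF _)) as [D1 D2].
      - auto_derive; trivial. rewrite sin_0, cos_0; ring.
      - auto_derive; trivial. rewrite sin_0, cos_0; ring.
      - rewrite sin_0, cos_0. apply injective_projections; simpl; ring.
      - assert (D := is_derive_sqr_sum _ _ _ _ _ D1 D2).
        apply (derive_max_zero _ _ _ 1) in D; [|lra|].
        + rewrite El, sin_0, cos_0 in D. rewrite HFp in D. unfold F1, F2, g1, g2.
          simpl in D. ring_simplify in D. nra.
        + intros t _. rewrite sin_0, cos_0.
          assert (H := Hsq (c * cos t - s * sin t, c * sin t + s * cos t)).
          replace (c * 1 - s * 0, c * 0 + s * 1) with (c, s) by (apply injective_projections; simpl; ring).
          apply Ropp_le_contravar, H.
          apply Rsqr_incr_0_var; [|lra]. rewrite Rsqr_1.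
          assert (H' := Cmod2_alt (c * cos t - s * sin t, c * sin t + s * cos t)).
          unfold Rsqr. simpl Re in H'; simpl Im in H'. pose proof (sin2_cos2 t) as T. unfold Rsqr in T. nra. }
    assert (Hrad : F1 * g1 + F2 * g2 <= 0).
    { destruct (Cder_path F (c, s) _ (fun t => 0 + t * c) (fun t => 0 + t * s)
        1 c s (HF _)) as [D1 D2]; try apply is_derive_affine.
      - apply injective_projections; simpl; ring.
      - assert (D := is_derive_sqr_sum _ _ _ _ _ D1 D2).
        apply (derive_left_max _ _ _ 1) in D; [|lra|].
        + rewrite El in D.
          replace (0 + 1 * c, 0 + 1 * s) with (c, s) in D by (apply injective_projections; simpl; ring).
          rewrite HFp in D. unfold F1, F2, g1, g2. simpl in D. nra.
        + intros t Ht.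
          assert (H := Hsq (0 + t * c, 0 + t * s)).
          replace (0 + 1 * c, 0 + 1 * s) with (c, s) by (apply injective_projections; simpl; ring).
          apply Ropp_le_contravar, H.
          replace (0 + t * c, 0 + t * s) with (RtoC t * (c, s))%C by (apply injective_projections; simpl; ring).
          rewrite Cmod_mult, Heq, Cmod_R, Rabs_pos_eq by lra. lra. }
    assert (Hs2 : 0 < s ^ 2) by nra.
    (* On the unit circle [|w - w^3| = |1 - w^2| = 2 |s|]. As this is not 0, [Htan] and [Hrad] make
       [(F1, F2)] a nonpositive multiple of [(g1, g2)], so [F1 * g1] and [F2 * g2] are nonpositive
       separately. *)
    assert (HG : g1 ^ 2 + g2 ^ 2 = 4 * s ^ 2).
    { unfold g1, g2. replace (c ^ 2) with (1 - s ^ 2) by lra.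
      replace ((4 * c * s ^ 2) ^ 2) with (16 * c ^ 2 * (s ^ 2) ^ 2) by ring.
      replace (c ^ 2) with (1 - s ^ 2) by lra. ring. }
    assert (HF1 : F1 * c <= 0).
    { assert (F1 * g1 * (4 * s ^ 2) <= 0).
      { rewrite <- HG. replace (F1 * g1 * (g1 ^ 2 + g2 ^ 2)) with (g1 ^ 2 * (F1 * g1 + F2 * g2) - g1 * g2 * (- F1 * g2 + F2 * g1)) by ring.
        rewrite Htan. pose proof (pow2_ge_0 g1). nra. }
      unfold g1 in H. replace (F1 * (4 * c * s ^ 2) * (4 * s ^ 2)) with (F1 * c * (16 * (s ^ 2) ^ 2)) in H by ring.
      assert (0 < 16 * (s ^ 2) ^ 2) by nra. nra. }
    assert (HF2 : F2 * s * (s ^ 2 - c ^ 2) <= 0).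
    { assert (F2 * g2 * (4 * s ^ 2) <= 0).
      { rewrite <- HG. replace (F2 * g2 * (g1 ^ 2 + g2 ^ 2)) with (g2 ^ 2 * (F1 * g1 + F2 * g2) + g1 * g2 * (- F1 * g2 + F2 * g1)) by ring.
        rewrite Htan. pose proof (pow2_ge_0 g2). nra. }
      unfold g2 in H. replace (F2 * (2 * s * (s ^ 2 - c ^ 2)) * (4 * s ^ 2)) with (F2 * s * (s ^ 2 - c ^ 2) * (8 * s ^ 2)) in H by ring.
      nra. }
    set (k := Rabs c). assert (Hk0 : 0 <= k) by apply Rabs_pos.
    assert (Hk2 : k ^ 2 = c ^ 2) by (unfold k; apply pow2_abs).
    assert (Hk1 : k < 1) by nra.
    (* Here [|x| < 2/3] enters: [HF1] yields [k (3 - 2 k^2) <= 1], that is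
       [(k - 1) (2 k^2 + 2 k - 1) >= 0], so [k] is at most [(sqrt 3 - 1) / 2 = 0.3660...]. *)
    assert (Hck : k < 0.367).
    { destruct (Req_dec c 0) as [Hc0|Hc0]; [unfold k; rewrite Hc0, Rabs_R0; lra|].
      assert (0 < k) by now apply Rabs_pos_lt.
      assert (F1 * c = 2 / 3 * (k ^ 2 * (3 - 2 * k ^ 2)) - x * c).
      { unfold F1. rewrite Hk2. replace (s ^ 2) with (1 - c ^ 2) by lra. field. }
      assert (x * c <= 2 / 3 * k) by (unfold k, Rabs; destruct (Rcase_abs c); nra).
      assert (k * (3 - 2 * k ^ 2) <= 1).
      { apply (Rmult_le_reg_l k); [easy|]. nra. }
      assert (0 <= (k - 1) * (2 * k ^ 2 + 2 * k - 1)) by nra.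
      assert (2 * k ^ 2 + 2 * k - 1 <= 0) by nra. nra. }
    assert (HF2' : F2 * s <= 0).
    { assert (0 < s ^ 2 - c ^ 2) by nra. clear - H HF2. nra. }
    assert (F2 * s = 4 / 3 * (s ^ 2) ^ 2 - y * s).
    { unfold F2. replace (c ^ 2) with (1 - s ^ 2) by lra. field. }
    set (m := Rabs s). assert (Hm0 : 0 < m) by now apply Rabs_pos_lt.
    assert (Hm2 : m ^ 2 = s ^ 2) by (unfold m; apply pow2_abs).
    assert (y * s <= 1.065 * m) by (unfold m, Rabs; destruct (Rcase_abs s); nra).
    (* The bound on [y] now contradicts the bound on [k]: [m^2 = 1 - k^2 >= 0.865] makes [4/3 * m^3]
       exceed 1.07. *)
    assert (4 / 3 * m ^ 3 <= 1.065).
    { apply (Rmult_le_reg_l m); [easy|]. replace (m * (4 / 3 * m ^ 3)) with (4 / 3 * (m ^ 2) ^ 2) by field. rewrite Hm2. lra. }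
    assert (0.865 <= m ^ 2) by nra.
    assert (0.93 <= m) by nra. nra.
Qed.

(** The difference factors as [(a - b) * (1 - (a^2 + a b + b^2) / 3)]. The constant depends on [b]
    because it must degenerate towards the cusps; for each [b] inside the disk it is positive, which
    gives injectivity and continuity of the inverse at [phi_Ne b]. *)
Lemma phi_Ne_expand (a b : C) : Cmod a <= 1 ->
  (1 - (1 + Cmod b + Cmod b ^ 2) / 3) * Cmod (a - b) <= Cmod (phi_Ne a - phi_Ne b).
Proof.
intros Ha.
pose proof C3_neq_0 as H3.
replace (phi_Ne a - phi_Ne b)%C with ((a - b) * (1 - (a * a + a * b + b * b) / 3))%C
  by (unfold phi_Ne; field).
rewrite Cmod_mult, Rmult_comm. apply Rmult_le_compat_l; [apply Cmod_ge_0|].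
eapply Rle_trans; [|apply Cmod_tri_inv]. rewrite Cmod_1, (Cmod_div _ _ H3), Cmod_R, (Rabs_pos_eq 3) by lra.
assert (H1 := Cmod_triangle (a * a + a * b) (b * b)).
assert (H2 := Cmod_triangle (a * a) (a * b)).
rewrite Cmod_mult in H1. rewrite (Cmod_mult a a), (Cmod_mult a b) in H2. pose proof (Cmod_ge_0 a). pose proof (Cmod_ge_0 b).
assert (Cmod a * Cmod a <= 1) by nra. assert (Cmod a * Cmod b <= Cmod b) by nra. nra.
Qed.

(** Preimages are picked pointwise with no regard to continuity. [phi_Ne_expand] shows that there is
    only one choice in the disk, so [W 0 = 0], and through [Cder_lift] that [W] is
    differentiable. *)
Lemma subordinate_phi_Ne (p : C -> C) :
  analytic_on_disk p -> p 0 = 1 ->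
  (forall z, in_disk z -> Rabs (Re (p z) - 1) < 2 / 3 /\ Rabs (Im (p z)) < 1.065) ->
  subordinate p phi_Ne.
Proof.
intros Hp Hp0 Hrect.
pose (W := fun z => epsilon (inhabits (RtoC 0)) (fun w => Cmod w < 1 /\ phi_Ne w = p z)).
assert (HW : forall z, in_disk z -> Cmod (W z) < 1 /\ phi_Ne (W z) = p z).
{ intros z Hz. unfold W. apply epsilon_spec. destruct (Hrect z Hz) as [H1 H2].
  destruct (nephroid_rectangle _ _ H1 H2) as [w [Hw1 Hw2]].
  exists w. split; [easy|]. rewrite Hw2. apply injective_projections; unfold Re, Im; simpl; ring. }
assert (H00 : in_disk 0) by (unfold in_disk; rewrite Cmod_0; lra).
split; [easy|split].
{ intros z _. exists (1 - z * z)%C. apply Cder_phi_Ne. }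
exists W. repeat split.
- intros z Hz. destruct (HW z Hz) as [W1 W2]. destruct (Hp z Hz) as [l Hl].
  eexists. unfold in_disk in Hz.
  assert (Hnear : forall y, Cmod (y - z) < 1 - Cmod z -> in_disk y).
  { intros y Hy. unfold in_disk. replace y with (z + (y - z))%C by ring.
    eapply Rle_lt_trans; [apply Cmod_triangle|]. lra. }
  pose proof (Cmod_ge_0 (W z)).
  apply (Cder_lift phi_Ne p W z (1 - W z * W z)%C l (1 - (1 + Cmod (W z) + Cmod (W z) ^ 2) / 3) (1 - Cmod z)).
  + nra.
  + lra.
  + apply Cder_phi_Ne.
  + intros E. assert (E' : Cmod (W z * W z) = 1).
    { replace (W z * W z)%C with (1 - (1 - W z * W z))%C by ring. rewrite E.
      replace (1 - 0)%C with (RtoC 1) by ring. apply Cmod_1. }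
    rewrite Cmod_mult in E'. nra.
  + exact Hl.
  + intros y Hy. now apply HW, Hnear.
  + intros y Hy. apply phi_Ne_expand. apply Rlt_le, HW, Hnear, Hy.
- destruct (HW 0 H00) as [W1 W2]. rewrite Hp0 in W2.
  assert (H := phi_Ne_expand 0 (W 0)). rewrite Cmod_0 in H. specialize (H Rle_0_1).
  rewrite W2 in H. replace (phi_Ne 0 - 1)%C with (RtoC 0) in H by (unfold phi_Ne; simpl; field; intros E; injection E; lra).
  rewrite Cmod_0 in H. replace (0 - W 0)%C with (- W 0)%C in H by ring. rewrite Cmod_opp in H.
  pose proof (Cmod_ge_0 (W 0)). apply Cmod_eq_0. nra.
- intros z Hz. now apply HW.
- intros z Hz. symmetry. now apply HW.
Qed.

(** * Maximum principle and Schwarz lemma *)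

Definition Cder2 (f f1 f2 : C -> C) (z : C) : Prop := Cder f z (f1 z) /\ Cder f1 z (f2 z).

Lemma Cder2_mult (f f1 f2 g g1 g2 : C -> C) (z : C) :
  Cder2 f f1 f2 z -> Cder2 g g1 g2 z ->
  Cder2 (fun x => f x * g x)%C (fun x => f1 x * g x + f x * g1 x)%C
    (fun x => (f2 x * g x + f1 x * g1 x) + (f1 x * g1 x + f x * g2 x))%C z.
Proof.
intros [F1 F2] [G1 G2]. split; [now apply Cder_mult|].
apply Cder_plus; now apply Cder_mult.
Qed.

(* Local uniform limits of twice differentiable functions obey the maximum principle, by the second
   derivative test; this avoids Cauchy's theorem. *)
Definition smoothable (f : C -> C) (z0 : C) : Prop :=
  exists rho, 0 < rho /\ forall eta, 0 < eta -> exists g g1 g2 : C -> C,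
    forall z, Cmod (z - z0) < rho -> Cder2 g g1 g2 z /\ Cmod (g z - f z) < eta.

Lemma smoothable_Cder2 (f f1 f2 : C -> C) (z0 : C) (rho : R) : 0 < rho ->
  (forall z, Cmod (z - z0) < rho -> Cder2 f f1 f2 z) -> smoothable f z0.
Proof.
intros Hr H. exists rho. split; [easy|]. intros eta He. exists f, f1, f2.
intros z Hz. split; [now apply H|]. replace (f z - f z)%C with (RtoC 0) by ring. now rewrite Cmod_0.
Qed.

Lemma Cder_bounded (f : C -> C) (z l : C) : Cder f z l ->
  exists d, 0 < d /\ forall y, Cmod (y - z) < d -> Cmod (f y) <= Cmod (f z) + 1.
Proof.
intros H. destruct (Cder_cont f z l H 1 Rlt_0_1) as [d [Hd K]]. exists d. split; [easy|].
intros y Hy. specialize (K y Hy). pose proof (Cmod_tri_inv (f y) (f z)). lra.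
Qed.

Lemma smoothable_mult (f h : C -> C) (z0 a b : C) : Cder f z0 a -> Cder h z0 b ->
  smoothable f z0 -> smoothable h z0 -> smoothable (fun z => f z * h z)%C z0.
Proof.
intros Hf Hh [r1 [Hr1 K1]] [r2 [Hr2 K2]].
destruct (Cder_bounded _ _ _ Hf) as [d1 [Hd1 B1]].
destruct (Cder_bounded _ _ _ Hh) as [d2 [Hd2 B2]].
set (A := Cmod (f z0) + 1) in *. set (B := Cmod (h z0) + 1) in *.
assert (HA : 1 <= A) by (pose proof (Cmod_ge_0 (f z0)); unfold A; lra).
assert (HB : 1 <= B) by (pose proof (Cmod_ge_0 (h z0)); unfold B; lra).
exists (Rmin (Rmin r1 r2) (Rmin d1 d2)). split; [repeat apply Rmin_glb_lt; easy|].
intros eta He.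
(* The product error is at most [e * e + e * B + A * e], which for [e <= 1] is at most
   [e * (A + B + 1) <= eta / 2]. *)
set (e := Rmin 1 (eta / (2 * (A + B + 1)))).
assert (He0 : 0 < e) by (apply Rmin_glb_lt; [lra|apply Rdiv_lt_0_compat; lra]).
destruct (K1 e He0) as [g [g1 [g2 G]]]. destruct (K2 e He0) as [k [k1 [k2 K]]].
do 3 eexists. intros z Hz.
assert (Hz1 := Rlt_le_trans _ _ _ Hz (Rmin_l _ _)).
assert (Hz2 := Rlt_le_trans _ _ _ Hz (Rmin_r _ _)).
destruct (G z (Rlt_le_trans _ _ _ Hz1 (Rmin_l _ _))) as [Dg Eg].
destruct (K z (Rlt_le_trans _ _ _ Hz1 (Rmin_r _ _))) as [Dk Ek].
specialize (B1 z (Rlt_le_trans _ _ _ Hz2 (Rmin_l _ _))).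
specialize (B2 z (Rlt_le_trans _ _ _ Hz2 (Rmin_r _ _))).
split; [apply (Cder2_mult _ _ _ _ _ _ z Dg Dk)|].
change (Cmod (g z * k z - f z * h z) < eta).
replace (g z * k z - f z * h z)%C with ((g z - f z) * (k z - h z) + ((g z - f z) * h z + f z * (k z - h z)))%C by ring.
eapply Rle_lt_trans; [apply Cmod_triangle|].
assert (T := Cmod_triangle ((g z - f z) * h z) (f z * (k z - h z))).
rewrite (Cmod_mult (g z - f z) (h z)), (Cmod_mult (f z) (k z - h z)) in T.
rewrite (Cmod_mult (g z - f z) (k z - h z)).
assert (E1 : e <= 1) by apply Rmin_l.
assert (E2 : e * (2 * (A + B + 1)) <= eta).
{ assert (H : e <= eta / (2 * (A + B + 1))) by apply Rmin_r.
  apply (Rmult_le_compat_r (2 * (A + B + 1))) in H; [|lra].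
  unfold Rdiv in H. rewrite Rmult_assoc, Rinv_l, Rmult_1_r in H by lra. easy. }
pose proof (Cmod_ge_0 (g z - f z)). pose proof (Cmod_ge_0 (k z - h z)).
pose proof (Cmod_ge_0 (f z)). pose proof (Cmod_ge_0 (h z)).
assert (U1 : Cmod (g z - f z) * Cmod (k z - h z) <= e * 1) by (apply Rmult_le_compat; lra).
assert (U2 : Cmod (g z - f z) * Cmod (h z) <= e * B) by (apply Rmult_le_compat; lra).
assert (U3 : Cmod (f z) * Cmod (k z - h z) <= A * e) by (apply Rmult_le_compat; lra).
assert (0 < e * (A + B + 1)) by (apply Rmult_lt_0_compat; lra). lra.
Qed.

Lemma second_derivative_max (f f' : R -> R) (m d : R) : 0 < d ->
  (forall s, Rabs s < d -> is_derive f s (f' s)) -> is_derive f' 0 m ->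
  (forall s, Rabs s < d -> f s <= f 0) -> m <= 0.
Proof.
intros Hd Hf Hf' Hmax. destruct (Rle_lt_dec m 0) as [|Hm]; [easy|exfalso].
assert (R0 : Rabs 0 < d) by now rewrite Rabs_R0.
assert (H0 : f' 0 = 0).
{ apply (derive_max_zero f 0 _ d (Hf 0 R0) Hd). intros s Hs. apply Hmax. now rewrite Rminus_0_r in Hs. }
destruct (proj1 (is_derive_eps _ _ _) Hf' (m / 2)) as [d1 [Hd1 K]]; [lra|].
set (s := Rmin d d1 / 2). assert (0 < Rmin d d1) by now apply Rmin_glb_lt.
assert (Hs : 0 < s < d /\ s < d1).
{ pose proof (Rmin_l d d1). pose proof (Rmin_r d d1). unfold s. lra. }
destruct (MVT_cor2 f f' 0 s) as [c [Hc1 Hc2]]; [easy| |].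
{ intros c Hc. apply is_derive_Reals, Hf. rewrite Rabs_pos_eq; lra. }
specialize (K c). rewrite H0, !Rminus_0_r, Rabs_pos_eq in K by lra.
assert (Kc := K ltac:(lra)). apply Rabs_le_between in Kc.
assert (f s <= f 0) by (apply Hmax; rewrite Rabs_pos_eq; lra).
assert (0 < f' c) by nra. nra.
Qed.

(** [A] and [B] are the components of a complex function along the line through [(x, y)] with
    direction [(a, b)]. The left-hand side of the conclusion is half the second derivative of [Q] at
    0. *)
Lemma sqr_sum_line_max (A B A1 B1 : R -> R) (A2 B2 k m x y x0 y0 a b d : R) : 0 < d ->
  (forall s, Rabs s < d -> is_derive A s (A1 s) /\ is_derive B s (B1 s)) ->
  is_derive A1 0 A2 -> is_derive B1 0 B2 ->
  (let Q := fun s => A s ^ 2 + B s ^ 2 + k * ((x + s * a) ^ 2 + (y + s * b) ^ 2)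
      - m * ((x + s * a - x0) ^ 2 + (y + s * b - y0) ^ 2) in
   forall s, Rabs s < d -> Q s <= Q 0) ->
  A1 0 ^ 2 + B1 0 ^ 2 + (A 0 * A2 + B 0 * B2) + (k - m) * (a ^ 2 + b ^ 2) <= 0.
Proof.
intros Hd HAB HA2 HB2 Hmax.
apply (Rmult_le_reg_l 2); [lra|]. rewrite Rmult_0_r.
refine (second_derivative_max _ (fun s => 2 * (A s * A1 s + B s * B1 s)
   + 2 * k * ((x + s * a) * a + (y + s * b) * b)
   - 2 * m * ((x + s * a - x0) * a + (y + s * b - y0) * b)) _ d Hd _ _ Hmax).
- intros s Hs. destruct (HAB s Hs) as [H1 H2].
  auto_derive; [split; [|split; trivial]; eexists; eassumption|].
  replace (Derive (fun x => A x) s) with (A1 s) by (symmetry; apply is_derive_unique, H1).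
  replace (Derive (fun x => B x) s) with (B1 s) by (symmetry; apply is_derive_unique, H2). ring.
- destruct (HAB 0) as [H1 H2]; [now rewrite Rabs_R0|].
  auto_derive; [repeat split; trivial; eexists; eassumption|].
  replace (Derive (fun x => A x) 0) with (A1 0) by (symmetry; apply is_derive_unique, H1).
  replace (Derive (fun x => B x) 0) with (B1 0) by (symmetry; apply is_derive_unique, H2).
  replace (Derive (fun x => A1 x) 0) with A2 by (symmetry; apply is_derive_unique, HA2).
  replace (Derive (fun x => B1 x) 0) with B2 by (symmetry; apply is_derive_unique, HB2). ring.
Qed.

(* The Laplacian of [|g|^2 + k |z|^2 - m |z - z0|^2] is [4 |g'|^2 + 4 (k - m)]. *)
Lemma no_interior_max (g g1 g2 : C -> C) (z1 z0 : C) (k m d : R) : 0 < d -> m < k ->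
  (forall z, Cmod (z - z1) < d -> Cder2 g g1 g2 z) ->
  (let Q := fun z => Cmod (g z) ^ 2 + k * Cmod z ^ 2 - m * Cmod (z - z0) ^ 2 in
   forall z, Cmod (z - z1) < d -> Q z <= Q z1) -> False.
Proof.
intros Hd Hk Hg Hmax. cbv beta zeta in Hmax.
assert (Hline : forall a b, a ^ 2 + b ^ 2 = 1 ->
  Cmod (g1 z1) ^ 2 + (Re (g z1) * Re (g2 z1 * (a, b) * (a, b)) + Im (g z1) * Im (g2 z1 * (a, b) * (a, b))) + (k - m) <= 0).
{ intros a b Hab.
  assert (Hcab : Cmod (a, b) = 1).
  { assert (H := Cmod2_alt (a, b)). simpl Re in H; simpl Im in H. pose proof (Cmod_ge_0 (a, b)). nra. }
  pose (L := fun s => (fst z1 + s * a, snd z1 + s * b) : C).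
  assert (HL : forall s, Rabs s < d -> Cmod (L s - z1) < d).
  { intros s Hs. replace (L s - z1)%C with (RtoC s * (a, b))%C
      by (unfold L; apply injective_projections; simpl; ring).
    now rewrite Cmod_mult, Cmod_R, Hcab, Rmult_1_r. }
  assert (HL0 : L 0 = z1) by (unfold L; apply injective_projections; simpl; ring).
  assert (H0 : Cmod (z1 - z1) < d) by (replace (z1 - z1)%C with (RtoC 0) by ring; now rewrite Cmod_0).
  assert (Hg1e : Cder (fun z => g1 z * (a, b))%C z1 (g2 z1 * (a, b))%C).
  { refine (Cder_eq _ _ _ _ _ (Cder_mult _ _ _ _ _ (proj2 (Hg z1 H0)) (Cder_const (a, b) z1))). ring. }
  destruct (Cder_path _ _ _ (fun s => fst z1 + s * a) (fun s => snd z1 + s * b) 0 a b Hg1e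
     (is_derive_affine _ _ _) (is_derive_affine _ _ _) HL0) as [D1 D2].
  assert (H := sqr_sum_line_max (fun s => Re (g (L s))) (fun s => Im (g (L s)))
    (fun s => Re (g1 (L s) * (a, b))) (fun s => Im (g1 (L s) * (a, b)))
    (Re (g2 z1 * (a, b) * (a, b))) (Im (g2 z1 * (a, b) * (a, b)))
    k m (fst z1) (snd z1) (fst z0) (snd z0) a b d Hd).
  cbv beta zeta in H.
  rewrite Hab, Rmult_1_r, HL0 in H. rewrite <- (Cmod2_alt (g1 z1 * (a, b))), Cmod_mult, Hcab, Rmult_1_r in H.
  apply H; clear H; [|exact D1|exact D2|].
  - intros s Hs. exact (Cder_path g (L s) _ (fun s => fst z1 + s * a) (fun s => snd z1 + s * b) s a b
      (proj1 (Hg _ (HL s Hs))) (is_derive_affine _ _ _) (is_derive_affine _ _ _) eq_refl).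
  - intros s Hs. assert (H := Hmax (L s) (HL s Hs)). rewrite <- HL0 in H at 1 2 3.
    rewrite !Cmod2_alt in H.
    rewrite <- (f_equal (fun v => Re (g v)) HL0), <- (f_equal (fun v => Im (g v)) HL0). exact H. }
(* The directions 1 and i have opposite squares, so adding the two inequalities cancels [g2] and
   leaves [2 |g1|^2 + 2 (k - m) <= 0]. *)
assert (H1 := Hline 1 0 ltac:(ring)). assert (H2 := Hline 0 1 ltac:(ring)).
simpl in H1, H2. unfold Re, Im in H1, H2. simpl in H1, H2.
pose proof (pow2_ge_0 (Cmod (g1 z1))). nra.
Qed.

Lemma continuous_Cmod_id (a z : C) : continuous (fun x => Cmod (x - a)) z.
Proof.
apply (continuous_Cmod_Cder (fun x => x - a)%C z (1 - 0)%C).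
apply Cder_minus; [apply Cder_id|apply Cder_const].
Qed.

Lemma continuous_pow2 (f : C -> R) (z : C) : continuous f z -> continuous (fun x => f x ^ 2) z.
Proof.
intros H. apply (continuous_ext (fun x => f x * f x)); [intros; simpl; ring|].
now apply (continuous_mult (K := R_AbsRing)).
Qed.

Lemma continuous_quadratic (f : C -> R) (k m : R) (a z : C) : continuous f z ->
  continuous (fun x => f x ^ 2 + k * Cmod x ^ 2 - m * Cmod (x - a) ^ 2) z.
Proof.
intros H.
apply (continuous_minus (K := R_AbsRing) (V := R_NormedModule) (fun x => f x ^ 2 + k * Cmod x ^ 2)).
- apply (continuous_plus (K := R_AbsRing) (V := R_NormedModule) (fun x => f x ^ 2)).
  + now apply continuous_pow2.
  + apply (continuous_scal_r (K := R_AbsRing) (V := R_NormedModule) k (fun x => Cmod x ^ 2)).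
    apply continuous_pow2.
    apply (continuous_ext (fun x => Cmod (x - 0))); [intros; f_equal; ring|apply continuous_Cmod_id].
- apply (continuous_scal_r (K := R_AbsRing) (V := R_NormedModule) m (fun x => Cmod (x - a) ^ 2)).
  apply continuous_pow2, continuous_Cmod_id.
Qed.

(** A small multiple of [|x|^2] is added so that the maximum point [z0] of the sum is interior. Near
    [z0], [g] is replaced by a twice differentiable [h], and subtracting half as much of
    [|x - z0|^2] keeps a maximum interior in spite of the error, contradicting [no_interior_max].
    The origin may fail to be smoothable since [g] vanishes there. *)
Lemma maximum_principle (g : C -> C) (r M : R) : 0 < r -> 0 <= M ->
  (forall z, Cmod z <= r -> continuous (fun x => Cmod (g x)) z) -> g 0 = 0 ->
  (forall z, 0 < Cmod z < r -> smoothable g z) ->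
  (forall z, Cmod z = r -> Cmod (g z) <= M) ->
  forall z, Cmod z <= r -> Cmod (g z) <= M.
Proof.
intros Hr HM Hc Hg0 Hs Hbd z Hz.
destruct (Rle_lt_dec (Cmod (g z)) M) as [|Hlt]; [easy|exfalso].
(* Then [k * r^2] is half the excess of [|g z|^2] over [M^2], so neither the rim nor the origin can
   reach [T z]. *)
set (k := (Cmod (g z) ^ 2 - M ^ 2) / (2 * r ^ 2)).
assert (Hr2 : 0 < r ^ 2) by (apply pow_lt; easy).
assert (Hk : 0 < k) by (apply Rdiv_lt_0_compat; nra).
assert (Hkr : k * r ^ 2 = (Cmod (g z) ^ 2 - M ^ 2) / 2) by (unfold k; field; lra).
set (T := fun x => Cmod (g x) ^ 2 + k * Cmod x ^ 2 - 0 * Cmod (x - 0) ^ 2).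
destruct (disk_max T 0 r) as [z0 [Hz0 Hmax]]; [lra| |].
{ intros x Hx. apply (continuous_quadratic (fun x => Cmod (g x))). apply Hc.
  now replace x with (x - 0)%C by ring. }
replace (z0 - 0)%C with z0 in Hz0 by ring.
assert (Hmax' : forall x, Cmod x <= r -> T x <= T z0).
{ intros x Hx. apply Hmax. now replace (x - 0)%C with x by ring. }
clear Hmax. rename Hmax' into Hmax.
assert (HTz : Cmod (g z) ^ 2 <= T z0).
{ apply Rle_trans with (2 := Hmax z Hz). unfold T. pose proof (pow2_ge_0 (Cmod z)). nra. }
assert (Hz0r : Cmod z0 < r).
{ destruct (Rle_lt_or_eq_dec _ _ Hz0) as [|E]; [easy|exfalso].
  unfold T in HTz. rewrite E in HTz. specialize (Hbd z0 E). pose proof (Cmod_ge_0 (g z0)). nra. }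
assert (Hz00 : 0 < Cmod z0).
{ apply Cmod_gt_0. intros E. unfold T in HTz. rewrite E, Hg0, Cmod_0 in HTz. nra. }
destruct (Hs z0 (conj Hz00 Hz0r)) as [rho [Hrho Happ]].
set (q := Rmin rho (r - Cmod z0) / 2).
assert (Hmin : 0 < Rmin rho (r - Cmod z0)) by (apply Rmin_glb_lt; lra).
assert (Hq : 0 < q /\ q < rho /\ q < r - Cmod z0).
{ pose proof (Rmin_l rho (r - Cmod z0)). pose proof (Rmin_r rho (r - Cmod z0)). unfold q. lra. }
set (B := T z0 + 1).
assert (HB : 1 <= B) by (unfold B; pose proof (pow2_ge_0 (Cmod (g z))); lra).
assert (Hin : forall x, Cmod (x - z0) <= q -> Cmod x <= r).
{ intros x Hx. replace x with (z0 + (x - z0))%C by ring. eapply Rle_trans; [apply Cmod_triangle|]. lra. }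
assert (HgB : forall x, Cmod x <= r -> Cmod (g x) <= B).
{ intros x Hx. specialize (Hmax x Hx). unfold T at 1 in Hmax. pose proof (pow2_ge_0 (Cmod x)).
  pose proof (Cmod_ge_0 (g x)).
  assert (Cmod (g x) ^ 2 <= B - 1) by (unfold B; nra). nra. }
(* Squared moduli then change by at most [k q^2 / 8]. Two such errors stay below the loss
   [k q^2 / 2] that the subtracted term causes on the rim of the small disk. *)
set (eta := Rmin 1 (k * q ^ 2 / (8 * (2 * B + 1)))).
assert (Hq2 : 0 < q ^ 2) by (apply pow_lt; easy).
assert (Heta : 0 < eta) by (apply Rmin_glb_lt; [lra|apply Rdiv_lt_0_compat; nra]).
assert (Heta1 : eta <= 1) by apply Rmin_l.
assert (Heta2 : eta * (2 * B + 1) <= k * q ^ 2 / 8).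
{ assert (H : eta <= k * q ^ 2 / (8 * (2 * B + 1))) by apply Rmin_r.
  apply (Rmult_le_compat_r (2 * B + 1)) in H; [|lra].
  replace (k * q ^ 2 / (8 * (2 * B + 1)) * (2 * B + 1)) with (k * q ^ 2 / 8) in H by (field; lra). easy. }
destruct (Happ eta Heta) as [h [h1 [h2 Hh]]].
assert (Hclose : forall x, Cmod (x - z0) <= q -> Rabs (Cmod (h x) ^ 2 - Cmod (g x) ^ 2) <= k * q ^ 2 / 8).
{ intros x Hx. apply Rle_trans with (2 := Heta2).
  destruct (Hh x ltac:(lra)) as [_ E].
  assert (Gx := HgB x (Hin x Hx)).
  assert (Cmod (h x) - Cmod (g x) <= eta) by (pose proof (Cmod_tri_inv (h x) (g x)); lra).
  assert (Cmod (g x) - Cmod (h x) <= eta) by (pose proof (Cmod_tri_inv (g x) (h x)); rewrite Cmod_minus_sym in H0; lra).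
  pose proof (Cmod_ge_0 (h x)). pose proof (Cmod_ge_0 (g x)).
  replace (Cmod (h x) ^ 2 - Cmod (g x) ^ 2) with ((Cmod (h x) - Cmod (g x)) * (Cmod (h x) + Cmod (g x))) by ring.
  rewrite Rabs_mult. apply Rmult_le_compat; try apply Rabs_pos; [apply Rabs_le; lra|].
  rewrite Rabs_pos_eq by lra. lra. }
set (Q := fun x => Cmod (h x) ^ 2 + k * Cmod x ^ 2 - k / 2 * Cmod (x - z0) ^ 2).
destruct (disk_max Q z0 q) as [z1 [Hz1 Hmax1]]; [lra| |].
{ intros x Hx. apply (continuous_quadratic (fun x => Cmod (h x))).
  destruct (Hh x ltac:(lra)) as [[D _] _]. exact (continuous_Cmod_Cder _ _ _ D). }
assert (H00 : Cmod (z0 - z0) = 0) by (replace (z0 - z0)%C with (RtoC 0) by ring; apply Cmod_0).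
assert (Hz1q : Cmod (z1 - z0) < q).
{ destruct (Rle_lt_or_eq_dec _ _ Hz1) as [|E]; [easy|exfalso].
  specialize (Hmax1 z0 ltac:(lra)). unfold Q in Hmax1. rewrite H00, E in Hmax1.
  assert (C0 := Hclose z0 ltac:(lra)). assert (C1 := Hclose z1 Hz1).
  apply Rabs_le_between in C0. apply Rabs_le_between in C1.
  specialize (Hmax z1 (Hin z1 Hz1)). unfold T in Hmax. nra. }
apply (no_interior_max h h1 h2 z1 z0 k (k / 2) (q - Cmod (z1 - z0))); [lra|lra| |].
- intros x Hx. apply Hh.
  replace (x - z0)%C with ((x - z1) + (z1 - z0))%C by ring.
  eapply Rle_lt_trans; [apply Cmod_triangle|]. lra.
- intros Q' x Hx. apply Hmax1.
  replace (x - z0)%C with ((x - z1) + (z1 - z0))%C by ring.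
  eapply Rle_trans; [apply Cmod_triangle|]. lra.
Qed.

Lemma Cder_Cpow (f : C -> C) (z l : C) (n : nat) : Cder f z l ->
  exists m, Cder (fun x => f x ^ n)%C z m.
Proof.
intros Hf. induction n as [|n [m Hm]].
- exists (RtoC 0). apply (Cder_const (RtoC 1)).
- eexists. apply (Cder_mult _ _ _ _ _ Hf Hm).
Qed.

Lemma Cder_inv_id2 (z : C) : z <> 0 ->
  Cder2 (fun x => / x)%C (fun x => - / (x * x))%C (fun x => 2 / (x * x * x))%C z.
Proof.
intros Hz.
assert (I := Cder_id z).
split.
- refine (Cder_eq _ _ _ _ _ (Cder_inv _ _ _ I Hz)). field. easy.
- assert (Hzz : (z * z)%C <> 0) by now apply Cmult_neq_0.
  refine (Cder_eq _ _ _ _ _ (Cder_opp _ _ _ (Cder_inv _ _ _ (Cder_mult _ _ _ _ _ I I) Hzz))). field. easy.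
Qed.

(* The factor [w] makes [w (w / z)^n] tend to [0] at the origin, so that no removable singularity
   theorem is needed; its circle bound yields Schwarz's lemma as [n] grows. *)
Lemma schwarz (w : C -> C) : analytic_on_disk w -> w 0 = 0 ->
  (forall z, in_disk z -> Cmod (w z) < 1) ->
  (forall z, 0 < Cmod z < 1 -> smoothable w z) ->
  forall z, in_disk z -> Cmod (w z) <= Cmod z.
Proof.
intros Hw Hw0 Hw1 Hsm z Hz. unfold in_disk in *.
destruct (Rle_lt_dec (Cmod (w z)) (Cmod z)) as [|Hlt]; [easy|exfalso].
assert (Hz0 : z <> 0).
{ intros E. rewrite E, Hw0 in Hlt. lra. }
assert (Hzp : 0 < Cmod z) by now apply Cmod_gt_0.
pose (G := fun n x => (w x * (w x / x) ^ n)%C).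
assert (Hne : forall x, 0 < Cmod x -> x <> 0) by (intros x Hx; now apply Cmod_gt_0).
assert (Dq : forall x, 0 < Cmod x < 1 -> exists l, Cder (fun y => w y / y)%C x l).
{ intros x Hx. destruct (Hw x ltac:(unfold in_disk; lra)) as [l Hl].
  eexists. apply (Cder_div _ _ _ _ _ Hl (Cder_id x)). apply Hne; lra. }
assert (DG : forall n x, 0 < Cmod x < 1 -> exists l, Cder (G n) x l).
{ intros n x Hx. destruct (Hw x ltac:(unfold in_disk; lra)) as [l Hl].
  destruct (Dq x Hx) as [l1 Hl1]. destruct (Cder_Cpow _ _ _ n Hl1) as [l2 Hl2].
  eexists. apply (Cder_mult _ _ _ _ _ Hl Hl2). }
assert (SG : forall n x, 0 < Cmod x < 1 -> smoothable (G n) x).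
{ intros n x Hx.
  destruct (Hw x ltac:(unfold in_disk; lra)) as [l Hl].
  assert (Hx0 : x <> 0) by (apply Hne; lra).
  assert (Hq : smoothable (fun y => w y / y)%C x).
  { apply (smoothable_mult w (fun y => / y)%C x _ _ Hl (proj1 (Cder_inv_id2 x Hx0))); [now apply Hsm|].
    apply (smoothable_Cder2 _ (fun y => - / (y * y))%C (fun y => 2 / (y * y * y))%C x (Cmod x)); [lra|].
    intros y Hy. apply Cder_inv_id2. intros E. rewrite E in Hy.
    replace (0 - x)%C with (- x)%C in Hy by ring. rewrite Cmod_opp in Hy. lra. }
  destruct (Dq x Hx) as [l1 Hl1].
  assert (Hp : smoothable (fun y => (w y / y) ^ n)%C x).
  { clear - Hl1 Hq. induction n as [|n IH].
    - apply (smoothable_Cder2 (fun _ => RtoC 1) (fun _ => RtoC 0) (fun _ => RtoC 0) x 1 Rlt_0_1).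
      intros y _. split; apply (Cder_const (RtoC _)).
    - destruct (Cder_Cpow _ _ _ n Hl1) as [l2 Hl2].
      exact (smoothable_mult _ _ _ _ _ Hl1 Hl2 Hq IH). }
  destruct (Cder_Cpow _ _ _ n Hl1) as [l2 Hl2].
  exact (smoothable_mult w _ _ _ _ Hl Hl2 (Hsm x Hx) Hp). }
(* At the origin the quotient has the default value of division, which the factor [w 0 = 0]
   annihilates. *)
assert (G0 : forall n, G n 0 = 0) by (intros n; unfold G; rewrite Hw0; ring).
assert (HGm : forall n (x : C), x <> 0 -> Cmod (G n x) = Cmod (w x) * (Cmod (w x) / Cmod x) ^ n).
{ intros n x Hx. unfold G. rewrite Cmod_mult, Cmod_pow, Cmod_div by easy. reflexivity. }
assert (CG : forall n x, Cmod x < 1 -> continuous (fun y => Cmod (G n y)) x).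
{ intros n x Hx. destruct (Rle_lt_or_eq_dec _ _ (Cmod_ge_0 x)) as [Hp|E].
  - destruct (DG n x (conj Hp Hx)) as [l Hl]. exact (continuous_Cmod_Cder _ _ _ Hl).
  - symmetry in E. apply Cmod_eq_0 in E. subst x.
    destruct (Hw 0) as [l Hl]; [unfold in_disk; rewrite Cmod_0; lra|].
    destruct (proj1 (Cder_eps _ _ _) Hl 1 Rlt_0_1) as [d1 [Hd1 K1]].
    (* Near 0 the quotient [|w y / y|] is at most [K], hence [|G n y| <= |w y| * K^n], which tends
       to 0. *)
    set (K := 1 + Cmod l). assert (HK : 1 <= K) by (pose proof (Cmod_ge_0 l); unfold K; lra).
    apply continuous_eps. intros eps He.
    destruct (Cder_cont _ _ _ Hl (eps / K ^ n)) as [d2 [Hd2 K2]].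
    { apply Rdiv_lt_0_compat; [easy|apply pow_lt; lra]. }
    exists (Rmin d1 d2). split; [now apply Rmin_glb_lt|]. intros y Hy.
    rewrite G0, Cmod_0, Rminus_0_r, Rabs_pos_eq by apply Cmod_ge_0.
    assert (Hy1 := K1 y (Rlt_le_trans _ _ _ Hy (Rmin_l _ _))).
    assert (Hy2 := K2 y (Rlt_le_trans _ _ _ Hy (Rmin_r _ _))).
    rewrite Hw0 in Hy1, Hy2. replace (y - 0)%C with y in Hy1 by ring.
    replace (w y - 0)%C with (w y) in Hy2 by ring. replace (w y - 0 - y * l)%C with (w y - y * l)%C in Hy1 by ring.
    destruct (Rle_lt_or_eq_dec _ _ (Cmod_ge_0 y)) as [Hp|E].
    + rewrite HGm by now apply Hne.
      assert (Hwy : Cmod (w y) / Cmod y <= K).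
      { apply (Rmult_le_reg_r (Cmod y)); [easy|]. unfold Rdiv. rewrite Rmult_assoc, Rinv_l, Rmult_1_r by lra.
        replace (w y) with ((w y - y * l) + y * l)%C by ring.
        eapply Rle_trans; [apply Cmod_triangle|]. rewrite Cmod_mult. unfold K. lra. }
      assert (Hwy0 : 0 <= Cmod (w y) / Cmod y) by (apply Rdiv_le_0_compat; [apply Cmod_ge_0|easy]).
      assert (Hpw := pow_incr _ _ n (conj Hwy0 Hwy)).
      assert (HKn : 0 < K ^ n) by (apply pow_lt; lra).
      apply Rle_lt_trans with (Cmod (w y) * K ^ n).
      * apply Rmult_le_compat_l; [apply Cmod_ge_0|easy].
      * apply (Rmult_lt_compat_r (K ^ n)) in Hy2; [|easy].
        unfold Rdiv in Hy2. rewrite Rmult_assoc, Rinv_l, Rmult_1_r in Hy2 by lra. easy.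
    + symmetry in E. apply Cmod_eq_0 in E. subst y. rewrite G0, Cmod_0. easy. }
assert (Hwz1 := Hw1 z Hz).
(* Any radius between [|z| / |w z|] and 1 makes [q > 1]. The maximum principle on [|x| <= r] then
   bounds [|w z| * q^n] by 1 for every [n], although [q^n] is unbounded. *)
set (r := (1 + Cmod z / Cmod (w z)) / 2).
assert (Hratio : Cmod z < Cmod z / Cmod (w z) < 1).
{ split; apply (Rmult_lt_reg_r (Cmod (w z))); try lra; unfold Rdiv; rewrite Rmult_assoc, Rinv_l by lra; nra. }
assert (Hr : Cmod z / Cmod (w z) < r < 1) by (unfold r; lra).
set (q := Cmod (w z) * r / Cmod z).
assert (Hq : 1 < q).
{ unfold q. apply (Rmult_lt_reg_r (Cmod z)); [easy|]. unfold Rdiv. rewrite Rmult_assoc, Rinv_l by lra.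
  destruct Hr as [Hr _]. apply (Rmult_lt_compat_l (Cmod (w z))) in Hr; [|lra].
  replace (Cmod (w z) * (Cmod z / Cmod (w z))) with (Cmod z) in Hr by (field; lra). lra. }
assert (Hall : forall n, Cmod (w z) * q ^ n <= 1).
{ intros n.
  assert (Hrn : 0 < r ^ n) by (apply pow_lt; lra).
  assert (HM := maximum_principle (G n) r ((/ r) ^ n)).
  assert (HMz : Cmod (G n z) <= (/ r) ^ n).
  { apply HM; try lra.
    - apply pow_le. apply Rlt_le, Rinv_0_lt_compat. lra.
    - intros x Hx. apply CG. lra.
    - apply G0.
    - intros x Hx. apply SG. lra.
    - intros x Hx. rewrite HGm by (apply Hne; lra). rewrite Hx.
      assert (Hwx := Hw1 x ltac:(lra)). pose proof (Cmod_ge_0 (w x)).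
      assert (Hdiv : 0 <= Cmod (w x) / r <= / r).
      { assert (0 < / r) by (apply Rinv_0_lt_compat; lra). unfold Rdiv. nra. }
      assert (Hp := pow_incr _ _ n Hdiv).
      assert (0 <= (Cmod (w x) / r) ^ n) by (apply pow_le; lra).
      assert (0 <= (/ r) ^ n) by lra. nra. }
  rewrite HGm in HMz by easy.
  apply (Rmult_le_compat_r (r ^ n)) in HMz; [|lra].
  rewrite <- Rpow_mult_distr, Rinv_l, pow1 in HMz by lra.
  rewrite Rmult_assoc, <- Rpow_mult_distr in HMz.
  replace q with (Cmod (w z) / Cmod z * r) by (unfold q; field; lra). easy. }
destruct (Pow_x_infinity q ltac:(rewrite Rabs_pos_eq; lra) (2 / Cmod (w z))) as [N HN].
specialize (HN N ltac:(lia)). rewrite Rabs_pos_eq in HN by (apply pow_le; lra).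
specialize (Hall N).
apply Rge_le in HN. apply (Rmult_le_compat_l (Cmod (w z))) in HN; [|lra].
replace (Cmod (w z) * (2 / Cmod (w z))) with 2 in HN by (field; lra). lra.
Qed.

(** The square of half-side [2 r] about [z0] lies within distance [4 r] and contains both [z] and
    [z + h], so uniform continuity on rectangles applies to each component. *)
Lemma Cder_uniformly_continuous (f f1 : C -> C) (z0 : C) (r : R) :
  (forall z, Cmod (z - z0) <= 4 * r -> Cder f z (f1 z)) ->
  forall eps, 0 < eps -> exists d, 0 < d /\ forall (z : C) h, Cmod (z - z0) < r -> 0 <= h < d -> h <= r ->
    Rabs (Re (f (z + h)%C) - Re (f z)) < eps /\ Rabs (Im (f (z + h)%C) - Im (f z)) < eps.
Proof.
intros Hf eps He.
assert (Hrect : forall x y, fst z0 - 2 * r <= x <= fst z0 + 2 * r -> snd z0 - 2 * r <= y <= snd z0 + 2 * r ->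
  forall e : posreal, exists d : posreal, forall u v, Rabs (u - x) < d -> Rabs (v - y) < d ->
    Cmod (f (u, v) - f (x, y)) < e).
{ intros x y Hx Hy e.
  assert (Hxy : Cmod ((x, y) - z0) <= 4 * r).
  { eapply Rle_trans; [apply Cmod_le_sum|]. simpl.
    assert (Rabs (x + - fst z0) <= 2 * r) by (apply Rabs_le; lra).
    assert (Rabs (y + - snd z0) <= 2 * r) by (apply Rabs_le; lra). lra. }
  destruct (Cder_cont _ _ _ (Hf _ Hxy) e (cond_pos e)) as [d [Hd K]].
  exists (mkposreal (d / 2) ltac:(lra)). intros u v Hu Hv. simpl in Hu, Hv. apply K.
  eapply Rle_lt_trans; [apply Cmod_le_sum|]. simpl. unfold Rminus in *. lra. }
assert (CR : forall x y, fst z0 - 2 * r <= x <= fst z0 + 2 * r -> snd z0 - 2 * r <= y <= snd z0 + 2 * r ->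
  continuity_2d_pt (fun u v => Re (f (u, v))) x y).
{ intros x y Hx Hy e. destruct (Hrect x y Hx Hy e) as [d K]. exists d. intros u v Hu Hv.
  eapply Rle_lt_trans; [|exact (K u v Hu Hv)]. apply (re_le_Cmod (f (u, v) - f (x, y))). }
assert (CI : forall x y, fst z0 - 2 * r <= x <= fst z0 + 2 * r -> snd z0 - 2 * r <= y <= snd z0 + 2 * r ->
  continuity_2d_pt (fun u v => Im (f (u, v))) x y).
{ intros x y Hx Hy e. destruct (Hrect x y Hx Hy e) as [d K]. exists d. intros u v Hu Hv.
  eapply Rle_lt_trans; [|exact (K u v Hu Hv)]. apply (Im_le_Cmod (f (u, v) - f (x, y))). }
destruct (uniform_continuity_2d _ _ _ _ _ CR (mkposreal eps He)) as [d1 K1].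
destruct (uniform_continuity_2d _ _ _ _ _ CI (mkposreal eps He)) as [d2 K2].
exists (Rmin d1 d2). split; [apply Rmin_glb_lt; apply cond_pos|].
intros [x y] h Hz Hh Hhr.
pose proof (Rle_lt_trans _ _ _ (re_le_Cmod _) Hz) as Hx.
pose proof (Rle_lt_trans _ _ _ (Im_le_Cmod _) Hz) as Hy.
simpl in Hx, Hy. apply Rabs_def2 in Hx. apply Rabs_def2 in Hy.
pose proof (Rmin_l d1 d2). pose proof (Rmin_r d1 d2).
replace ((x, y) + h)%C with (x + h, y) by (apply injective_projections; simpl; ring).
assert (E1 : Rabs (x + h - x) = h) by (replace (x + h - x) with h by ring; apply Rabs_pos_eq; lra).
assert (E2 : Rabs (y - y) = 0) by (replace (y - y) with 0 by ring; apply Rabs_R0).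
pose proof (cond_pos d1). pose proof (cond_pos d2).
split; [apply (K1 x y (x + h) y)|apply (K2 x y (x + h) y)]; simpl; lra.
Qed.

(** The mean value theorem is applied to the real and imaginary parts along the horizontal segment
    from [z] to [z + h]. The two intermediate points differ, but both lie within [h] of [z], so
    uniform continuity of [p1] controls both. *)
Lemma difference_quotient_uniform (p p1 p2 : C -> C) (z0 : C) (r : R) : 0 < r ->
  (forall z, Cmod (z - z0) < 5 * r -> Cder2 p p1 p2 z) ->
  forall eps, 0 < eps -> exists h, 0 < h <= r /\ forall z, Cmod (z - z0) < r ->
    Cmod ((p (z + h)%C - p z) / h - p1 z) <= eps.
Proof.
intros Hr Hp eps He.
destruct (Cder_uniformly_continuous p1 p2 z0 r) with (eps := eps / 2) as [d [Hd K]]; [|lra|].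
{ intros z Hz. apply Hp. lra. }
set (h := Rmin r (d / 2)).
assert (Hh : 0 < h <= r /\ h < d).
{ pose proof (Rmin_l r (d / 2)). pose proof (Rmin_r r (d / 2)).
  assert (0 < h) by (apply Rmin_glb_lt; lra). unfold h in *. lra. }
exists h. split; [easy|]. intros [x y] Hz.
pose (L := fun t => (x + t * 1, y + t * 0) : C).
assert (E : forall t, L t = ((x, y) + t)%C)
  by (intros t; apply injective_projections; simpl; ring).
assert (Hin : forall t, 0 <= t <= h -> Cmod (L t - z0) < 5 * r).
{ intros t Ht. rewrite E. replace ((x, y) + t - z0)%C with (((x, y) - z0) + t)%C by ring.
  eapply Rle_lt_trans; [apply Cmod_triangle|]. rewrite Cmod_R, Rabs_pos_eq by lra. lra. }
assert (D : forall t, 0 <= t <= h -> _ /\ _) by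
  (intros t Ht; exact (Cder_path p (L t) _ (fun s => x + s * 1) (fun s => y + s * 0) t 1 0
     (proj1 (Hp _ (Hin t Ht))) (is_derive_affine _ _ _) (is_derive_affine _ _ _) eq_refl)).
destruct (MVT_gen _ 0 h _ (fun t Ht => proj1 (D t ltac:(rewrite Rmin_left, Rmax_right in Ht by lra; lra)))) as [a [Ha Ma]].
{ intros t Ht. rewrite Rmin_left, Rmax_right in Ht by lra. apply continuity_pt_filterlim.
  apply (ex_derive_continuous (K := R_AbsRing) (V := R_NormedModule)). eexists. apply (proj1 (D t Ht)). }
destruct (MVT_gen _ 0 h _ (fun t Ht => proj2 (D t ltac:(rewrite Rmin_left, Rmax_right in Ht by lra; lra)))) as [b [Hb Mb]].
{ intros t Ht. rewrite Rmin_left, Rmax_right in Ht by lra. apply continuity_pt_filterlim.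
  apply (ex_derive_continuous (K := R_AbsRing) (V := R_NormedModule)). eexists. apply (proj2 (D t Ht)). }
rewrite Rmin_left, Rmax_right in Ha, Hb by lra.
change (Re (p (L h)) - Re (p (L 0)) = Re (p1 (L a) * (1, 0)) * (h - 0)) in Ma.
change (Im (p (L h)) - Im (p (L 0)) = Im (p1 (L b) * (1, 0)) * (h - 0)) in Mb.
rewrite !E in Ma, Mb.
rewrite Cplus_0_r in Ma, Mb.
assert (KA := proj1 (K (x, y) a Hz ltac:(lra) ltac:(lra))).
assert (KB := proj2 (K (x, y) b Hz ltac:(lra) ltac:(lra))).
set (z := (x, y) : C) in *.
assert (E1 : forall c : C, Re (Cmult c (1%R, 0%R)) = Re c) by (intros c; unfold Re; simpl; ring).
assert (E2 : forall c : C, Im (Cmult c (1%R, 0%R)) = Im c) by (intros c; unfold Im; simpl; ring).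
rewrite E1 in Ma. rewrite E2 in Mb.
assert (Hh0 : RtoC h <> 0) by (intros F; injection F; lra).
pose (v := (Re (p1 (z + a)%C), Im (p1 (z + b)%C)) : C).
assert (Hv : (p (z + h) - p z)%C = (RtoC h * v)%C).
{ unfold v, Re, Im in *. apply injective_projections; simpl; lra. }
assert (EQ : ((p (z + h) - p z) / h - p1 z)%C = (v - p1 z)%C) by (rewrite Hv; field; easy).
rewrite EQ. eapply Rle_trans; [apply Cmod_le_sum|]. unfold v, Re, Im, Rminus in *. simpl. lra.
Qed.

(* Replacing [p1] by difference quotients of [p] in [Csin w = k p1] gives the approximations. *)
Lemma smoothable_arcsin (p p1 p2 k k1 k2 w : C -> C) (z0 l : C) (r : R) : 0 < r ->
  (forall z, Cmod (z - z0) < r -> Cder2 p p1 p2 z /\ Cder2 k k1 k2 z /\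
     Cmod (w z) < 1 /\ Csin (w z) = (k z * p1 z)%C) ->
  Cder w z0 l -> smoothable w z0.
Proof.
intros Hr H Hw.
assert (Hzz : Cmod (z0 - z0) = 0) by (replace (z0 - z0)%C with (RtoC 0) by ring; apply Cmod_0).
destruct (H z0 ltac:(lra)) as [_ [[Hk0 _] [Hw0 _]]].
(* Near [z0] this keeps [|w| <= 1 - a], so a perturbation of [w] by less than [a] stays in the unit
   disk, where [Csin] expands. *)
set (a := (1 - Cmod (w z0)) / 2). assert (Ha : 0 < a) by (unfold a; lra).
destruct (Cder_cont _ _ _ Hw a Ha) as [d1 [Hd1 K1]].
destruct (Cder_bounded _ _ _ Hk0) as [d2 [Hd2 K2]].
set (B := Cmod (k z0) + 1) in *. assert (HB : 1 <= B) by (pose proof (Cmod_ge_0 (k z0)); unfold B; lra).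
set (rho := Rmin (r / 6) (Rmin d1 d2)).
assert (Hrho : 0 < rho) by (repeat apply Rmin_glb_lt; lra).
assert (Hrho' : rho <= r / 6 /\ rho <= d1 /\ rho <= d2).
{ unfold rho. pose proof (Rmin_l (r / 6) (Rmin d1 d2)). pose proof (Rmin_r (r / 6) (Rmin d1 d2)).
  pose proof (Rmin_l d1 d2). pose proof (Rmin_r d1 d2). lra. }
exists rho. split; [easy|]. intros eta Heta.
set (s := Rmin eta a / 2).
assert (Hm : 0 < Rmin eta a) by now apply Rmin_glb_lt.
assert (Hs : 0 < s /\ s < eta /\ s < a).
{ pose proof (Rmin_l eta a). pose proof (Rmin_r eta a). unfold s. lra. }
(* Multiplied by [|k| <= B] this error is at most [s / 8], below the margin [s / 4] that
   [disk_preimage] grants with expansion constant 1/2. *)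
destruct (difference_quotient_uniform p p1 p2 z0 rho Hrho) with (eps := s / (8 * B)) as [h [Hh Kh]].
{ intros z Hz. apply H. lra. }
{ apply Rdiv_lt_0_compat; lra. }
assert (Hh0 : RtoC h <> 0) by (intros F; injection F; lra).
pose (q := fun z => ((p (z + h) - p z) * / h)%C).
pose (q1 := fun z => ((p1 (z + h) - p1 z) * / h)%C).
pose (q2 := fun z => ((p2 (z + h) - p2 z) * / h)%C).
assert (Hq : forall z, Cmod (z - z0) < rho -> Cder2 q q1 q2 z).
{ intros z Hz.
  destruct (H z ltac:(lra)) as [[P1 P2] _].
  destruct (H (z + h)%C) as [[Q1 Q2] _].
  { replace (z + h - z0)%C with ((z - z0) + h)%C by ring.
    eapply Rle_lt_trans; [apply Cmod_triangle|]. rewrite Cmod_R, Rabs_pos_eq by lra. lra. }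
  assert (Hsh : Cder (fun x => x + h)%C z (RtoC 1)).
  { refine (Cder_eq _ _ _ _ _ (Cder_plus _ _ _ _ _ (Cder_id z) (Cder_const h z))). ring. }
  split.
  - refine (Cder_eq _ _ _ _ _ (Cder_mult _ _ _ _ _ (Cder_minus _ _ _ _ _ (Cder_comp p (fun x => x + h)%C z _ _ Q1 Hsh) P1) (Cder_const (/ h)%C z))).
    unfold q1. ring.
  - refine (Cder_eq _ _ _ _ _ (Cder_mult _ _ _ _ _ (Cder_minus _ _ _ _ _ (Cder_comp p1 (fun x => x + h)%C z _ _ Q2 Hsh) P2) (Cder_const (/ h)%C z))).
    unfold q2. ring. }
pose (F := fun z => (k z * q z)%C).
assert (Hex : forall z, Cmod (z - z0) < rho -> exists x, Cmod (x - w z) < s /\ Csin x = F z).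
{ intros z Hz. destruct (H z ltac:(lra)) as [_ [_ [Hwz Esin]]].
  assert (Hwa : Cmod (w z) <= 1 - a).
  { assert (T := K1 z ltac:(lra)). pose proof (Cmod_tri_inv (w z) (w z0)). unfold a in *. lra. }
  assert (Hball : forall x, Cmod (x - w z) <= s -> Cmod x <= 1).
  { intros x Hx. replace x with (w z + (x - w z))%C by ring. eapply Rle_trans; [apply Cmod_triangle|]. lra. }
  apply (disk_preimage Csin Ccos (w z) (F z) s (/ 2)); [lra|lra| | |].
  - intros x Hx. split; [apply Cder_Csin|]. apply Ccos_neq_0. now apply Hball.
  - intros x Hx. apply Csin_expand; [now apply Hball|lra].
  - rewrite Esin. unfold F, q.
    replace (k z * ((p (z + h) - p z) * / h) - k z * p1 z)%C with (k z * ((p (z + h) - p z) / h - p1 z))%C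
      by (unfold Cdiv; ring).
    rewrite Cmod_mult. specialize (Kh z Hz). specialize (K2 z ltac:(lra)).
    apply Rle_lt_trans with (B * (s / (8 * B))).
    + apply Rmult_le_compat; try apply Cmod_ge_0; easy.
    + replace (B * (s / (8 * B))) with (s / 8) by (field; lra). lra. }
pose (W := fun z => epsilon (inhabits (RtoC 0)) (fun x => Cmod (x - w z) < s /\ Csin x = F z)).
assert (HW : forall z, Cmod (z - z0) < rho -> Cmod (W z - w z) < s /\ Csin (W z) = F z).
{ intros z Hz. unfold W. apply epsilon_spec. now apply Hex. }
assert (HW1 : forall z, Cmod (z - z0) < rho -> Cmod (W z) <= 1).
{ intros z Hz. assert (T := K1 z ltac:(lra)). pose proof (Cmod_tri_inv (w z) (w z0)).
  destruct (HW z Hz) as [T' _]. pose proof (Cmod_tri_inv (W z) (w z)). unfold a in *. lra. }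
pose (F1 := fun z => (k1 z * q z + k z * q1 z)%C).
assert (HF : forall z, Cmod (z - z0) < rho -> Cder2 F F1
  (fun x => (k2 x * q x + k1 x * q1 x) + (k1 x * q1 x + k x * q2 x))%C z).
{ intros z Hz. apply Cder2_mult; [|now apply Hq]. apply H. lra. }
pose (W1 := fun z => (F1 z / Ccos (W z))%C).
assert (DW : forall z, Cmod (z - z0) < rho -> Cder W z (W1 z)).
{ intros z Hz.
  assert (Hnear : forall y, Cmod (y - z) < rho - Cmod (z - z0) -> Cmod (y - z0) < rho).
  { intros y Hy. replace (y - z0)%C with ((y - z) + (z - z0))%C by ring.
    eapply Rle_lt_trans; [apply Cmod_triangle|]. lra. }
  apply (Cder_lift Csin F W z (Ccos (W z)) (F1 z) (/ 2) (rho - Cmod (z - z0))); [lra|lra| | | | |].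
  - apply Cder_Csin.
  - apply Ccos_neq_0. now apply HW1.
  - now apply HF.
  - intros y Hy. now apply HW, Hnear.
  - intros y Hy. apply Csin_expand; [now apply HW1, Hnear|now apply HW1]. }
do 3 eexists. intros z Hz. split; [split; [now apply DW|]|].
- apply (Cder_div F1 (fun x => Ccos (W x)) z _ _ (proj2 (HF z Hz))
    (Cder_comp _ _ _ _ _ (Cder_Ccos (W z)) (DW z Hz))).
  apply Ccos_neq_0. now apply HW1.
- apply Rlt_trans with s; [now apply HW|easy].
Qed.

(** * The sine integral on the real line *)

Definition sine_coef (n : nat) : R := (-1) ^ n / (INR (fact (2 * n + 1)) * INR (2 * n + 1)).

(* The integral of [sin t / t] from [0] to [x]. *)
Definition SiR (x : R) : R := x * PSeries sine_coef (x ^ 2).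

(** The function [sin x / x], continued to 0 by its power series in [x^2]; [sin_n] are the
    coefficients through which the standard library defines [sin]. *)
Definition sincR (x : R) : R := PSeries sin_n (x ^ 2).

Lemma INR_odd_pos (n : nat) : 0 < INR (2 * n + 1).
Proof. apply lt_0_INR. lia. Qed.

Lemma sine_coef_sin_n (n : nat) : sine_coef n * INR (2 * n + 1) = sin_n n.
Proof. unfold sine_coef, sin_n. field. split; [apply INR_fact_neq_0|apply Rgt_not_eq, INR_odd_pos]. Qed.

Lemma sin_sincR (x : R) : sin x = x * sincR x.
Proof.
unfold sin, sincR. destruct (exist_sin (Rsqr x)) as [a Ha]. f_equal.
symmetry. apply is_pseries_unique, is_pseries_R.
unfold sin_in in Ha. apply is_series_Reals in Ha. rewrite <- Rsqr_pow2. exact Ha.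
Qed.

(** Coefficient ratios are dominated by those of the sine series, because the extra factor [2 n + 1]
    in the denominator increases. *)
Lemma CV_radius_sine_coef : CV_radius sine_coef = p_infty.
Proof.
assert (Hn0 : forall n, sine_coef n <> 0).
{ intros n E. apply (sin_no_R0 n). rewrite <- sine_coef_sin_n, E. ring. }
apply CV_radius_infinite_DAlembert; [easy|].
apply (is_lim_seq_le_le (fun _ => 0) _ (fun n => Rabs (sin_n (S n) / sin_n n))).
- intros n. split; [apply Rabs_pos|].
  rewrite <- !sine_coef_sin_n.
  replace (sine_coef (S n) * INR (2 * S n + 1) / (sine_coef n * INR (2 * n + 1))) with
    ((sine_coef (S n) / sine_coef n) * (INR (2 * S n + 1) / INR (2 * n + 1))).
  2:{ field. split; [apply Rgt_not_eq, INR_odd_pos|easy]. }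
  rewrite Rabs_mult. rewrite <- (Rmult_1_r (Rabs _)) at 1.
  apply Rmult_le_compat_l; [apply Rabs_pos|].
  pose proof (INR_odd_pos n).
  assert (INR (2 * n + 1) <= INR (2 * S n + 1)) by (apply le_INR; lia).
  rewrite Rabs_pos_eq by (apply Rdiv_le_0_compat; lra).
  apply (Rmult_le_reg_r (INR (2 * n + 1))); [easy|]. unfold Rdiv. rewrite Rmult_assoc, Rinv_l; lra.
- apply is_lim_seq_const.
- apply is_lim_seq_Reals, Alembert_sin.
Qed.

(** Differentiating [x * S (x^2)] gives [S (x^2) + 2 x^2 S' (x^2)], whose coefficients are
    [(2 n + 1) * sine_coef n = sin_n n]. *)
Lemma is_derive_SiR (x : R) : is_derive SiR x (sincR x).
Proof.
assert (Hcv : Rbar_lt (Rabs (x ^ 2)) (CV_radius sine_coef)) by (rewrite CV_radius_sine_coef; exact I).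
assert (D := is_derive_PSeries sine_coef (x ^ 2) Hcv).
unfold SiR. auto_derive; [eexists; exact D|].
replace (Derive (fun x0 => PSeries sine_coef x0) (x * (x * 1))) with (PSeries (PS_derive sine_coef) (x ^ 2)).
2:{ symmetry. apply is_derive_unique. exact D. }
replace (x * (x * 1)) with (x ^ 2) by ring.
unfold sincR.
rewrite (PSeries_ext sin_n (PS_plus sine_coef (PS_scal 2 (PS_incr_1 (PS_derive sine_coef))))).
- rewrite PSeries_plus, PSeries_scal, PSeries_incr_1; [simpl; ring| |].
  + now apply CV_radius_inside.
  + apply (ex_pseries_scal (K := R_AbsRing) (V := R_NormedModule)); [apply Rmult_comm|]. apply ex_pseries_incr_1. now apply ex_pseries_derive.
- intros [|n]; unfold PS_plus, PS_scal, PS_incr_1, PS_derive; rewrite <- sine_coef_sin_n.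
  + simpl INR. unfold plus, scal, zero; simpl; unfold mult; simpl. ring.
  + unfold plus, scal; simpl; unfold mult; simpl.
    change (sine_coef (S n) * INR (2 * S n + 1) = sine_coef (S n) + 2 * (INR (S n) * sine_coef (S n))).
    rewrite plus_INR, mult_INR. simpl (INR 2); simpl (INR 1). ring.
Qed.

Lemma SiR_0 : SiR 0 = 0.
Proof. unfold SiR. ring. Qed.

Lemma SiR_1 : SiR 1 = sine_sum.
Proof. unfold SiR. rewrite Rmult_1_l, pow1, PSeries_1. reflexivity. Qed.

Lemma SiR_increasing (x y : R) : 0 <= x -> x < y -> y <= 1 -> SiR x < SiR y.
Proof.
intros Hx Hxy Hy.
destruct (MVT_cor2 SiR sincR x y Hxy) as [c [Hc1 Hc2]].
{ intros c _. apply is_derive_Reals, is_derive_SiR. }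
assert (0 < sin c) by (apply sin_gt_0; pose proof PI2_1; lra).
rewrite sin_sincR in H. nra.
Qed.

Definition sine_abs_coef (n : nat) : R := / (INR (fact (2 * n + 1)) * INR (2 * n + 1)).

Lemma sine_sum_bounds : 0.94608306 <= sine_sum <= 0.94608308.
Proof.
assert (Hpos : forall n, 0 < INR (fact (2 * n + 1)) * INR (2 * n + 1)).
{ intros n. apply Rmult_lt_0_compat; [apply INR_fact_lt_0|apply INR_odd_pos]. }
assert (Heq : forall n, tg_alt sine_abs_coef n = sine_coef n) by reflexivity.
assert (Hex : ex_series sine_coef).
{ assert (H := CV_radius_inside sine_coef 1 ltac:(rewrite CV_radius_sine_coef; easy)).
  apply (ex_series_ext (fun n => scal (pow_n 1 n) (sine_coef n))); [|exact H].
  intros n. rewrite pow_n_pow, pow1. apply Rmult_1_l. }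
assert (Hcv : Un_cv (fun N => sum_f_R0 (tg_alt sine_abs_coef) N) sine_sum).
{ apply is_series_Reals. apply (is_series_ext sine_coef); [easy|]. now apply Series_correct. }
assert (Hdec : Un_decreasing sine_abs_coef).
{ intros n. unfold sine_abs_coef. apply Rinv_le_contravar; [apply Hpos|].
  apply Rmult_le_compat; try apply pos_INR; apply le_INR; [apply fact_le|]; lia. }
assert (H0 : Un_cv sine_abs_coef 0).
{ apply is_lim_seq_Reals. apply (is_lim_seq_ext (fun n => Rabs (sine_coef n))).
  - intros n. unfold sine_coef, sine_abs_coef, Rdiv. rewrite Rabs_mult, pow_1_abs, Rmult_1_l.
    apply Rabs_pos_eq, Rlt_le, Rinv_0_lt_compat, Hpos.
  - apply (is_lim_seq_abs_0 sine_coef). now apply ex_series_lim_0. }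
(* The sum lies between the partial sums ending at indices 5 and 4, which differ by
   [1 / (11! * 11)], less than 3e-9. *)
assert (H := alternated_series_ineq sine_abs_coef sine_sum 2 Hdec H0 Hcv).
assert (Hf : forall n, INR (fact (S n)) = INR (S n) * INR (fact n)) by (intros n; rewrite <- mult_INR; reflexivity).
assert (Hf0 : INR (fact 0) = 1) by reflexivity.
unfold sum_f_R0, tg_alt, sine_abs_coef in H. simpl (2 * 2)%nat in H. 
cbv [Nat.mul Nat.add] in H. rewrite !Hf, !Hf0 in H.
rewrite !INR_IZR_INZ in H. simpl IZR in H. simpl pow in H. lra.
Qed.

(** Since [5/3 = (1 + 1/4) / (1 - 1/4)], the odd series of [ln (1 + x) - ln (1 - x)] applies at 1/4.
    [P] is its part up to [x^11], and the remainder has derivative [2 x^12 / (1 - x^2)]. *)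
Lemma ln_5_3_bounds : 0.510825 <= ln (5 / 3) - 0.0000006 /\ ln (5 / 3) <= 0.5108257.
Proof.
set (P := fun x => 2 * (x + x ^ 3 / 3 + x ^ 5 / 5 + x ^ 7 / 7 + x ^ 9 / 9 + x ^ 11 / 11)).
destruct (MVT_cor2 (fun x => ln (1 + x) - ln (1 - x) - P x) (fun x => 2 * x ^ 12 / (1 - x ^ 2)) 0 (1 / 4)) as [c [Hc1 Hc2]]; [lra| |].
{ intros c Hc. apply is_derive_Reals. unfold P. auto_derive; [lra|]. field. nra. }
assert (E : ln (1 + 1 / 4) - ln (1 - 1 / 4) = ln (5 / 3)).
{ rewrite <- ln_div by lra. f_equal. field. }
rewrite E in Hc1. rewrite Rplus_0_r, Rminus_0_r, ln_1 in Hc1.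
assert (Hb : 0 <= 2 * c ^ 12 / (1 - c ^ 2) <= 2 * (1 / 4) ^ 12 / (15 / 16)).
{ assert (c ^ 2 <= 1 / 16) by nra.
  assert (0 <= c ^ 12 <= (1 / 4) ^ 12) by (split; [apply pow_le; lra|apply pow_incr; lra]).
  split; [apply Rdiv_le_0_compat; lra|].
  unfold Rdiv. apply Rmult_le_compat; try lra.
  - apply Rlt_le, Rinv_0_lt_compat. lra.
  - apply Rinv_le_contravar; lra. }
unfold P in Hc1. lra.
Qed.

Lemma beta_numerics :
  Rabs (beta_a - 1.41912) <= 0.000005 /\
  Rabs (beta_b - 1.85207) <= 0.000005 /\
  Rabs (beta_c - 2.36521) <= 0.000005.
Proof.
pose proof sine_sum_bounds as Hs. pose proof ln_5_3_bounds as Hl.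
unfold beta_a, beta_b, beta_c.
repeat split; apply Rabs_le; try lra.
set (L := ln (5 / 3)) in *.
assert (E : 1 / L * sine_sum * L = sine_sum) by (field; lra).
split; apply (Rmult_le_reg_r L); try lra.
Qed.

(** * The three implications *)

Lemma analytic_C_derive (f : C -> C) (z : C) : analytic_on_disk f -> in_disk z ->
  Cder f z (C_derive f z).
Proof. intros Hf Hz. apply C_derive_correct; [exact z|now apply Hf]. Qed.

(* [nu] is [1], [1 / x] or [1 / x^2] in the three cases of the theorem.  The equation exhibits [p']
   as a differentiable function off the origin, which makes [p] twice differentiable there. *)
Lemma schwarz_of_equation (p w nu nu1 nu2 : C -> C) (beta : R) : 0 < beta ->
  analytic_on_disk p -> analytic_on_disk w -> w 0 = 0 ->
  (forall z, in_disk z -> Cmod (w z) < 1) ->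
  (forall z, in_disk z -> Cder2 nu nu1 nu2 (p z) /\ nu (p z) <> 0) ->
  (forall z, in_disk z -> Csin (w z) = (beta * (z * nu (p z)) * C_derive p z)%C) ->
  forall z, in_disk z -> Cmod (w z) <= Cmod z.
Proof.
intros Hb Hp Hw Hw0 Hw1 Hnu Heq.
apply schwarz; try easy. intros z0 Hz0.
set (r := Rmin (Cmod z0) (1 - Cmod z0)).
assert (Hr : 0 < r) by (apply Rmin_glb_lt; lra).
assert (Hb0 : RtoC beta <> 0) by (intros E; injection E; lra).
assert (Hball : forall z, Cmod (z - z0) < r -> in_disk z /\ z <> 0).
{ intros z Hz. pose proof (Rmin_l (Cmod z0) (1 - Cmod z0)). pose proof (Rmin_r (Cmod z0) (1 - Cmod z0)).
  fold r in H, H0. split.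
  - unfold in_disk. replace z with (z0 + (z - z0))%C by ring.
    eapply Rle_lt_trans; [apply Cmod_triangle|]. lra.
  - intros E. rewrite E in Hz. replace (0 - z0)%C with (- z0)%C in Hz by ring.
    rewrite Cmod_opp in Hz. lra. }
set (p1 := C_derive p).
assert (Dp : forall z, in_disk z -> Cder p z (p1 z)) by (intros; now apply analytic_C_derive).
pose (E := fun z => (Csin (w z) / (beta * (z * nu (p z))))%C).
assert (HE : forall z, Cmod (z - z0) < r -> E z = p1 z).
{ intros z Hz. destruct (Hball z Hz) as [Hd Hz']. unfold E. rewrite (Heq z Hd). fold p1.
  field. repeat split; try easy. now apply Hnu. }
pose (v1 := fun z => (p1 z * nu1 (p z))%C).
assert (Dv : forall z, in_disk z -> Cder (fun x => nu (p x)) z (v1 z)).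
{ intros z Hz. apply (Cder_comp nu p z _ _ (proj1 (proj1 (Hnu z Hz))) (Dp z Hz)). }
assert (Dw : forall z, in_disk z -> Cder w z (C_derive w z)) by (intros; now apply analytic_C_derive).
pose (den := fun z => (beta * (z * nu (p z)))%C).
pose (den1 := fun z => (beta * (1 * nu (p z) + z * v1 z))%C).
assert (Dden : forall z, in_disk z -> Cder den z (den1 z)).
{ intros z Hz.
  refine (Cder_eq _ _ _ _ _ (Cder_mult _ _ _ _ _ (Cder_const beta z)
    (Cder_mult _ _ _ _ _ (Cder_id z) (Dv z Hz)))). unfold den1. ring. }
pose (p2 := fun z => ((C_derive w z * Ccos (w z) * den z - Csin (w z) * den1 z) / (den z * den z))%C).
assert (D2p : forall z, Cmod (z - z0) < r -> Cder2 p p1 p2 z).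
{ intros z Hz. destruct (Hball z Hz) as [Hd Hz']. split; [now apply Dp|].
  apply (Cder_ext_near E p1 z _ (r - Cmod (z - z0))); [lra| |].
  - intros y Hy. apply HE. replace (y - z0)%C with ((y - z) + (z - z0))%C by ring.
    eapply Rle_lt_trans; [apply Cmod_triangle|]. lra.
  - apply (Cder_div (fun x => Csin (w x)) den z).
    + apply (Cder_comp Csin w z _ _ (Cder_Csin (w z)) (Dw z Hd)).
    + now apply Dden.
    + unfold den. repeat apply Cmult_neq_0; try easy. now apply Hnu. }
pose (v2 := fun z => (p2 z * nu1 (p z) + p1 z * (p1 z * nu2 (p z)))%C).
assert (D2v : forall z, Cmod (z - z0) < r -> Cder2 (fun x => nu (p x)) v1 v2 z).
{ intros z Hz. destruct (Hball z Hz) as [Hd _]. split; [now apply Dv|].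
  apply (Cder_mult p1 (fun x => nu1 (p x))).
  - now apply D2p.
  - apply (Cder_comp nu1 p z _ _ (proj2 (proj1 (Hnu z Hd))) (Dp z Hd)). }
assert (D2den : exists d1 d2, forall z, Cmod (z - z0) < r -> Cder2 den d1 d2 z).
{ do 2 eexists. intros z Hz.
  assert (Cb : Cder2 (fun _ => RtoC beta) (fun _ => RtoC 0) (fun _ => RtoC 0) z) by (split; apply Cder_const).
  assert (Ci : Cder2 (fun x => x) (fun _ => RtoC 1) (fun _ => RtoC 0) z) by (split; [apply Cder_id|apply Cder_const]).
  exact (Cder2_mult _ _ _ _ _ _ z Cb (Cder2_mult _ _ _ _ _ _ z Ci (D2v z Hz))). }
destruct D2den as [d1 [d2 D2den]].
apply (smoothable_arcsin p p1 p2 den d1 d2 w z0 (C_derive w z0) r Hr).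
- intros z Hz. destruct (Hball z Hz) as [Hd _].
  split; [now apply D2p|]. split; [exact (D2den z Hz)|]. split; [now apply Hw1|].
  rewrite (Heq z Hd). reflexivity.
- apply Dw. unfold in_disk. lra.
Qed.

(* At a maximum point [z0] of [V - SiR |z| - e |z|] the angular derivative vanishes, so that
   [sin (w z0)] is real, while the radial derivative makes it exceed [sin |z0|]. *)
Lemma radial_growth_bound (V : C -> R) (w : C -> C) :
  (forall z, in_disk z -> continuous V z) -> V 0 = 0 ->
  (forall z, in_disk z -> Cmod (w z) <= Cmod z) ->
  (forall x y, in_disk (x, y) ->
     is_derive (fun t => V (0 + t * x, 0 + t * y)) 1 (Re (Csin (w (x, y)))) /\
     is_derive (fun t => V (x * cos t - y * sin t, x * sin t + y * cos t)) 0 (- Im (Csin (w (x, y))))) ->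
  forall z, in_disk z -> V z <= SiR (Cmod z).
Proof.
intros Hc HV0 Hw Hd z Hz.
destruct (Rle_lt_dec (V z) (SiR (Cmod z))) as [|Hlt]; [easy|exfalso].
unfold in_disk in *.
(* With half the excess, [Phi z = 2 e - e |z|] remains positive, while [Phi 0 = 0]; hence the
   maximum point is not the origin. *)
pose (e := (V z - SiR (Cmod z)) / 2). assert (He : 0 < e) by (unfold e; lra).
pose (Phi := fun x => V x - SiR (Cmod x) - e * Cmod x).
assert (Hid : forall x : C, (x - 0)%C = x) by (intros; ring).
destruct (disk_max Phi 0 (Cmod z)) as [z0 [Hz0 Hmax]]; [apply Cmod_ge_0| |].
{ intros x Hx. rewrite Hid in Hx.
  assert (Cx : continuous Cmod x).
  { apply (continuous_ext (fun x => Cmod (x - 0))); [intros; f_equal; apply Hid|apply continuous_Cmod_id]. }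
  apply (continuous_minus (K := R_AbsRing) (V := R_NormedModule) (fun x => V x - SiR (Cmod x))).
  - apply (continuous_minus (K := R_AbsRing) (V := R_NormedModule) V); [apply Hc; lra|].
    apply (continuous_comp Cmod SiR); [exact Cx|].
    apply (ex_derive_continuous (K := R_AbsRing) (V := R_NormedModule)). eexists. apply is_derive_SiR.
  - now apply (continuous_scal_r (K := R_AbsRing) (V := R_NormedModule) e Cmod). }
rewrite Hid in Hz0.
assert (Hmax' : forall x, Cmod x <= Cmod z -> Phi x <= Phi z0) by (intros x Hx; apply Hmax; now rewrite Hid).
clear Hmax.
assert (Hpos : 0 < Phi z0).
{ apply Rlt_le_trans with (2 := Hmax' z (Rle_refl _)). unfold Phi.
  pose proof (Cmod_ge_0 z). assert (e * Cmod z < e) by nra. unfold e in *. lra. }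
set (a := Cmod z0) in *.
assert (Ha : 0 < a).
{ apply Cmod_gt_0. intros E. rewrite E in Hpos. unfold Phi in Hpos. rewrite Cmod_0, HV0, SiR_0 in Hpos. lra. }
assert (Ha2 : a * a = Cmod z0 ^ 2) by (unfold a; ring).
rewrite Cmod2_alt in Ha2.
destruct z0 as [x y]. simpl Re in Ha2. simpl Im in Ha2.
destruct (Hd x y ltac:(fold a; lra)) as [Drad Dang].
assert (Him : Im (Csin (w (x, y))) = 0).
{ assert (H := derive_max_zero _ _ _ 1 Dang Rlt_0_1).
  assert (H' : - Im (Csin (w (x, y))) = 0); [|lra]. apply H. intros t _.
  rewrite cos_0, sin_0.
  replace (x * 1 - y * 0, x * 0 + y * 1) with (x, y) by (apply injective_projections; simpl; ring).
  set (c := (x * cos t - y * sin t, x * sin t + y * cos t) : C).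
  assert (Hcm : Cmod c = a).
  { assert (H2 := Cmod2_alt c). simpl Re in H2; simpl Im in H2.
    pose proof (sin2_cos2 t) as T. unfold Rsqr in T. pose proof (Cmod_ge_0 c).
    assert (Cmod c ^ 2 = a * a).
    { rewrite H2, Ha2. replace (x ^ 2 + y ^ 2) with ((x ^ 2 + y ^ 2) * 1) by ring. rewrite <- T. ring. }
    nra. }
  assert (M := Hmax' c ltac:(lra)). unfold Phi in M. fold a in M. rewrite Hcm in M. lra. }
(* The maximum point may lie on the rim [|x| = |z|], so radially it is compared with smaller radii
   only. *)
assert (Hre : 0 <= Re (Csin (w (x, y))) - (sin a + e * a)).
{ apply (derive_left_max (fun t => V (0 + t * x, 0 + t * y) - (SiR (0 + t * a) + e * (0 + t * a))) 1 _ 1); [|lra|].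
  - apply (is_derive_minus (K := R_AbsRing) (V := R_NormedModule) (fun t => V (0 + t * x, 0 + t * y))); [exact Drad|].
    apply (is_derive_plus (K := R_AbsRing) (V := R_NormedModule) (fun t => SiR (0 + t * a)) (fun t => e * (0 + t * a))).
    + rewrite sin_sincR.
      replace (sincR a) with (sincR (0 + 1 * a)) by (f_equal; ring).
      apply (is_derive_comp (K := R_AbsRing) (V := R_NormedModule) SiR (fun t => 0 + t * a)).
      * apply is_derive_SiR.
      * apply is_derive_affine.
    + auto_derive; trivial; ring.
  - intros t Ht. 
    replace (0 + 1 * x, 0 + 1 * y) with (x, y) by (apply injective_projections; simpl; ring).
    set (c := (0 + t * x, 0 + t * y) : C).
    assert (Hcm : Cmod c = 0 + t * a).
    { replace c with (RtoC t * (x, y))%C by (unfold c; apply injective_projections; simpl; ring).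
      rewrite Cmod_mult, Cmod_R, Rabs_pos_eq by lra. unfold a. ring. }
    assert (M := Hmax' c ltac:(rewrite Hcm; nra)). unfold Phi in M. fold a in M. rewrite Hcm in M.
    replace (0 + 1 * a) with a by ring. lra. }
assert (Hsin := Csin_real (w (x, y)) a (Hw (x, y) ltac:(fold a; lra)) ltac:(lra) Him).
nra.
Qed.

Lemma Csin_opp (z : C) : Csin (- z) = (- Csin z)%C.
Proof.
unfold Csin. replace (- (Ci * - z))%C with (Ci * z)%C by ring.
replace (Ci * - z)%C with (- (Ci * z))%C by ring.
field. apply Ci_neq_0.
Qed.

(** Since the sine is odd, [- V] satisfies the same equations with [- w] in place of [w]. *)
Lemma radial_growth_bound_abs (V : C -> R) (w : C -> C) :
  (forall z, in_disk z -> continuous V z) -> V 0 = 0 ->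
  (forall z, in_disk z -> Cmod (w z) <= Cmod z) ->
  (forall x y, in_disk (x, y) ->
     is_derive (fun t => V (0 + t * x, 0 + t * y)) 1 (Re (Csin (w (x, y)))) /\
     is_derive (fun t => V (x * cos t - y * sin t, x * sin t + y * cos t)) 0 (- Im (Csin (w (x, y))))) ->
  forall z, in_disk z -> Rabs (V z) <= SiR (Cmod z).
Proof.
intros Hc HV0 Hw Hd z Hz. apply Rabs_le.
assert (H1 := radial_growth_bound V w Hc HV0 Hw Hd z Hz).
assert (H2 := radial_growth_bound (fun x => - V x) (fun x => - w x)%C).
assert (H3 : - V z <= SiR (Cmod z)); [|lra]. apply H2; try easy.
- intros x Hx. apply (continuous_opp V). now apply Hc.
- rewrite HV0. ring.
- intros x Hx. rewrite Cmod_opp. now apply Hw.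
- intros x y Hxy. destruct (Hd x y Hxy) as [D1 D2]. rewrite Csin_opp. split.
  + apply (is_derive_opp (K := R_AbsRing) (V := R_NormedModule)) in D1. exact D1.
  + apply (is_derive_opp (K := R_AbsRing) (V := R_NormedModule)) in D2. exact D2.
Qed.

Lemma Cder_radial (f : C -> C) (x y t : R) (l : C) : Cder f (0 + t * x, 0 + t * y) l ->
  is_derive (fun s => Re (f (0 + s * x, 0 + s * y))) t (Re (Cmult (x, y) l)) /\
  is_derive (fun s => Im (f (0 + s * x, 0 + s * y))) t (Im (Cmult (x, y) l)).
Proof.
intros H. rewrite Cmult_comm.
exact (Cder_path f _ l (fun s => 0 + s * x) (fun s => 0 + s * y) t x y H
  (is_derive_affine _ _ _) (is_derive_affine _ _ _) eq_refl).
Qed.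

(** The velocity of the rotation at [(x, y)] is [(- y, x)], that is i times the point; this factor
    exchanges real and imaginary parts up to sign. *)
Lemma Cder_angular (f : C -> C) (x y : R) (l : C) : Cder f (x, y) l ->
  is_derive (fun t => Re (f (x * cos t - y * sin t, x * sin t + y * cos t))) 0 (- Im (Cmult (x, y) l)) /\
  is_derive (fun t => Im (f (x * cos t - y * sin t, x * sin t + y * cos t))) 0 (Re (Cmult (x, y) l)).
Proof.
intros H.
destruct (Cder_path f (x, y) l (fun t => x * cos t - y * sin t) (fun t => x * sin t + y * cos t) 0 (- y) x H) as [D1 D2].
- auto_derive; trivial. rewrite sin_0, cos_0; ring.
- auto_derive; trivial. rewrite sin_0, cos_0; ring.
- rewrite sin_0, cos_0. apply injective_projections; simpl; ring.
- replace (Re (l * (- y, x))) with (- Im (Cmult (x, y) l)) in D1 by (simpl; ring).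
  replace (Im (l * (- y, x))) with (Re (Cmult (x, y) l)) in D2 by (simpl; ring).
  now split.
Qed.

Lemma RtoC_neq_0 (x : R) : x <> 0 -> RtoC x <> 0.
Proof. intros H E. apply H. now injection E. Qed.

Lemma is_derive_scale (f : R -> R) (k t l : R) : is_derive f t l -> is_derive (fun s => k * f s) t (k * l).
Proof. intros H. now apply is_derive_scal. Qed.

(** At the point [t (x, y)] the equation carries a factor [t], and Schwarz's lemma gives [|w| <= t]
    there. The two cancel, so the bound is uniform down to the origin. *)
Lemma ray_derivative_bound (w g : C -> C) (beta x y t : R) : 0 < beta -> 0 < t < 1 ->
  in_disk (x, y) ->
  (forall z, in_disk z -> Cmod (w z) <= Cmod z) ->
  (forall z, in_disk z -> Csin (w z) = (beta * (z * g z))%C) ->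
  Rabs (Im (Cmult (x, y) (g (0 + t * x, 0 + t * y)))) <= 1.182 / beta.
Proof.
intros Hb Ht Hz Hw Heq. unfold in_disk in *.
set (z := (0 + t * x, 0 + t * y) : C).
assert (Ez : z = (RtoC t * (x, y))%C) by (unfold z; apply injective_projections; simpl; ring).
assert (Hzm : Cmod z = t * Cmod (x, y)) by (rewrite Ez, Cmod_mult, Cmod_R, Rabs_pos_eq by lra; easy).
pose proof (Cmod_ge_0 (x, y)).
assert (Hz1 : Cmod z < 1) by (rewrite Hzm; nra).
assert (B := Im_Csin_le (w z)). specialize (Hw z Hz1). rewrite (Heq z Hz1) in B.
replace (Im (beta * (z * g z))) with (beta * t * Im (Cmult (x, y) (g z))) in B
  by (rewrite Ez; unfold Im; simpl; ring).
specialize (B ltac:(lra)).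
assert (0 < beta * t) by nra.
rewrite Rabs_mult, (Rabs_pos_eq (beta * t)) in B by lra.
apply (Rmult_le_reg_l (beta * t)); [easy|].
replace (beta * t * (1.182 / beta)) with (1.182 * t) by (field; lra). nra.
Qed.

(** Serves [U = p - 1] and [U = 1 - 1 / p], and later [Si] itself. The real part falls under the
    radial growth bound; the imaginary part is integrated along the ray from 0. *)
Lemma primitive_bounds (U U1 w : C -> C) (beta : R) : 0 < beta ->
  (forall z, in_disk z -> Cder U z (U1 z)) -> U 0 = 0 ->
  (forall z, in_disk z -> Cmod (w z) <= Cmod z) ->
  (forall z, in_disk z -> Csin (w z) = (beta * (z * U1 z))%C) ->
  forall z, in_disk z -> beta * Rabs (Re (U z)) <= SiR (Cmod z) /\ Rabs (Im (U z)) <= 1.182 / beta.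
Proof.
intros Hb HU HU0 Hw Heq z Hz.
split.
- replace (beta * Rabs (Re (U z))) with (Rabs (beta * Re (U z)))
    by (rewrite Rabs_mult, (Rabs_pos_eq beta) by lra; easy).
  apply (radial_growth_bound_abs (fun x => beta * Re (U x)) w); try easy.
  + intros x Hx. apply (continuous_scal_r (K := R_AbsRing) (V := R_NormedModule) beta (fun x => Re (U x))).
    apply continuous_eps. intros eps He. destruct (Cder_cont _ _ _ (HU x Hx) eps He) as [d [Hd K]].
    exists d. split; [easy|]. intros y Hy. eapply Rle_lt_trans; [|exact (K y Hy)].
    apply (re_le_Cmod (U y - U x)).
  + rewrite HU0. simpl. ring.
  + intros x y Hxy. rewrite (Heq _ Hxy).
    replace (Re (beta * ((x, y) * U1 (x, y)))) with (beta * Re (Cmult (x, y) (U1 (x, y)))) by (simpl; ring).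
    replace (- Im (beta * ((x, y) * U1 (x, y)))) with (beta * - Im (Cmult (x, y) (U1 (x, y)))) by (simpl; ring).
    split; apply is_derive_scale.
    * apply Cder_radial. replace (0 + 1 * x, 0 + 1 * y) with (x, y) by (apply injective_projections; simpl; ring).
      now apply HU.
    * now apply Cder_angular, HU.
- destruct z as [x y].
  destruct (MVT_cor2 (fun t => Im (U (0 + t * x, 0 + t * y)))
    (fun t => Im (Cmult (x, y) (U1 (0 + t * x, 0 + t * y)))) 0 1 Rlt_0_1) as [c [Hc1 Hc2]].
  { intros t Ht. apply is_derive_Reals. apply Cder_radial, HU. unfold in_disk in *.
    replace (0 + t * x, 0 + t * y) with (RtoC t * (x, y))%C by (apply injective_projections; simpl; ring).
    rewrite Cmod_mult, Cmod_R, Rabs_pos_eq by lra. pose proof (Cmod_ge_0 (x, y)). nra. }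
  replace (0 + 1 * x, 0 + 1 * y) with (x, y) in Hc1 by (apply injective_projections; simpl; ring).
  replace (0 + 0 * x, 0 + 0 * y) with (RtoC 0) in Hc1 by (apply injective_projections; simpl; ring).
  rewrite HU0 in Hc1. simpl (Im 0) in Hc1.
  replace (Im (U (x, y))) with (Im (Cmult (x, y) (U1 (0 + c * x, 0 + c * y)))) by lra.
  now apply (ray_derivative_bound w U1).
Qed.

Lemma is_derive_ln_norm (A B : R -> R) (t a b : R) : is_derive A t a -> is_derive B t b ->
  0 < A t ^ 2 + B t ^ 2 ->
  is_derive (fun s => ln (sqrt (A s ^ 2 + B s ^ 2))) t ((A t * a + B t * b) / (A t ^ 2 + B t ^ 2)).
Proof.
intros HA HB Hp.
assert (Hs : 0 < sqrt (A t ^ 2 + B t ^ 2)) by now apply sqrt_lt_R0.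
assert (E := sqrt_sqrt _ (Rlt_le _ _ Hp)).
auto_derive.
- replace (A t * (A t * 1) + B t * (B t * 1)) with (A t ^ 2 + B t ^ 2) by ring.
  repeat split; trivial; eexists; eassumption.
- replace (Derive (fun x => A x) t) with a by (symmetry; apply is_derive_unique, HA).
  replace (Derive (fun x => B x) t) with b by (symmetry; apply is_derive_unique, HB).
  replace (A t * (A t * 1) + B t * (B t * 1)) with (A t ^ 2 + B t ^ 2) by ring.
  rewrite <- E at 3.
  set (s := sqrt (A t ^ 2 + B t ^ 2)) in *. field. lra.
Qed.

(** [q] is the angular velocity of [(A, B)] about the origin: the normalized vector turns by
    [(nx, ny)' = q * (- ny, nx)], the derivative of an argument that is never chosen. *)
Lemma is_derive_unit_vector (A B : R -> R) (t a b : R) : is_derive A t a -> is_derive B t b ->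
  0 < A t ^ 2 + B t ^ 2 ->
  let n := sqrt (A t ^ 2 + B t ^ 2) in
  let q := (A t * b - B t * a) / (A t ^ 2 + B t ^ 2) in
  is_derive (fun s => A s / sqrt (A s ^ 2 + B s ^ 2)) t (- (B t / n) * q) /\
  is_derive (fun s => B s / sqrt (A s ^ 2 + B s ^ 2)) t (A t / n * q).
Proof.
intros HA HB Hp n q.
assert (Hs : 0 < n) by now apply sqrt_lt_R0.
assert (E := sqrt_sqrt _ (Rlt_le _ _ Hp)). fold n in E.
assert (EA : Derive (fun x => A x) t = a) by (apply is_derive_unique, HA).
assert (EB : Derive (fun x => B x) t = b) by (apply is_derive_unique, HB).
assert (EP : A t * (A t * 1) + B t * (B t * 1) = A t ^ 2 + B t ^ 2) by ring.
assert (E' : A t ^ 2 = n * n - B t ^ 2) by lra.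
split; auto_derive; rewrite ?EP; fold n.
- repeat split; trivial; try (eexists; eassumption). apply Rgt_not_eq, Hs.
- rewrite EA, EB. unfold q. rewrite <- E. field_simplify; [|lra|lra]. 
  rewrite E'. field. lra.
- repeat split; trivial; try (eexists; eassumption). apply Rgt_not_eq, Hs.
- rewrite EA, EB. unfold q. rewrite <- E. 
  assert (E'' : B t ^ 2 = n * n - A t ^ 2) by lra.
  field_simplify; [|lra|lra]. rewrite E''. field. lra.
Qed.

Lemma SiR_lt_sine_sum (z : C) : in_disk z -> SiR (Cmod z) < sine_sum.
Proof.
intros Hz. rewrite <- SiR_1. apply SiR_increasing; [apply Cmod_ge_0|exact Hz|lra].
Qed.

Lemma Cplus_1_inj (x y : C) : (1 + x = 1 + y)%C -> x = y.
Proof. intros E. replace x with (1 + x - 1)%C by ring. rewrite E. ring. Qed.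

Lemma implication_a : implication_from subord_a beta_a.
Proof.
intros p beta Hp Hp0 Hb [_ [_ [w [Hw [Hw0 [Hw1 Heq]]]]]].
pose proof sine_sum_bounds as Hs. unfold beta_a in Hb.
assert (Hb0 : 0 < beta) by lra.
assert (Heq1 : forall z, in_disk z -> Csin (w z) = (beta * (z * C_derive p z))%C).
{ intros z Hz. apply Cplus_1_inj. symmetry. exact (Heq z Hz). }
assert (Hsch : forall z, in_disk z -> Cmod (w z) <= Cmod z).
{ apply (schwarz_of_equation p w (fun _ => RtoC 1) (fun _ => RtoC 0) (fun _ => RtoC 0) beta); try easy.
  - intros z _. split; [split; apply Cder_const|]. apply RtoC_neq_0. lra.
  - intros z Hz. rewrite (Heq1 z Hz). ring. }
apply subordinate_phi_Ne; [easy|easy|]. intros z Hz.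
destruct (primitive_bounds (fun x => p x - 1)%C (C_derive p) w beta Hb0) with (z := z) as [B1 B2]; try easy.
{ intros x Hx. refine (Cder_eq _ _ _ _ _ (Cder_minus _ _ _ _ _ (analytic_C_derive p x Hp Hx) (Cder_const 1 x))). ring. }
{ rewrite Hp0. ring. }
pose proof (SiR_lt_sine_sum z Hz).
replace (Re (p z - 1)) with (Re (p z) - 1) in B1 by (unfold Re; simpl; ring).
replace (Im (p z - 1)) with (Im (p z)) in B2 by (unfold Im; simpl; ring).
split.
- nra.
(* [1.182 / 1.41912] is about 0.833, far below 1.065. *)
- apply Rle_lt_trans with (1 := B2). apply (Rmult_lt_reg_r beta); [easy|].
  unfold Rdiv. rewrite Rmult_assoc, Rinv_l by lra. lra.
Qed.

Lemma implication_c : implication_from subord_c beta_c.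
Proof.
intros p beta Hp Hp0 Hb [Hpz [_ [_ [w [Hw [Hw0 [Hw1 Heq]]]]]]].
pose proof sine_sum_bounds as Hs. unfold beta_c in Hb.
assert (Hb0 : 0 < beta) by lra.
assert (Heq1 : forall z, in_disk z -> Csin (w z) = (beta * (z * (C_derive p z / (p z * p z))))%C).
{ intros z Hz. apply Cplus_1_inj. symmetry. etransitivity; [|exact (Heq z Hz)]. simpl. field. now apply Hpz. }
assert (Hsch : forall z, in_disk z -> Cmod (w z) <= Cmod z).
{ apply (schwarz_of_equation p w (fun x => / x * / x)%C
    (fun x => (- / (x * x)) * / x + / x * (- / (x * x)))%C
    (fun x => (2 / (x * x * x) * / x + (- / (x * x)) * (- / (x * x))) + ((- / (x * x)) * (- / (x * x)) + / x * (2 / (x * x * x))))%C beta); try easy.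
  - intros z Hz. specialize (Hpz z Hz). split.
    + exact (Cder2_mult _ _ _ _ _ _ _ (Cder_inv_id2 _ Hpz) (Cder_inv_id2 _ Hpz)).
    + intros E. assert (E1 : (p z * p z * (/ p z * / p z))%C = 1) by (field; easy).
      rewrite E in E1. rewrite Cmult_0_r in E1. symmetry in E1. now apply RtoC_neq_0 in E1; [|lra].
  - intros z Hz. rewrite (Heq1 z Hz). field. now apply Hpz. }
apply subordinate_phi_Ne; [easy|easy|]. intros z Hz.
destruct (primitive_bounds (fun x => 1 - / p x)%C (fun x => C_derive p x / (p x * p x))%C w beta Hb0) with (z := z) as [B1 B2]; try easy.
{ intros x Hx.
  refine (Cder_eq _ _ _ _ _ (Cder_minus _ _ _ _ _ (Cder_const 1 x)
    (Cder_inv _ _ _ (analytic_C_derive p x Hp Hx) (Hpz x Hx)))). field. now apply Hpz. }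
{ rewrite Hp0. field. }
pose proof (SiR_lt_sine_sum z Hz).
specialize (Hpz z Hz).
pose (v := (/ p z)%C).
assert (Hv : p z = (/ v)%C) by (unfold v; field; easy).
assert (Hv0 : v <> 0).
{ intros E. assert (E1 : (v * p z)%C = 1) by (unfold v; field; easy).
  rewrite E, Cmult_0_l in E1. symmetry in E1. now apply RtoC_neq_0 in E1; [|lra]. }
fold v in B1, B2. rewrite Hv. destruct v as [a b].
replace (Re (1 - (a, b))) with (1 - a) in B1 by (simpl; ring).
replace (Im (1 - (a, b))) with (- b) in B2 by (simpl; ring).
rewrite Rabs_Ropp in B2.
(* So [1 / p = a + i b] has [3/5 < a < 7/5] and, since [1.182 / 2.3652 < 1/2], [|b| <= 1/2]. The
   rest estimates [p = (a - i b) / (a^2 + b^2)]; the sharp end is [a / D <= 1 / a < 5/3]. *)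
assert (Ha : Rabs (1 - a) < 2 / 5) by nra.
assert (Hbb : Rabs b <= 1 / 2).
{ apply Rle_trans with (1 := B2). apply (Rmult_le_reg_r beta); [easy|].
  unfold Rdiv. rewrite Rmult_assoc, Rinv_l by lra. lra. }
apply Rabs_def2 in Ha. apply Rabs_le_between in Hbb.
set (D := a ^ 2 + b ^ 2). assert (HD : 0.36 < D) by (unfold D; nra).
assert (Er : Re (/ (a, b)) = a / D) by reflexivity.
assert (Ei : Im (/ (a, b)) = - b / D) by reflexivity.
rewrite Er, Ei.
assert (Hdiv : forall u c, u < c * D -> u / D < c).
{ intros u c Hu. apply (Rmult_lt_reg_r D); [lra|]. unfold Rdiv. rewrite Rmult_assoc, Rinv_l by lra. lra. }
split; apply Rabs_def1.
- assert (a / D < 5 / 3); [|lra]. apply Hdiv. unfold D. nra.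
- assert ((- a) / D < - (1 / 3)); [|unfold Rdiv in *; lra]. apply Hdiv. unfold D. nra.
- apply Hdiv. unfold D. nra.
- assert (b / D < 1.065); [|unfold Rdiv in *; lra]. apply Hdiv. unfold D. nra.
Qed.

(* Following the unit vector [p / |p|] along a ray avoids the choice of a branch of [log p]. *)
Lemma log_bounds (p w : C -> C) (beta : R) : 0 < beta ->
  analytic_on_disk p -> p 0 = 1 -> (forall z, in_disk z -> p z <> 0) ->
  (forall z, in_disk z -> Cmod (w z) <= Cmod z) ->
  (forall z, in_disk z -> Csin (w z) = (beta * (z * (C_derive p z / p z)))%C) ->
  forall z, in_disk z -> beta * Rabs (ln (Cmod (p z))) <= SiR (Cmod z) /\
    Rabs (Im (p z) / Cmod (p z)) <= 1.182 / beta /\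
    1 - (1.182 / beta) ^ 2 <= Re (p z) / Cmod (p z).
Proof.
intros Hb Hp Hp0 Hpz Hw Heq.
assert (Dp : forall z, in_disk z -> Cder p z (C_derive p z)) by (intros; now apply analytic_C_derive).
assert (Hpos : forall z, in_disk z -> 0 < Re (p z) ^ 2 + Im (p z) ^ 2).
{ intros z Hz. rewrite <- Cmod2_alt. apply pow_lt, Cmod_gt_0, Hpz, Hz. }
assert (Hn : forall z, Cmod z = sqrt (Re z ^ 2 + Im z ^ 2)) by reflexivity.
assert (Hq : forall z v, in_disk z ->
  Re (Cmult v (C_derive p z / p z)) =
    (Re (p z) * Re (Cmult v (C_derive p z)) + Im (p z) * Im (Cmult v (C_derive p z))) / (Re (p z) ^ 2 + Im (p z) ^ 2) /\
  Im (Cmult v (C_derive p z / p z)) =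
    (Re (p z) * Im (Cmult v (C_derive p z)) - Im (p z) * Re (Cmult v (C_derive p z))) / (Re (p z) ^ 2 + Im (p z) ^ 2)).
{ intros z v Hz. specialize (Hpos z Hz). destruct (p z) as [A B]. destruct (C_derive p z) as [a b].
  destruct v as [x y]. simpl in Hpos. simpl. split; field; simpl; lra. }
assert (Hline : forall x y t, in_disk (x, y) -> 0 <= t <= 1 -> in_disk (0 + t * x, 0 + t * y)).
{ intros x y t Hz Ht. unfold in_disk in *.
  replace (0 + t * x, 0 + t * y) with (RtoC t * (x, y))%C by (apply injective_projections; simpl; ring).
  rewrite Cmod_mult, Cmod_R, Rabs_pos_eq by lra. pose proof (Cmod_ge_0 (x, y)). nra. }
intros z Hz. split.
- replace (beta * Rabs (ln (Cmod (p z)))) with (Rabs (beta * ln (Cmod (p z))))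
    by (rewrite Rabs_mult, (Rabs_pos_eq beta) by lra; easy).
  apply (radial_growth_bound_abs (fun x => beta * ln (Cmod (p x))) w); try easy.
  + intros x Hx. apply (continuous_scal_r (K := R_AbsRing) (V := R_NormedModule) beta (fun x => ln (Cmod (p x)))).
    apply (continuous_comp (fun x => Cmod (p x)) ln).
    * exact (continuous_Cmod_Cder _ _ _ (Dp x Hx)).
    * apply (ex_derive_continuous (K := R_AbsRing) (V := R_NormedModule)).
      exists (/ Cmod (p x)). apply is_derive_Reals, derivable_pt_lim_ln, Cmod_gt_0, Hpz, Hx.
  + rewrite Hp0, Cmod_1, ln_1. ring.
  + intros x y Hxy. rewrite (Heq _ Hxy).
    destruct (Hq (x, y) (x, y) Hxy) as [Q1 Q2].
    replace (Re (beta * ((x, y) * (C_derive p (x, y) / p (x, y))))) with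
       (beta * Re (Cmult (x, y) (C_derive p (x, y) / p (x, y)))) by (simpl; ring).
    replace (- Im (beta * ((x, y) * (C_derive p (x, y) / p (x, y))))) with
       (beta * - Im (Cmult (x, y) (C_derive p (x, y) / p (x, y)))) by (simpl; ring).
    split; apply is_derive_scale.
    * rewrite Q1.
      assert (E : (0 + 1 * x, 0 + 1 * y) = (x, y)) by (apply injective_projections; simpl; ring).
      destruct (Cder_radial p x y 1 (C_derive p (x, y))) as [D1 D2]; [rewrite E; now apply Dp|].
      assert (D := is_derive_ln_norm _ _ _ _ _ D1 D2). cbv beta in D. rewrite E in D. exact (D (Hpos _ Hxy)).
    * rewrite Q2.
      assert (E : (x * cos 0 - y * sin 0, x * sin 0 + y * cos 0) = (x, y))
        by (rewrite sin_0, cos_0; apply injective_projections; simpl; ring).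
      destruct (Cder_angular p x y (C_derive p (x, y))) as [D1 D2]; [now apply Dp|].
      assert (D := is_derive_ln_norm _ _ _ _ _ D1 D2). cbv beta in D. rewrite E in D. specialize (D (Hpos _ Hxy)).
      match type of D with is_derive _ _ ?u => match goal with |- is_derive _ _ ?v => replace v with u end end.
      { exact D. }
      field. apply Rgt_not_eq, (Hpos _ Hxy).
- destruct z as [x y].
  set (K := 1.182 / beta).
  pose (L := fun t => (0 + t * x, 0 + t * y) : C).
  assert (HL1 : L 1 = (x, y)) by (unfold L; apply injective_projections; simpl; ring).
  assert (HL0 : L 0 = RtoC 0) by (unfold L; apply injective_projections; simpl; ring).
  pose (q := fun t => Im (Cmult (x, y) (C_derive p (L t) / p (L t)))).
  pose (nx := fun t => Re (p (L t)) / Cmod (p (L t))).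
  pose (ny := fun t => Im (p (L t)) / Cmod (p (L t))).
  assert (Hqb : forall t, 0 < t < 1 -> Rabs (q t) <= K).
  { intros t Ht. apply (ray_derivative_bound w (fun u => C_derive p u / p u)%C beta x y t); easy. }
  assert (D : forall t, 0 <= t <= 1 -> is_derive nx t (- ny t * q t) /\ is_derive ny t (nx t * q t)).
  { intros t Ht. assert (Hd := Hline x y t Hz Ht).
    destruct (Cder_radial p x y t _ (Dp _ Hd)) as [D1 D2].
    destruct (Hq _ (x, y) Hd) as [_ Q2]. assert (Eq : q t = _) by exact Q2. rewrite Eq.
    exact (is_derive_unit_vector _ _ _ _ _ D1 D2 (Hpos _ Hd)). }
  assert (HK : 0 < K) by (apply Rdiv_lt_0_compat; lra).
  assert (Hnx1 : forall t, 0 <= t <= 1 -> Rabs (nx t) <= 1).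
  { intros t Ht. assert (H0 : 0 < Cmod (p (L t))) by (apply Cmod_gt_0, Hpz, Hline; easy).
    unfold nx, Rdiv. rewrite Rabs_mult, (Rabs_pos_eq (/ _)) by (apply Rlt_le, Rinv_0_lt_compat; easy).
    apply (Rmult_le_reg_r (Cmod (p (L t)))); [easy|]. rewrite Rmult_assoc, Rinv_l by lra.
    pose proof (re_le_Cmod (p (L t))). lra. }
  assert (Hny0 : ny 0 = 0) by (unfold ny; rewrite HL0, Hp0, Cmod_1; simpl; field).
  assert (Hnx0 : nx 0 = 1) by (unfold nx; rewrite HL0, Hp0, Cmod_1; simpl; field).
  (* Two successive integrations of the rotation equations from the initial vector [(1, 0)]:
     [|ny'| <= K] bounds [ny], and then [nx' >= - K^2] bounds [nx] from below. *)
  assert (Hny : forall t, 0 < t <= 1 -> Rabs (ny t) <= K).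
  { intros t Ht. destruct (MVT_cor2 ny (fun s => nx s * q s) 0 t) as [c [Hc1 Hc2]]; [easy| |].
    { intros s Hs. apply is_derive_Reals, D. lra. }
    rewrite Hny0, !Rminus_0_r in Hc1. rewrite Hc1, !Rabs_mult.
    specialize (Hqb c ltac:(lra)). specialize (Hnx1 c ltac:(lra)).
    pose proof (Rabs_pos (q c)). pose proof (Rabs_pos (nx c)). rewrite (Rabs_pos_eq t) by lra.
    assert (Rabs (nx c) * Rabs (q c) <= 1 * K) by (apply Rmult_le_compat; lra). nra. }
  assert (Hnx : 1 - K ^ 2 <= nx 1).
  { destruct (MVT_cor2 nx (fun s => - ny s * q s) 0 1 Rlt_0_1) as [c [Hc1 Hc2]].
    { intros s Hs. apply is_derive_Reals, D. lra. }
    rewrite Hnx0 in Hc1. specialize (Hqb c Hc2). specialize (Hny c ltac:(lra)).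
    assert (Rabs (ny c * q c) <= K * K) by (rewrite Rabs_mult; apply Rmult_le_compat; try apply Rabs_pos; easy).
    apply Rabs_le_between in H. lra. }
  assert (Hny1 := Hny 1 ltac:(lra)).
  unfold nx in Hnx. unfold ny in Hny1. rewrite HL1 in Hnx, Hny1. now split.
Qed.

Lemma implication_b : implication_from subord_b beta_b.
Proof.
intros p beta Hp Hp0 Hb [Hpz [_ [_ [w [Hw [Hw0 [Hw1 Heq]]]]]]].
pose proof sine_sum_bounds as Hs. pose proof ln_5_3_bounds as Hl.
assert (Hb1 : sine_sum <= beta * ln (5 / 3)).
{ unfold beta_b in Hb. apply (Rmult_le_compat_r (ln (5 / 3))) in Hb; [|lra].
  replace (1 / ln (5 / 3) * sine_sum * ln (5 / 3)) with sine_sum in Hb by (field; lra). easy. }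
assert (Hb2 : 1.852 < beta) by nra.
assert (Hb0 : 0 < beta) by lra.
assert (Heq1 : forall z, in_disk z -> Csin (w z) = (beta * (z * (C_derive p z / p z)))%C).
{ intros z Hz. apply Cplus_1_inj. symmetry. etransitivity; [|exact (Heq z Hz)]. field. now apply Hpz. }
assert (Hsch : forall z, in_disk z -> Cmod (w z) <= Cmod z).
{ apply (schwarz_of_equation p w (fun x => / x)%C (fun x => - / (x * x))%C (fun x => 2 / (x * x * x))%C beta); try easy.
  - intros z Hz. specialize (Hpz z Hz). split; [now apply Cder_inv_id2|].
    intros E. assert (E1 : (p z * / p z)%C = 1) by (field; easy).
    rewrite E, Cmult_0_r in E1. symmetry in E1. now apply RtoC_neq_0 in E1; [|lra].
  - intros z Hz. rewrite (Heq1 z Hz). field. now apply Hpz. }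
apply subordinate_phi_Ne; [easy|easy|]. intros z Hz.
destruct (log_bounds p w beta Hb0 Hp Hp0 Hpz Hsch Heq1 z Hz) as [B1 [B2 B3]].
pose proof (SiR_lt_sine_sum z Hz).
assert (Hm : 0 < Cmod (p z)) by now apply Cmod_gt_0, Hpz.
set (m := Cmod (p z)) in *.
assert (HL : Rabs (ln m) < ln (5 / 3)) by nra.
apply Rabs_def2 in HL.
assert (Hm1 : m < 5 / 3) by (apply ln_lt_inv; lra).
assert (Hm2 : 3 / 5 < m).
{ apply ln_lt_inv; try lra. replace (3 / 5) with (/ (5 / 3)) by field. rewrite ln_Rinv by lra. lra. }
(* With [3/5 < m < 5/3] this gives [|Im p| <= 0.6386 * 5/3 < 1.065]. Also [1 - 0.6386^2 >= 0.59], so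
   [Re p > 0.59 * 3/5 > 1/3]. *)
assert (HK : 1.182 / beta < 0.6386).
{ apply (Rmult_lt_reg_r beta); [easy|]. unfold Rdiv. rewrite Rmult_assoc, Rinv_l by lra. lra. }
assert (HK0 : 0 < 1.182 / beta) by (apply Rdiv_lt_0_compat; lra).
set (nx := Re (p z) / m) in *. set (ny := Im (p z) / m) in *.
assert (Ex : Re (p z) = nx * m) by (unfold nx; field; lra).
assert (Ey : Im (p z) = ny * m) by (unfold ny; field; lra).
assert (Hnx : 0.59 <= nx) by nra.
assert (Hnx1 : nx <= 1).
{ apply (Rmult_le_reg_r m); [easy|]. rewrite <- Ex. pose proof (re_le_Cmod (p z)). fold m in H0.
  pose proof (Rle_abs (Re (p z))). lra. }
split.
- rewrite Ex. apply Rabs_def1; nra.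
- rewrite Ey, Rabs_mult, (Rabs_pos_eq m) by lra. pose proof (Rabs_pos ny). nra.
Qed.

(** * Sharpness *)

Lemma Cmod_Cexp_le (a : C) : Cmod (Cexp a) <= exp (Cmod a).
Proof.
destruct a as [x y].
assert (E : Cmod (Cexp (x, y)) = exp x).
{ assert (H := Cmod2_alt (Cexp (x, y))). unfold Cexp, Re, Im in H; simpl fst in H; simpl snd in H.
  pose proof (sin2_cos2 y) as T. unfold Rsqr in T. pose proof (exp_pos x).
  pose proof (Cmod_ge_0 (Cexp (x, y))). unfold Cexp, Re, Im in *; simpl fst in *; simpl snd in *.
  assert (Cmod (exp x * cos y, exp x * sin y) ^ 2 = exp x ^ 2).
  { rewrite H. transitivity (exp x ^ 2 * (sin y * sin y + cos y * cos y)); [ring|]. rewrite T. ring. }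
  nra. }
rewrite E. pose proof (re_le_Cmod (x, y)) as H. simpl in H. pose proof (Rle_abs x).
destruct (Rle_lt_or_eq_dec x (Cmod (x, y))) as [Hl|<-]; [lra|now apply Rlt_le, exp_increasing|lra].
Qed.

(** The remainder is explicit and depends on [a] only through [exp |a|], so that it can be
    integrated over a segment when [Si] is differentiated. Both exponentials are split by the
    addition law. *)
Lemma Csin_second_order (a b : C) : Cmod b <= / 2 ->
  Cmod (Csin (a + b) - Csin a - b * Ccos a) <= 4 * exp (Cmod a) * Cmod b ^ 2.
Proof.
intros Hb.
set (P := (Cexp (Ci * a) * (Cexp (Ci * b) - 1 - Ci * b))%C).
set (Q := (Cexp (- (Ci * a)) * (Cexp (- (Ci * b)) - 1 - - (Ci * b)))%C).
assert (E : (Csin (a + b) - Csin a - b * Ccos a)%C = ((P - Q) / (2 * Ci))%C).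
{ unfold P, Q, Csin, Ccos.
  replace (Ci * (a + b))%C with (Ci * a + Ci * b)%C by ring.
  replace (- (Ci * a + Ci * b))%C with (- (Ci * a) + - (Ci * b))%C by ring.
  rewrite !Cexp_plus. field. apply Ci_neq_0. }
rewrite E, Cmod_div by (apply Cmult_neq_0; [apply C2_neq_0|apply Ci_neq_0]).
rewrite Cmod_mult, Cmod_Ci, Cmod_R, Rabs_pos_eq by lra.
assert (T := Cmod_triangle P (- Q)). rewrite Cmod_opp in T.
assert (Hexp : forall c, Cmod c = Cmod a -> Cmod (Cexp c) <= exp (Cmod a)) by (intros c <-; apply Cmod_Cexp_le).
assert (Hsec : forall c, Cmod c = Cmod b -> Cmod (Cexp c - 1 - c) <= 4 * Cmod b ^ 2).
{ intros c Hc. rewrite <- Hc. apply Cexp_second_order. lra. }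
assert (HP : Cmod P <= exp (Cmod a) * (4 * Cmod b ^ 2)).
{ unfold P. rewrite Cmod_mult. apply Rmult_le_compat; try apply Cmod_ge_0.
  - apply Hexp. rewrite Cmod_mult, Cmod_Ci. ring.
  - apply Hsec. rewrite Cmod_mult, Cmod_Ci. ring. }
assert (HQ : Cmod Q <= exp (Cmod a) * (4 * Cmod b ^ 2)).
{ unfold Q. rewrite Cmod_mult. apply Rmult_le_compat; try apply Cmod_ge_0.
  - apply Hexp. rewrite Cmod_opp, Cmod_mult, Cmod_Ci. ring.
  - apply Hsec. rewrite Cmod_opp, Cmod_mult, Cmod_Ci. ring. }
unfold Cminus. lra.
Qed.

Definition sinc (u : C) : C := if excluded_middle_informative (u = RtoC 0) then RtoC 1 else (Csin u / u)%C.

Lemma sinc_0 : sinc 0 = 1.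
Proof. unfold sinc. now destruct (excluded_middle_informative _). Qed.

Lemma Csin_RtoC (x : R) : Csin x = RtoC (sin x).
Proof.
unfold RtoC at 1. rewrite Csin_pair, cosh_0, sinh_0. apply injective_projections; simpl; ring.
Qed.

Lemma Csin_0 : Csin 0 = 0.
Proof. now rewrite Csin_RtoC, sin_0. Qed.

Lemma Ccos_0 : Ccos 0 = 1.
Proof.
unfold RtoC at 1. rewrite Ccos_pair, sin_0, cos_0, cosh_0. apply injective_projections; simpl; ring.
Qed.

Lemma mult_sinc (u : C) : (u * sinc u)%C = Csin u.
Proof.
unfold sinc. destruct (excluded_middle_informative _) as [->|H].
- rewrite Csin_0. ring.
- field. exact H.
Qed.

Lemma sinc_continuous (u : C) :
  forall eps, 0 < eps -> exists d, 0 < d /\ forall y, Cmod (y - u) < d -> Cmod (sinc y - sinc u) < eps.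
Proof.
destruct (excluded_middle_informative (u = RtoC 0)) as [->|Hu].
- intros eps He. exists (Rmin (/ 2) (eps / 4)). split; [apply Rmin_glb_lt; lra|].
  intros y Hy. replace (y - 0)%C with y in Hy by ring.
  assert (Hy1 := Rlt_le_trans _ _ _ Hy (Rmin_l _ _)).
  assert (Hy2 := Rlt_le_trans _ _ _ Hy (Rmin_r _ _)).
  rewrite sinc_0. unfold sinc. destruct (excluded_middle_informative _) as [_|H].
  + replace (1 - 1)%C with (RtoC 0) by ring. now rewrite Cmod_0.
  + assert (K := Csin_second_order 0 y (Rlt_le _ _ Hy1)).
    rewrite Csin_0, Cmod_0, exp_0 in K.
    rewrite Ccos_0, Cplus_0_l in K.
    replace (Csin y / y - 1)%C with ((Csin y - 0 - y * 1) / y)%C by (field; easy).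
    assert (0 < Cmod y) by now apply Cmod_gt_0.
    rewrite Cmod_div by easy. apply (Rmult_lt_reg_r (Cmod y)); [easy|].
    unfold Rdiv. rewrite Rmult_assoc, Rinv_l by lra. nra.
- assert (D : Cder sinc u ((Ccos u * u - Csin u * 1) / (u * u))%C).
  { apply (Cder_ext_near (fun x => Csin x / x)%C sinc u _ (Cmod u)).
    - now apply Cmod_gt_0.
    - intros y Hy. unfold sinc. destruct (excluded_middle_informative _) as [->|H]; [|easy].
      replace (0 - u)%C with (- u)%C in Hy by ring. rewrite Cmod_opp in Hy. lra.
    - apply (Cder_div Csin (fun x => x)); [apply Cder_Csin|apply Cder_id|easy]. }
  exact (Cder_cont _ _ _ D).
Qed.

(** The integrand of the complex sine integral over the segment from 0 to [z], parametrized by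
    [t * z]; all values of [Si] become integrals over the same interval. *)
Definition Si_kernel (z : C) (t : R) : C := (z * sinc (t * z))%C.

Definition Si (z : C) : C :=
  (RInt (fun t => Re (Si_kernel z t)) 0 1, RInt (fun t => Im (Si_kernel z t)) 0 1).

Lemma Si_kernel_ex_RInt (z : C) :
  ex_RInt (fun t => Re (Si_kernel z t)) 0 1 /\ ex_RInt (fun t => Im (Si_kernel z t)) 0 1.
Proof.
assert (H : forall t : R, forall eps, 0 < eps -> exists d, 0 < d /\ forall s, Rabs (s - t) < d ->
  Cmod (Si_kernel z s - Si_kernel z t) < eps).
{ intros t eps He. pose proof (Cmod_ge_0 z).
  destruct (sinc_continuous (t * z)%C (eps / (1 + Cmod z))) as [d [Hd K]]; [apply Rdiv_lt_0_compat; lra|].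
  exists (d / (1 + Cmod z)). split; [apply Rdiv_lt_0_compat; lra|]. intros s Hs.
  unfold Si_kernel. replace (z * sinc (s * z) - z * sinc (t * z))%C with (z * (sinc (s * z) - sinc (t * z)))%C by ring.
  rewrite Cmod_mult.
  assert (Hst : Cmod (s * z - t * z) < d).
  { replace (s * z - t * z)%C with (RtoC (s - t) * z)%C by (rewrite RtoC_minus; ring).
    rewrite Cmod_mult, Cmod_R. apply (Rmult_lt_compat_r (1 + Cmod z)) in Hs; [|lra].
    unfold Rdiv in Hs. rewrite Rmult_assoc, Rinv_l, Rmult_1_r in Hs by lra.
    pose proof (Rabs_pos (s - t)). nra. }
  specialize (K _ Hst). apply (Rmult_lt_compat_r (1 + Cmod z)) in K; [|lra].
  unfold Rdiv in K. rewrite Rmult_assoc, Rinv_l, Rmult_1_r in K by lra.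
  pose proof (Cmod_ge_0 (sinc (s * z) - sinc (t * z))). nra. }
assert (Hcont : forall (part : C -> R) t, (forall a b, Rabs (part a - part b) <= Cmod (a - b)) ->
  continuous (fun t => part (Si_kernel z t)) t).
{ intros part t Hp P [eps HP]. destruct (H t eps (cond_pos eps)) as [d [Hd K]].
  exists (mkposreal d Hd). intros s Hs. apply HP.
  apply Rle_lt_trans with (1 := Hp _ _). now apply K. }
split; apply (ex_RInt_continuous (V := R_CompleteNormedModule)); intros t _; apply Hcont; intros a b.
- apply (re_le_Cmod (a - b)).
- apply (Im_le_Cmod (a - b)).
Qed.

Lemma is_RInt_const_unit (c : R) : is_RInt (fun _ => c) 0 1 c.
Proof.
refine (eq_ind _ (is_RInt (fun _ => c) 0 1) (is_RInt_const (V := R_NormedModule) 0 1 c) c _).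
unfold scal; simpl; unfold mult; simpl. ring.
Qed.

(** [Ccos (t * z)] is the derivative of [Si_kernel] in [z], because the kernel equals
    [sin (t z) / t]. Its integral over [t] identifies the derivative of [Si] as [sinc]. *)
Lemma Ccos_RInt (z h : C) :
  is_RInt (fun t : R => Re (h * Ccos (t * z))%C) 0 1 (Re (h * sinc z)%C) /\
  is_RInt (fun t : R => Im (h * Ccos (t * z))%C) 0 1 (Im (h * sinc z)%C).
Proof.
destruct z as [x y].
assert (EL : forall t : R, (t * (x, y))%C = (0 + t * x, 0 + t * y))
  by (intros t; apply injective_projections; simpl; ring).
assert (Hc : forall t : R, continuous (fun t : R => Re (h * Ccos (t * (x, y)))%C) t /\
   continuous (fun t : R => Im (h * Ccos (t * (x, y)))%C) t).
{ intros t.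
  assert (D : Cder (fun u => h * Ccos u)%C (0 + t * x, 0 + t * y) (0 * Ccos (t * (x, y)) + h * - Csin (t * (x, y)))%C).
  { rewrite EL. apply Cder_mult; [apply Cder_const|apply Cder_Ccos]. }
  destruct (Cder_radial _ x y t _ D) as [D1 D2].
  split; apply (ex_derive_continuous (K := R_AbsRing) (V := R_NormedModule)); eexists;
   [eapply is_derive_ext; [|exact D1]|eapply is_derive_ext; [|exact D2]]; intros s; cbv beta; rewrite EL; reflexivity. }
destruct (excluded_middle_informative ((x, y) = RtoC 0)) as [E0|Hz].
- rewrite E0, sinc_0, Cmult_1_r.
  assert (Hc1 : forall t : R, (h * Ccos (t * 0))%C = h).
  { intros t. rewrite Cmult_0_r, Ccos_0. ring. }
  split.
  + apply (is_RInt_ext (fun _ => Re h)); [intros t _; now rewrite Hc1|apply is_RInt_const_unit].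
  + apply (is_RInt_ext (fun _ => Im h)); [intros t _; now rewrite Hc1|apply is_RInt_const_unit].
- pose (f := fun u => (h * / (x, y) * Csin u)%C).
  assert (D : forall t : R, Cder f (0 + t * x, 0 + t * y) (h * / (x, y) * Ccos (t * (x, y)))%C).
  { intros t. rewrite EL. refine (Cder_eq _ _ _ _ _ (Cder_mult _ _ _ _ _ (Cder_const (h * / (x, y))%C _) (Cder_Csin _))). ring. }
  assert (Em : forall t : R, Cmult (x, y) (h * / (x, y) * Ccos (t * (x, y)))%C = (h * Ccos (t * (x, y)))%C).
  { intros t. set (z := (x, y) : C) in *. field. exact Hz. }
  assert (F1 : f (0 + 1 * x, 0 + 1 * y) = (h * sinc (x, y))%C).
  { rewrite <- EL. unfold f, sinc. destruct (excluded_middle_informative _) as [E|_]; [easy|].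
    rewrite Cmult_1_l. unfold Cdiv. ring. }
  assert (F0 : f (0 + 0 * x, 0 + 0 * y) = 0).
  { rewrite <- EL. unfold f. rewrite Cmult_0_l, Csin_0. ring. }
  split.
  + assert (H1 : forall t, Rmin 0 1 <= t <= Rmax 0 1 ->
      is_derive (fun t => Re (f (0 + t * x, 0 + t * y))) t (Re (h * Ccos (t * (x, y)))%C)).
    { intros t _. rewrite <- Em. now apply Cder_radial. }
    refine (eq_ind _ (is_RInt (fun t : R => Re (h * Ccos (t * (x, y)))%C) 0 1)
      (is_RInt_derive _ _ 0 1 H1 (fun t _ => proj1 (Hc t))) _ _).
    rewrite F0, F1. unfold minus, plus, opp; simpl; ring.
  + assert (H2 : forall t, Rmin 0 1 <= t <= Rmax 0 1 ->
      is_derive (fun t => Im (f (0 + t * x, 0 + t * y))) t (Im (h * Ccos (t * (x, y)))%C)).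
    { intros t _. rewrite <- Em. now apply Cder_radial. }
    refine (eq_ind _ (is_RInt (fun t : R => Im (h * Ccos (t * (x, y)))%C) 0 1)
      (is_RInt_derive _ _ 0 1 H2 (fun t _ => proj2 (Hc t))) _ _).
    rewrite F0, F1. unfold minus, plus, opp; simpl; ring.
Qed.

(** For [t > 0] the kernel is [sin (t z) / t]. The quadratic sine remainder carries [t^2], so the
    division by [t] costs nothing and the bound is uniform in [t]; at 0 the difference is exactly
    0. *)
Lemma Si_kernel_second_order (z h : C) (t : R) : 0 <= t <= 1 -> Cmod h <= / 2 ->
  Cmod (Si_kernel (z + h) t - Si_kernel z t - h * Ccos (t * z)) <= 4 * exp (Cmod z) * Cmod h ^ 2.
Proof.
intros Ht Hh.
pose proof (exp_pos (Cmod z)). pose proof (Cmod_ge_0 h). pose proof (Cmod_ge_0 z).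
assert (HR : 0 <= 4 * exp (Cmod z) * Cmod h ^ 2) by (apply Rmult_le_pos; [lra|apply pow2_ge_0]).
destruct (Rle_lt_or_eq_dec _ _ (proj1 Ht)) as [Hp|<-].
- assert (Ht0 : RtoC t <> 0) by (apply RtoC_neq_0; lra).
  assert (Hk : forall u, Si_kernel u t = (Csin (t * u) / t)%C).
  { intros u. rewrite <- mult_sinc. unfold Si_kernel. field. exact Ht0. }
  rewrite !Hk.
  replace (Csin (t * (z + h)) / t - Csin (t * z) / t - h * Ccos (t * z))%C with
    ((Csin (t * z + t * h) - Csin (t * z) - (t * h) * Ccos (t * z)) / t)%C.
  2:{ replace (t * (z + h))%C with (t * z + t * h)%C by ring. field. exact Ht0. }
  assert (Hm : forall u, Cmod (t * u) = t * Cmod u) by (intros u; rewrite Cmod_mult, Cmod_R, Rabs_pos_eq by lra; easy).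
  assert (K := Csin_second_order (t * z) (t * h) ltac:(rewrite Hm; nra)).
  rewrite !Hm in K. rewrite Cmod_div, Cmod_R, Rabs_pos_eq by (easy || lra).
  apply (Rmult_le_reg_r t); [easy|]. unfold Rdiv. rewrite Rmult_assoc, Rinv_l, Rmult_1_r by lra.
  apply Rle_trans with (1 := K).
  assert (He : exp (t * Cmod z) <= exp (Cmod z)).
  { destruct (Req_dec (t * Cmod z) (Cmod z)) as [->|Hne]; [lra|]. apply Rlt_le, exp_increasing. nra. }
  replace (4 * exp (Cmod z) * Cmod h ^ 2 * t) with (4 * exp (Cmod z) * (t * Cmod h ^ 2)) by ring.
  apply Rmult_le_compat; try lra.
  + pose proof (exp_pos (t * Cmod z)). lra.
  + apply pow2_ge_0.
  + pose proof (pow2_ge_0 (Cmod h)). nra.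
- unfold Si_kernel. rewrite !Cmult_0_l, sinc_0, Ccos_0.
  replace ((z + h) * 1 - z * 1 - h * 1)%C with (RtoC 0) by ring.
  now rewrite Cmod_0.
Qed.

Lemma Cder_Si (z : C) : Cder Si z (sinc z).
Proof.
apply Cder_eps. intros eps He.
pose proof (exp_pos (Cmod z)) as Hez.
(* Twice the constant of the kernel estimate, since the integrals of the real and imaginary parts
   are bounded separately and added. *)
set (M := 8 * exp (Cmod z)). assert (HM : 0 < M) by (unfold M; lra).
exists (Rmin (/ 2) (eps / M)). split; [apply Rmin_glb_lt; [lra|now apply Rdiv_lt_0_compat]|].
intros y Hy.
assert (Hy1 := Rlt_le_trans _ _ _ Hy (Rmin_l _ _)).
assert (Hy2 := Rlt_le_trans _ _ _ Hy (Rmin_r _ _)).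
set (h := (y - z)%C) in *. assert (Ey : y = (z + h)%C) by (unfold h; ring).
destruct (Si_kernel_ex_RInt z) as [Z1 Z2]. destruct (Si_kernel_ex_RInt (z + h)%C) as [Y1 Y2].
destruct (Ccos_RInt z h) as [C1 C2].
assert (I1 := is_RInt_minus _ _ _ _ _ _ (is_RInt_minus _ _ _ _ _ _ (RInt_correct _ _ _ Y1) (RInt_correct _ _ _ Z1)) C1).
assert (I2 := is_RInt_minus _ _ _ _ _ _ (is_RInt_minus _ _ _ _ _ _ (RInt_correct _ _ _ Y2) (RInt_correct _ _ _ Z2)) C2).
apply (norm_RInt_le_const _ _ _ _ (4 * exp (Cmod z) * Cmod h ^ 2) Rle_0_1) in I1.
2:{ intros t Ht. eapply Rle_trans; [|exact (Si_kernel_second_order z h t Ht (Rlt_le _ _ Hy1))].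
    eapply Rle_trans; [|apply re_le_Cmod]. apply Req_le. reflexivity. }
apply (norm_RInt_le_const _ _ _ _ (4 * exp (Cmod z) * Cmod h ^ 2) Rle_0_1) in I2.
2:{ intros t Ht. eapply Rle_trans; [|exact (Si_kernel_second_order z h t Ht (Rlt_le _ _ Hy1))].
    eapply Rle_trans; [|apply Im_le_Cmod]. apply Req_le. reflexivity. }
assert (Hle : Cmod (Si y - Si z - h * sinc z) <= M * Cmod h ^ 2).
{ eapply Rle_trans; [apply Cmod_le_sum|].
  unfold M. replace (8 * exp (Cmod z) * Cmod h ^ 2) with ((1 - 0) * (4 * exp (Cmod z) * Cmod h ^ 2) + (1 - 0) * (4 * exp (Cmod z) * Cmod h ^ 2)) by ring.
  apply Rplus_le_compat.
  - eapply Rle_trans; [|exact I1]. rewrite Ey. apply Req_le. reflexivity.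
  - eapply Rle_trans; [|exact I2]. rewrite Ey. apply Req_le. reflexivity. }
apply Rle_trans with (1 := Hle).
apply (Rmult_lt_compat_r M) in Hy2; [|easy]. unfold Rdiv in Hy2. rewrite Rmult_assoc, Rinv_l, Rmult_1_r in Hy2 by lra.
pose proof (Cmod_ge_0 h). nra.
Qed.

Lemma Si_0 : Si 0 = 0.
Proof.
assert (K : forall t, Si_kernel 0 t = 0) by (intros t; apply Cmult_0_l).
unfold Si. apply injective_projections; apply is_RInt_unique;
  (apply (is_RInt_ext (fun _ => 0)); [intros t _; now rewrite K|apply is_RInt_const_unit]).
Qed.

Lemma Si_real (x : R) : 0 < x -> Si x = RtoC (SiR x).
Proof.
intros Hx.
assert (Hs : forall t, 0 < t -> sinc t = RtoC (sincR t)).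
{ intros t Ht. assert (Ht0 : RtoC t <> 0) by (apply RtoC_neq_0; lra).
  unfold sinc. destruct (excluded_middle_informative _) as [|_]; [easy|].
  rewrite Csin_RtoC, sin_sincR, RtoC_mult. field. exact Ht0. }
assert (D : forall t, is_derive (fun s => Re (Si (0 + s * 1, 0 + s * 0))) t (Re (Cmult (1, 0) (sinc (0 + t * 1, 0 + t * 0)))) /\
  is_derive (fun s => Im (Si (0 + s * 1, 0 + s * 0))) t (Im (Cmult (1, 0) (sinc (0 + t * 1, 0 + t * 0)))))
  by (intros t; apply Cder_radial, Cder_Si).
assert (E : forall t, (0 + t * 1, 0 + t * 0) = RtoC t) by (intros; apply injective_projections; simpl; ring).
destruct (MVT_cor2 (fun t => Re (Si (0 + t * 1, 0 + t * 0)) - SiR t)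
  (fun t => Re (Cmult (1, 0) (sinc (0 + t * 1, 0 + t * 0))) - sincR t) 0 x Hx) as [c [Hc1 Hc2]].
{ intros t _. apply is_derive_Reals. 
  apply (is_derive_minus (K := R_AbsRing) (V := R_NormedModule)); [apply D|apply is_derive_SiR]. }
destruct (MVT_cor2 (fun t => Im (Si (0 + t * 1, 0 + t * 0)))
  (fun t => Im (Cmult (1, 0) (sinc (0 + t * 1, 0 + t * 0)))) 0 x Hx) as [d [Hd1 Hd2]].
{ intros t _. apply is_derive_Reals, D. }
rewrite !E in Hc1, Hd1. rewrite Hs in Hc1, Hd1 by lra. rewrite Si_0 in Hc1, Hd1. rewrite SiR_0 in Hc1.
unfold Re, Im in *. apply injective_projections; simpl in *; lra.
Qed.

Lemma SiR_approaches_sine_sum (m : R) : m < sine_sum -> exists x, 0 < x < 1 /\ m < SiR x.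
Proof.
(* The derivative [sincR] is below 1, so moving back from 1 by [d] loses less than half the gap;
   [d <= 1/2] keeps the point positive. *)
intros Hm. set (d := Rmin (/ 2) ((sine_sum - m) / 2)).
assert (Hd : 0 < d) by (apply Rmin_glb_lt; lra).
assert (Hd' : d <= / 2 /\ d <= (sine_sum - m) / 2) by (split; [apply Rmin_l|apply Rmin_r]).
exists (1 - d). split; [lra|].
destruct (MVT_cor2 SiR sincR (1 - d) 1) as [c [Hc1 Hc2]]; [lra| |].
{ intros c _. apply is_derive_Reals, is_derive_SiR. }
rewrite SiR_1 in Hc1.
assert (Hs : c * sincR c < c) by (rewrite <- sin_sincR; apply sin_lt_x; lra).
assert (sincR c < 1) by nra. nra.
Qed.

Lemma subordinate_phi_S (f : C -> C) : (forall z, in_disk z -> f z = phi_S z) -> subordinate f phi_S.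
Proof.
intros Hf.
assert (HS : forall z, Cder phi_S z (0 + Ccos z)%C).
{ intros z. apply (Cder_plus (fun _ => RtoC 1) Csin); [apply Cder_const|apply Cder_Csin]. }
split; [|split].
- intros z Hz. exists (0 + Ccos z)%C. unfold in_disk in Hz.
  apply (Cder_ext_near phi_S f z _ (1 - Cmod z)); [lra| |apply HS].
  intros y Hy. symmetry. apply Hf. unfold in_disk. replace y with (z + (y - z))%C by ring.
  eapply Rle_lt_trans; [apply Cmod_triangle|]. lra.
- intros z _. eexists. apply HS.
- exists (fun z => z). repeat split; try easy. intros z _. eexists. apply Cder_id.
Qed.

(* [5 / 3] is a cusp of the nephroid, pointing inwards. *)
Lemma not_subordinate_phi_Ne (p : C -> C) (x c : R) : 0 < x < 1 -> p x = RtoC c -> 5 / 3 <= c ->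
  ~ subordinate p phi_Ne.
Proof.
intros Hx Hp Hc [_ [_ [w [_ [_ [Hw1 Heq]]]]]].
assert (Hd : in_disk x) by (unfold in_disk; rewrite Cmod_R, Rabs_pos_eq; lra).
specialize (Hw1 _ Hd). specialize (Heq _ Hd). rewrite Hp in Heq.
destruct (w x) as [a b].
assert (H2 := Cmod2_alt (a, b)). simpl Re in H2. simpl Im in H2.
assert (Hab : a ^ 2 + b ^ 2 < 1) by (pose proof (Cmod_ge_0 (a, b)); nra).
rewrite phi_Ne_pair in Heq. injection Heq as E1 E2.
assert (Hb : b * (1 - a ^ 2 + b ^ 2 / 3) = 0) by (rewrite E2; field).
assert (b = 0).
{ apply Rmult_integral in Hb. destruct Hb as [|Hb]; [easy|]. pose proof (pow2_ge_0 b). lra. }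
subst b. assert (-1 < a < 1) by nra. nra.
Qed.

Lemma Cder_Si_scaled (beta : R) (z : C) : beta <> 0 -> Cder (fun x => Si x / beta)%C z (sinc z / beta)%C.
Proof.
intros Hb. apply RtoC_neq_0 in Hb.
refine (Cder_eq _ _ _ _ _ (Cder_div _ _ _ _ _ (Cder_Si z) (Cder_const beta z) Hb)). field. exact Hb.
Qed.

Lemma sharp_a (b : R) : b < beta_a -> ~ implication_from subord_a b.
Proof.
intros Hb Himp. pose proof sine_sum_bounds as Hs. unfold beta_a in Hb.
(* The implication covers every beta from [b] on, so it is refuted at one value in [[b, beta_a)].
   The maximum with 1 makes this value positive when [b] is not. *)
set (beta := Rmax b 1).
assert (Hbb : b <= beta) by apply Rmax_l.
assert (Hb1 : 1 <= beta) by apply Rmax_r.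
assert (Hb2 : beta < 3 / 2 * sine_sum) by (apply Rmax_lub_lt; lra).
destruct (SiR_approaches_sine_sum (2 / 3 * beta)) as [x [Hx HSx]]; [lra|].
assert (Hb0 : RtoC beta <> 0) by (apply RtoC_neq_0; lra).
pose (p := fun z => (1 + Si z / beta)%C).
assert (Dp : forall z, Cder p z (sinc z / beta)%C).
{ intros z. refine (Cder_eq _ _ _ _ _ (Cder_plus _ _ _ _ _ (Cder_const 1 z) (Cder_Si_scaled beta z ltac:(lra)))). ring. }
apply (not_subordinate_phi_Ne p x (1 + SiR x / beta) Hx).
- unfold p. rewrite Si_real, RtoC_plus, RtoC_div by lra. reflexivity.
- assert (2 / 3 <= SiR x / beta); [|lra]. apply (Rmult_le_reg_r beta); [lra|].
  unfold Rdiv at 2. rewrite Rmult_assoc, Rinv_l by lra. lra.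
- apply (Himp p beta); [intros z _; eexists; apply Dp| |easy|].
  + unfold p. rewrite Si_0. field. exact Hb0.
  + apply subordinate_phi_S. intros z _. rewrite (is_C_derive_unique _ _ _ (Dp z)).
    unfold phi_S. rewrite <- mult_sinc. field. exact Hb0.
Qed.

Lemma sharp_b (b : R) : b < beta_b -> ~ implication_from subord_b b.
Proof.
intros Hb Himp. pose proof sine_sum_bounds as Hs. pose proof ln_5_3_bounds as Hl.
unfold beta_b in Hb.
set (L := ln (5 / 3)) in *.
assert (HL : 1 / L * sine_sum * L = sine_sum) by (field; lra).
set (beta := Rmax b 1).
assert (Hbb : b <= beta) by apply Rmax_l.
assert (Hb1 : 1 <= beta) by apply Rmax_r.
assert (Hb2 : beta < 1 / L * sine_sum).
{ apply Rmax_lub_lt; [easy|]. apply (Rmult_lt_reg_r L); lra. }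
assert (Hb3 : L * beta < sine_sum) by (apply (Rmult_lt_compat_r L) in Hb2; lra).
destruct (SiR_approaches_sine_sum (L * beta) Hb3) as [x [Hx HSx]].
assert (Hb0 : RtoC beta <> 0) by (apply RtoC_neq_0; lra).
pose (p := fun z => Cexp (Si z / beta)%C).
assert (Dp : forall z, Cder p z (sinc z / beta * p z)%C).
{ intros z. apply (Cder_comp Cexp (fun z => Si z / beta)%C); [apply Cder_Cexp|]. apply Cder_Si_scaled. lra. }
apply (not_subordinate_phi_Ne p x (exp (SiR x / beta)) Hx).
- unfold p. rewrite Si_real by lra. rewrite <- RtoC_div by lra.
  unfold Cexp; simpl. rewrite sin_0, cos_0. apply injective_projections; simpl; ring.
- replace (5 / 3) with (exp L) by (apply exp_ln; lra). apply Rlt_le, exp_increasing.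
  apply (Rmult_lt_reg_r beta); [lra|]. unfold Rdiv. rewrite Rmult_assoc, Rinv_l by lra. lra.
- apply (Himp p beta); [intros z _; eexists; apply Dp| |easy|split].
  + unfold p. rewrite Si_0. replace (0 / beta)%C with (RtoC 0) by (field; exact Hb0).
    unfold Cexp; simpl. rewrite exp_0, sin_0, cos_0. apply injective_projections; simpl; ring.
  + intros z _. apply Cexp_neq_0.
  + apply subordinate_phi_S. intros z _. rewrite (is_C_derive_unique _ _ _ (Dp z)).
    unfold phi_S. rewrite <- mult_sinc. field. split; [exact Hb0|apply Cexp_neq_0].
Qed.

(** The growth estimate applied to the extremal function itself: [w z = z] and beta equal to 1. *)
Lemma Re_Si_bound (z : C) : in_disk z -> Rabs (Re (Si z)) < sine_sum.
Proof.
intros Hz. apply Rle_lt_trans with (2 := SiR_lt_sine_sum z Hz).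
rewrite <- (Rmult_1_l (Rabs _)).
apply (primitive_bounds Si sinc (fun x => x) 1 Rlt_0_1); try easy.
- intros x _. apply Cder_Si.
- apply Si_0.
- intros x _. now rewrite mult_sinc, Cmult_1_l.
Qed.

Lemma sharp_c (b : R) : b < beta_c -> ~ implication_from subord_c b.
Proof.
intros Hb Himp. pose proof sine_sum_bounds as Hs. unfold beta_c in Hb.
(* The lower bound 2 exceeds [sine_sum], so [Re_Si_bound] excludes [Si z = beta] and the denominator
   [1 - Si / beta] has no zero in the disk; it still lies below the critical value 2.365. *)
set (beta := Rmax b 2).
assert (Hbb : b <= beta) by apply Rmax_l.
assert (Hb1 : 2 <= beta) by apply Rmax_r.
assert (Hb2 : beta < 5 / 2 * sine_sum) by (apply Rmax_lub_lt; lra).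
destruct (SiR_approaches_sine_sum (2 / 5 * beta)) as [x [Hx HSx]]; [lra|].
assert (Hb0 : RtoC beta <> 0) by (apply RtoC_neq_0; lra).
pose (q := fun z => (1 - Si z / beta)%C).
pose (p := fun z => (/ q z)%C).
assert (Dq : forall z, Cder q z (- (sinc z / beta))%C).
{ intros z. refine (Cder_eq _ _ _ _ _ (Cder_minus _ _ _ _ _ (Cder_const 1 z) (Cder_Si_scaled beta z ltac:(lra)))). ring. }
assert (Hq : forall z, in_disk z -> q z <> 0).
{ intros z Hz E. assert (H := Re_Si_bound z Hz). apply Rabs_def2 in H.
  assert (E1 : Si z = RtoC beta).
  { replace (Si z) with (beta * (1 - q z))%C by (unfold q; field; exact Hb0). rewrite E. ring. }
  rewrite E1 in H. simpl in H. lra. }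
assert (Hp : forall z, in_disk z -> p z <> 0).
{ intros z Hz E. specialize (Hq z Hz).
  assert (E1 : (q z * p z)%C = 1) by (unfold p; field; exact Hq).
  rewrite E, Cmult_0_r in E1. symmetry in E1. now apply RtoC_neq_0 in E1; [|lra]. }
assert (Dp : forall z, in_disk z -> Cder p z (- - (sinc z / beta) / (q z * q z))%C).
{ intros z Hz. apply (Cder_inv q); [apply Dq|now apply Hq]. }
assert (Hxb : 2 / 5 <= SiR x / beta < 1 / 2).
{ assert (SiR x < 1).
  { apply Rlt_trans with sine_sum; [|lra]. rewrite <- SiR_1. apply SiR_increasing; lra. }
  assert (E : SiR x / beta * beta = SiR x) by (field; lra).
  split; [apply (Rmult_le_reg_r beta)|apply (Rmult_lt_reg_r beta)]; lra. }
apply (not_subordinate_phi_Ne p x (/ (1 - SiR x / beta)) Hx).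
- unfold p, q. rewrite Si_real, RtoC_inv, RtoC_minus, RtoC_div by lra. reflexivity.
- replace (5 / 3) with (/ (3 / 5)) by field. apply Rinv_le_contravar; lra.
- apply (Himp p beta); [intros z Hz; eexists; now apply Dp| |easy|split].
  + unfold p, q. rewrite Si_0. field. exact Hb0.
  + exact Hp.
  + apply subordinate_phi_S. intros z Hz. rewrite (is_C_derive_unique _ _ _ (Dp z Hz)).
    unfold phi_S. rewrite <- mult_sinc. unfold p. simpl. field. split; [now apply Hq|exact Hb0].
Qed.

Theorem theorem3p4 :
  (implication_from subord_a beta_a /\
   implication_from subord_b beta_b /\
   implication_from subord_c beta_c) /\
  ((forall b : R, b < beta_a -> ~ implication_from subord_a b) /\
   (forall b : R, b < beta_b -> ~ implication_from subord_b b) /\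
   (forall b : R, b < beta_c -> ~ implication_from subord_c b)) /\
  (Rabs (beta_a - 1.41912) <= 0.000005 /\
   Rabs (beta_b - 1.85207) <= 0.000005 /\
   Rabs (beta_c - 2.36521) <= 0.000005).
Proof.
split; [|split].
- exact (conj implication_a (conj implication_b implication_c)).
- exact (conj sharp_a (conj sharp_b sharp_c)).
- exact beta_numerics.
Qed.
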